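(* Let $G$ be a $2\times2$ matrix function invertible in $APW^{2\times2}$, and denote $\delta=\kappa(\det G)$. Then $G$ admits an $APW$ factorization if and only if the Riemann-Hilbert problem $$e_{-\delta/2}\,G\psi_+=\psi_-,\qquad \psi_\pm\in(APW^\pm)^2$$ admits a solution $(\psi_+,\psi_-)$ such that $$\tilde\psi_+:=e_{-\tilde\delta}\psi_+\in CP^+\ \text{ for some } \tilde\delta\ge0,\quad\text{and}\quad \psi_-\in CP^-.$$ If this is the case, then the partial $AP$ indices of $G$ are $\delta_1=-\tilde\delta+\frac{\delta}{2}$, $\delta_2=\tilde\delta+\frac{\delta}{2}$, and the factors $G_\pm$ can be chosen in such a way that $\tilde\psi_+$ is the first column of $G_+$ and $\psi_-$ is the first column of $G_-$.
   Context: $H_\infty^\pm$ is the Hardy class of bounded analytic functions in $\mathbb{C}^\pm=\{z:\pm\mathrm{Im}\, z>0\}$, identified with boundary values on $\mathbb{R}$. $e_\lambda(x)=e^{i\lambda x}$, $\lambda\in\mathbb{R}$. $AP$ is the uniform closure of the set of finite linear combinations of the $e_\lambda$; for $f\in AP$, $M(f)=\lim_{T\to\infty}\frac1{2T}\int_{-T}^Tf(t)\,dt$, $\widehat f(\lambda)=M(e_{-\lambda}f)$, $\Omega(f)=\{\lambda\in\mathbb{R}:\widehat f(\lambda)\ne0\}$. $APW$ is the set of $f\in AP$ whose Bohr-Fourier series $\sum_{\lambda\in\Omega(f)}\widehat f(\lambda)e_\lambda$ converges absolutely; $APW^\pm=\{f\in APW:\Omega(f)\subset\mathbb{R}_\pm\}$,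 $\mathbb{R}_\pm=\{x:\pm x\ge0\}$. For $f$ invertible in $AP$, the mean motion $\kappa(f)$ is the unique $\lambda\in\mathbb{R}$ such that a continuous branch of $\log(e_{-\lambda}f)$ belongs to $AP$. An $APW$ factorization of $G$ is a representation $G=G_-DG_+^{-1}$ with $G_+^{\pm1}\in(APW^+)^{2\times2}$, $G_-^{\pm1}\in(APW^-)^{2\times2}$, $D=\mathrm{diag}[e_{\delta_1},e_{\delta_2}]$, $\delta_j\in\mathbb{R}$; the numbers $\delta_1\le\delta_2$ are the partial $AP$ indices of $G$. A vector $\omega\in(H_\infty^\pm)^2$ is in $CP^\pm$ if $\inf_{z\in\mathbb{C}^\pm}(|\omega_1(z)|+|\omega_2(z)|)>0$. *)

(* Defs.v *)
From HB Require Import structures.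
From mathcomp Require Import all_boot all_order all_algebra.
From mathcomp Require Import all_classical all_reals all_analysis.
From mathcomp Require Import complex.
Set Implicit Arguments.
Unset Strict Implicit.
Unset Printing Implicit Defensive.
Import Order.TTheory GRing.Theory Num.Theory numFieldNormedType.Exports.
Local Open Scope classical_set_scope.
Local Open Scope ring_scope.
Local Open Scope complex_scope.

(* Topological notions on the complex numbers use R[i]^o, the complex numbers
   as a normed module over themselves. *)

Section Defs.
Variable R : realType.
Local Notation C := R[i].

Definition cexp (z : C) : C :=
  (expR (complex.Re z))%:C * (cos (complex.Im z) +i* sin (complex.Im z)).

(* The real-valued modulus; `|z| itself has type C. *)
Definition cabs (z : C) : R := complex.Re `|z|.

Definition e_ (l : R) (x : R) : C := cexp ('i * (l * x)%:C).

Definition trig_poly (p : R -> C) : Prop :=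
  exists s : seq (C * R), forall x, p x = \sum_(t <- s) t.1 * e_ t.2 x.

Definition AP (f : R -> C) : Prop :=
  forall eps : R, 0 < eps ->
    exists2 p, trig_poly p & forall x, cabs (f x - p x) <= eps.

Definition average (f : R -> C) (T : R) : C :=
  ((2 * T)^-1)%:C *
  ((\int[lebesgue_measure]_(t in `[- T, T]) complex.Re (f t)) +i*
   (\int[lebesgue_measure]_(t in `[- T, T]) complex.Im (f t))).

(* The limit exists whenever f is in AP. *)
Definition bohr_mean (f : R -> C) : C :=
  lim ((average f T : R[i]^o) @[T --> +oo%R]).

Definition bohr_coef (f : R -> C) (l : R) : C :=
  bohr_mean (fun x => e_ (- l) x * f x).

Definition bohr_spectrum (f : R -> C) : set R :=
  [set l | bohr_coef f l != 0].

(* Since |e_l| = 1, absolute convergence of the Bohr-Fourier series is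
   summability of its coefficients over the spectrum. *)
Definition APW (f : R -> C) : Prop :=
  AP f /\ summable (bohr_spectrum f) (fun l => (cabs (bohr_coef f l))%:E).

Definition APWp (f : R -> C) : Prop :=
  APW f /\ bohr_spectrum f `<=` [set l | 0 <= l].

Definition APWm (f : R -> C) : Prop :=
  APW f /\ bohr_spectrum f `<=` [set l | l <= 0].

(* l is the mean motion of f: g is a continuous branch of log (e_{-l} f)
   belonging to AP (elements of AP are continuous). Such a g makes f invertible
   in AP, and l is determined by f. *)
Definition mean_motion (f : R -> C) (l : R) : Prop :=
  exists2 g, AP g & forall x, cexp (g x) = e_ (- l) x * f x.

Definition mx_in (P : (R -> C) -> Prop) m n (G : R -> 'M[C]_(m, n)) : Prop :=
  forall i j, P (fun x => G x i j).

(* The unit condition is needed because invmx A = A for a singular A. *)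
Definition invertible_in (P : (R -> C) -> Prop) n (G : R -> 'M[C]_n) : Prop :=
  [/\ mx_in P G, forall x, G x \in unitmx & mx_in P (fun x => invmx (G x))].

Definition diag_e (d1 d2 : R) (x : R) : 'M[C]_2 :=
  diag_mx (\row_j (if j == 0 then e_ d1 x else e_ d2 x)).

Definition APW_factorization (G Gm Gp : R -> 'M[C]_2) (d1 d2 : R) : Prop :=
  [/\ invertible_in APWp Gp,
      invertible_in APWm Gm &
      forall x, G x = Gm x *m diag_e d1 d2 x *m invmx (Gp x)].

Definition has_APW_factorization (G : R -> 'M[C]_2) : Prop :=
  exists Gm Gp d1 d2, APW_factorization G Gm Gp d1 d2.

(* The diagonal factor may list the exponents in either order. *)
Definition partial_AP_indices (G : R -> 'M[C]_2) (d1 d2 : R) : Prop :=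
  d1 <= d2 /\
  exists Gm Gp, APW_factorization G Gm Gp d1 d2 \/
                APW_factorization G Gm Gp d2 d1.

Definition Cplus : set C := [set z | 0 < complex.Im z].
Definition Cminus : set C := [set z | complex.Im z < 0].

Definition bounded_analytic (U : set C) (F : C -> C) : Prop :=
  (forall z, U z -> derivable (F : R[i]^o -> R[i]^o) z 1) /\
  (exists B : R, forall z, U z -> cabs (F z) <= B).

Definition stolz (U : set C) (a x : R) : set C :=
  [set z | U z /\ `|complex.Re z - x| < a * `|complex.Im z|].

(* An element of a Hardy class on U (one of the two half-planes) is identified
   with its almost everywhere nontangential limits, which determine it; hence
   the extension F quantified in CP below is unique. *)
Definition boundary_value (U : set C) (F : C -> C) (f : R -> C) : Prop :=
  {ae (@lebesgue_measure R), forall x, forall a : R, 0 < a ->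
    ((F : R[i]^o -> R[i]^o) @ within (stolz U a x) (nbhs (x%:C : R[i]^o)))
      --> (f x : R[i]^o)}.

Definition CP (U : set C) (w : R -> 'cV[C]_2) : Prop :=
  exists F : 'I_2 -> C -> C,
    (forall j, bounded_analytic U (F j) /\
               boundary_value U (F j) (fun x => w x j 0)) /\
    0 < inf [set cabs (F 0 z) + cabs (F 1 z) | z in U].

Definition RH_solution (G : R -> 'M[C]_2) (d : R) (psip psim : R -> 'cV[C]_2)
    : Prop :=
  [/\ mx_in APWp psip, mx_in APWm psim &
      forall x, e_ (- (d / 2)) x *: (G x *m psip x) = psim x].

Definition tilde (dt : R) (psip : R -> 'cV[C]_2) (x : R) : 'cV[C]_2 :=
  e_ (- dt) x *: psip x.

Definition RH_CP_solution (G : R -> 'M[C]_2) (d : R)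
    (psip psim : R -> 'cV[C]_2) (dt : R) : Prop :=
  [/\ RH_solution G d psip psim, 0 <= dt,
      CP Cplus (tilde dt psip) & CP Cminus psim].

End Defs.

(* Main.v *)
(* The main points are the following.

   Logarithms. If g is in AP and exp(g) is in APW, then g is in APW. Splitting a logarithm
   of e_{-delta} det G by the sign of its frequencies gives det G = e_delta q p with
   p^{+-1} in APW+ and q^{+-1} in APW-.

   Corona. The characters of APW+ restrict to semicharacters of the frequency semigroup
   [0, +oo[, and on finite sets of frequencies these are approximated by the evaluations
   l |-> exp(i l z) at points z of the upper half-plane. Hence two elements of APW+ whose
   extensions satisfy inf (|w1| + |w2|) > 0 generate the unit ideal of APW+.

   Hardy extensions. A bounded analytic function is determined by its boundary values, so
   the extension of an element of APW+ is the sum of its exponential series, and if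
   e_{-d} f extends to a bounded analytic function then the spectrum of f lies in [d, +oo[.

   Given a solution, Bezout equations for w = e_{-d} psi_+ in APW+ and for psi_- in APW-
   complete both vectors to matrices X_+ and X_- of determinant 1, and
   X_-^{-1} e_{-delta/2} G X_+ is triangular with diagonal (e_{-d}, e_d q p). After
   rescaling the second columns by p^{-1} and q, the corner entry is removed by splitting its
   spectrum at -d. Conversely, the first columns of the factors (the one of the smaller
   exponent) solve the Riemann-Hilbert problem, and they are corona vectors because the
   factors are invertible. Uniqueness of the indices holds since e_t a = b with t > 0,
   a in APW+ and b in APW- forces a = b = 0. *)
Require Import Defs.
From HB Require Import structures.
From mathcomp Require Import finmap.
From mathcomp Require Import all_boot all_order all_algebra.
From mathcomp Require Import all_classical all_reals all_analysis.
From mathcomp Require Import complex ring lra.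
Set Implicit Arguments.
Unset Strict Implicit.
Unset Printing Implicit Defensive.
Import Order.TTheory GRing.Theory Num.Theory numFieldNormedType.Exports.
Local Open Scope classical_set_scope.
Local Open Scope ring_scope.
Local Open Scope complex_scope.

(** * Complex numbers and exponentials *)

Section Complex.
Variable R : realType.
Local Notation C := R[i].
Implicit Types (z w : C) (x y : R).

(** Three obstacles shape the proof. Bohr coefficients are limits of means and do not by themselves
    sum to a function, so the Wiener algebra is handled through uniform approximation by
    trigonometric polynomials of bounded coefficient norm, and the uniqueness theorem for Bohr
    coefficients leads back. Instead of the Bohr compactification, that theorem, the spectral radius
    formula behind the logarithm and the approximation of semicharacters all use one count: the n-th
    power of a polynomial with D terms has at most (n + 1)^D frequencies, so its sup norm and its
    coefficient norm differ by at most a polynomial factor, which every geometric rate beats.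
    Gelfand theory has to work for seminorms, without completeness; Rickart's argument gives
    nonempty spectra without Liouville's theorem. Finally, a corona vector comes with arbitrary
    bounded analytic extensions having boundary limits almost everywhere; uniqueness from such
    limits is obtained from Cauchy's theorem on rectangles and dominated convergence. The lower
    half-plane is reduced to the upper one by conjugation. *)

Lemma cabsE z : cabs z = Num.sqrt (complex.Re z ^+ 2 + complex.Im z ^+ 2).
Proof. by rewrite /cabs normc_def. Qed.

Lemma cabs_norm z : `|z| = (cabs z)%:C.
Proof. by rewrite /cabs normc_def. Qed.

Lemma cabsM z w : cabs (z * w) = cabs z * cabs w.
Proof. by apply: complexI; rewrite -cabs_norm normrM !cabs_norm -rmorphM. Qed.

Lemma cabs_ge0 z : 0 <= cabs z.
Proof. by rewrite -ler0c -cabs_norm. Qed.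

Lemma cabsD z w : cabs (z + w) <= cabs z + cabs w.
Proof. by rewrite -lecR rmorphD/= -!cabs_norm ler_normD. Qed.

Lemma cabsN z : cabs (- z) = cabs z.
Proof. by rewrite /cabs normrN. Qed.

Lemma cabsBC z w : cabs (z - w) = cabs (w - z).
Proof. by rewrite /cabs distrC. Qed.

Lemma cabsB z w : cabs (z - w) <= cabs z + cabs w.
Proof. by rewrite -[cabs w]cabsN cabsD. Qed.

Lemma cabs_triangle u z w : cabs (z - w) <= cabs (z - u) + cabs (u - w).
Proof. by have := cabsD (z - u) (u - w); rewrite addrA subrK. Qed.

Lemma cabs0 : cabs (0 : C) = 0. Proof. by rewrite /cabs normr0. Qed.
Lemma cabs1 : cabs (1 : C) = 1. Proof. by rewrite /cabs normr1. Qed.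

Lemma cabs_eq0 z : (cabs z == 0) = (z == 0).
Proof. by rewrite -[RHS]normr_eq0 cabs_norm -(inj_eq (@complexI R)). Qed.

Lemma cabs_gt0 z : (0 < cabs z) = (z != 0).
Proof. by rewrite lt_def cabs_ge0 andbT cabs_eq0. Qed.

Lemma cabsX z n : cabs (z ^+ n) = cabs z ^+ n.
Proof. by elim: n => [|n IH]; rewrite ?cabs1 // !exprS cabsM IH. Qed.

Lemma cabsV z : cabs z^-1 = (cabs z)^-1.
Proof. by apply: complexI; rewrite -cabs_norm normfV cabs_norm -fmorphV. Qed.

Lemma cabs_real x : cabs x%:C = `|x|.
Proof. by rewrite cabsE /= expr0n addr0 sqrtr_sqr. Qed.

Lemma cabs_nat n : cabs (n%:R : C) = n%:R.
Proof. by rewrite -[n%:R](rmorph_nat (real_complex R)) cabs_real normr_nat. Qed.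

Lemma cabs_Re z : `|complex.Re z| <= cabs z.
Proof. by rewrite -lecR -cabs_norm normc_ge_Re. Qed.

Lemma cabs_Im z : `|complex.Im z| <= cabs z.
Proof.
rewrite cabsE -sqrtr_sqr ler_sqrt ?lerDr ?sqr_ge0 //.
by rewrite addr_ge0 ?sqr_ge0.
Qed.

Lemma cabs_ReIm z : cabs z <= `|complex.Re z| + `|complex.Im z|.
Proof.
rewrite {1}[z]complexE; apply: le_trans (cabsD _ _) _.
by rewrite cabsM !cabs_real [cabs 'i]cabsE /= expr0n add0r expr1n sqrtr1 mul1r.
Qed.

Lemma cabs_conj z : cabs (z^*) = cabs z.
Proof. by rewrite /cabs normcJ. Qed.

Lemma cabs_sum I (r : seq I) (P : pred I) (F : I -> C) :
  cabs (\sum_(i <- r | P i) F i) <= \sum_(i <- r | P i) cabs (F i).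
Proof.
elim/big_ind2: _ => //; first by rewrite cabs0.
by move=> x1 x2 y1 y2 h1 h2; apply: le_trans (cabsD _ _) (lerD h1 h2).
Qed.

Lemma cReD z w : complex.Re (z + w) = complex.Re z + complex.Re w.
Proof. by case: z w => [? ?] [? ?]. Qed.
Lemma cImD z w : complex.Im (z + w) = complex.Im z + complex.Im w.
Proof. by case: z w => [? ?] [? ?]. Qed.
Lemma cReN z : complex.Re (- z) = - complex.Re z. Proof. by case: z. Qed.
Lemma cImN z : complex.Im (- z) = - complex.Im z. Proof. by case: z. Qed.
Lemma cReM z w : complex.Re (z * w) =
  complex.Re z * complex.Re w - complex.Im z * complex.Im w.
Proof. by case: z w => [? ?] [? ?]. Qed.
Lemma cImM z w : complex.Im (z * w) =
  complex.Re z * complex.Im w + complex.Im z * complex.Re w.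
Proof. by case: z w => [? ?] [? ?]. Qed.

Lemma complex_eq z w : complex.Re z = complex.Re w ->
  complex.Im z = complex.Im w -> z = w.
Proof. by case: z w => [? ?] [? ?] /= -> ->. Qed.

(** Reduces estimates of complex integrals and increments to estimates of a real part. The factor
    only satisfies [cabs u <= 1] because u = 0 is taken for z = 0. *)
Lemma cabs_rot z : exists2 u, cabs u <= 1 & cabs z = complex.Re (u * z).
Proof.
have [->|z0] := eqVneq z 0.
  by exists 0; rewrite ?mul0r cabs0 ?ler01.
exists (z^* / (cabs z)%:C).
  rewrite cabsM cabs_conj cabsV cabs_real ger0_norm ?cabs_ge0 // divff //.
  by rewrite cabs_eq0.
have h : z^* * z = (cabs z ^+ 2)%:C.
  by rewrite mulrC -sqr_normc cabs_norm rmorphXn.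
rewrite mulrAC h -fmorphV -rmorphM /= expr2 mulfK //.
by rewrite cabs_eq0.
Qed.

Lemma cexpD z w : cexp (z + w) = cexp z * cexp w.
Proof.
apply: complex_eq; case: z w => [a b] [c d];
  rewrite /cexp /= expRD cosD sinD; ring.
Qed.

Lemma cexp0 : cexp 0 = 1 :> C.
Proof. by apply: complex_eq; rewrite /cexp /= expR0 cos0 sin0; ring. Qed.

Lemma cabs_cexp z : cabs (cexp z) = expR (complex.Re z).
Proof.
rewrite /cexp cabsM cabs_real ger0_norm ?expR_ge0 // cabsE /= cos2Dsin2.
by rewrite sqrtr1 mulr1.
Qed.

Lemma cexpMn z n : cexp (z *+ n) = cexp z ^+ n.
Proof.
by elim: n => [|n IH]; rewrite ?mulr0n ?cexp0 // mulrS exprS cexpD IH.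
Qed.

Lemma e_D l m x : e_ (l + m) x = e_ l x * e_ m x :> C.
Proof. by rewrite /e_ -cexpD -mulrDr -rmorphD -mulrDl. Qed.

Lemma e_Dx l x y : e_ l (x + y) = e_ l x * e_ l y :> C.
Proof. by rewrite /e_ -cexpD -mulrDr -rmorphD -mulrDr. Qed.

Lemma e_0 x : e_ 0 x = 1 :> C.
Proof. by rewrite /e_ mul0r mulr0 cexp0. Qed.

Lemma e_x0 l : e_ l 0 = 1 :> C.
Proof. by rewrite /e_ mulr0 mulr0 cexp0. Qed.

Lemma e_Nx l x : e_ l (- x) = e_ (- l) x :> C.
Proof. by rewrite /e_ mulrN mulNr. Qed.

Lemma e_E l x : e_ l x = cos (l * x) +i* sin (l * x) :> C.
Proof. by rewrite /e_ /cexp; apply: complex_eq; rewrite /= !(mul0r, mul1r, mulr0, subr0, oppr0, addr0, add0r) expR0; ring. Qed.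

Lemma cabs_e l x : cabs (e_ l x : C) = 1.
Proof. by rewrite /e_ cabs_cexp /= !mul0r mulr0 subr0 expR0. Qed.

Lemma e_NK l x : e_ (- l) x * e_ l x = 1 :> C.
Proof. by rewrite -e_D addNr e_0. Qed.

Lemma e_KN l x : e_ l x * e_ (- l) x = 1 :> C.
Proof. by rewrite -e_D addrN e_0. Qed.

Lemma e_conj l x : (e_ l x)^* = e_ (- l) x :> C.
Proof. by rewrite !e_E mulNr cosN sinN. Qed.

End Complex.

(** * Elementary estimates and complex differentiability *)

Section Estimates.
Variable R : realType.
Local Notation C := R[i].
Implicit Types (z w : C) (x y : R).

Lemma mvt0 (f df : R -> R) x : (forall t : R, is_derive t (1 : R) f (df t)) ->
  exists2 c, `|c| <= `|x| & f x - f 0 = df c * x.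
Proof.
move=> fd.
have fc a b : {within `[a, b], continuous f}.
  apply/continuous_subspaceT => t.
  by apply/differentiable_continuous/derivable1_diffP; case: (fd t).
have [x0|/ltW x0] := leP 0 x.
  have [c /itvP ci E] := MVT_segment x0 (fun t _ => fd t) (fc 0 x).
  by exists c; [rewrite !ger0_norm ?ci|rewrite E subr0].
have [c /itvP ci E] := MVT_segment x0 (fun t _ => fd t) (fc x 0).
exists c; first by rewrite !ler0_norm ?ci // lerN2 ci.
by rewrite -[LHS]opprB E; ring.
Qed.

Lemma sin_le_norm x : `|sin x| <= `|x|.
Proof.
have [c _ E] := mvt0 x (@is_derive_sin R).
move: E; rewrite sin0 subr0 => ->; rewrite normrM.
by rewrite ler_piMl // cos_max.
Qed.

Lemma cos_sub1_le x : `|cos x - 1| <= x ^+ 2.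
Proof.
have [c cx E] := mvt0 x (@is_derive_cos R).
move: E; rewrite cos0 => ->; rewrite normrM normrN -real_normK ?num_real // expr2.
by apply: ler_pM => //; apply: le_trans (sin_le_norm _) cx.
Qed.

Lemma sin_sub_le x : `|x| <= 1 -> `|sin x - x| <= x ^+ 2.
Proof.
move=> x1.
have fd (t : R) : is_derive t (1 : R) (fun t => sin t - t) (cos t - 1) by apply: is_deriveB.
have [c cx E] := mvt0 x fd.
move: E; rewrite sin0 !subr0 => ->; rewrite normrM -[X in _ <= X]real_normK ?num_real // expr2.
apply: ler_pM => //; apply: le_trans (cos_sub1_le _) _.
rewrite -real_normK ?num_real // expr2.
apply: le_trans (ler_pM _ _ cx cx) _ => //.
by rewrite -[X in _ <= X]mulr1 ler_wpM2l.
Qed.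

Lemma expR_sub_le x : `|x| <= 2^-1 -> `|expR x - 1 - x| <= 2 * x ^+ 2.
Proof.
rewrite ler_norml => /andP[x1 x2].
have h1 := expR_ge1Dx x; have h2 := expR_ge1Dx (- x).
rewrite ger0_norm; last lra.
have h3 : expR x * (1 - x) <= 1.
  by rewrite -[X in _ <= X](expRxMexpNx_1 x) ler_wpM2l ?expR_ge0.
have h4 : (expR x - 1 - x) * (1 - x) <= x ^+ 2 by lra.
have h5 : 0 <= expR x - 1 - x by lra.
nra.
Qed.

Lemma cexp_small w : cabs w <= 2^-1 -> cabs (cexp w - 1 - w) <= 8 * cabs w ^+ 2.
Proof.
move=> hw; have hr := le_trans (cabs_Re w) hw; have hi := le_trans (cabs_Im w) hw.
have hn : cabs w ^+ 2 = complex.Re w ^+ 2 + complex.Im w ^+ 2.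
  by rewrite cabsE sqr_sqrtr // addr_ge0 ?sqr_ge0.
apply: le_trans (cabs_ReIm _) _; rewrite hn.
move: w {hw hn} hr hi => [a b]; rewrite /cexp /= => ha hb.
have := expR_sub_le ha; have := cos_sub1_le b.
have hb1 : `|b| <= 1 by lra.
have := sin_sub_le hb1; move: ha hb.
rewrite !ler_norml => /andP[a1 a2] /andP[b1 b2] /andP[s1 s2] /andP[c1 c2] /andP[e1 e2].
rewrite !oppr0 !addr0 !mul0r subr0 addr0.
set E := expR a in e1 e2 *; set S := sin b in s1 s2 *; set K := cos b in c1 c2 *.
have E0 : 0 < E := expR_gt0 a.
have E2 : E <= 2 by nra.
have r1 : `|E * K - 1 - a| <= 2 * a ^+ 2 + 2 * b ^+ 2.
  have -> : E * K - 1 - a = (E - 1 - a) + E * (K - 1) by ring.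
  by rewrite ler_norml; apply/andP; split; nra.
have r2 : `|E * S - b| <= 2 * b ^+ 2 + (2 * a ^+ 2 + 2 * b ^+ 2).
  have -> : E * S - b = E * (S - b) + ((E - 1 - a) * b + a * b) by ring.
  have ab : `|a * b| <= (a ^+ 2 + b ^+ 2) / 2.
    by rewrite ler_norml; apply/andP; split; have := sqr_ge0 (a + b); have := sqr_ge0 (a - b); nra.
  have eb : `|(E - 1 - a) * b| <= a ^+ 2.
    rewrite normrM; have : `|E - 1 - a| <= 2 * a ^+ 2 by rewrite ler_norml e1 e2.
    have : `|b| <= 2^-1 by rewrite ler_norml b1 b2.
    have := normr_ge0 (E - 1 - a); have := normr_ge0 b; nra.
  have es : `|E * (S - b)| <= 2 * b ^+ 2.
    by rewrite ler_norml; apply/andP; split; nra.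
  have := ler_normD (E * (S - b)) ((E - 1 - a) * b + a * b).
  have := ler_normD ((E - 1 - a) * b) (a * b).
  have := sqr_ge0 a; have := sqr_ge0 b; lra.
by have := sqr_ge0 a; have := sqr_ge0 b; lra.
Qed.

(** Beyond the disc of radius 1/2 the trivial bound is absorbed by 4|w|^2 > 1. A bound for all w is
    needed since w will be i l h with l unbounded. *)
Lemma cexp_taylor1 w : cabs (cexp w - 1 - w) <= 16 * cabs w ^+ 2 * expR (cabs w).
Proof.
have w0 := cabs_ge0 w.
have e1 := expR_ge1Dx (cabs w).
have [hw|hw] := leP (cabs w) 2^-1.
  by have := cexp_small hw; nra.
have : cabs (cexp w - 1 - w) <= expR (cabs w) + 1 + cabs w.
  apply: le_trans (cabsB _ _) _; rewrite lerD2r.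
  apply: le_trans (cabsB _ _) _; rewrite cabs1 lerD2r cabs_cexp ler_expR.
  by apply: le_trans (cabs_Re w); rewrite ler_norm.
move: (cabs (cexp w - 1 - w)) => T; move: (cabs w) e1 w0 hw => W.
move: (expR W) => E e1 w0 hw hT.
have w2 : 1 <= 4 * W ^+ 2 by nra.
by have : 1 * E <= 4 * W ^+ 2 * E; [rewrite ler_wpM2r//; lra | lra].
Qed.

Lemma ltc0E (r : C) : 0 < r -> r = (complex.Re r)%:C /\ 0 < complex.Re r.
Proof. by case: r => a b; rewrite ltcE /= => /andP[/eqP -> ->]. Qed.

Lemma nbhsCP z (P : set R[i]^o) : nbhs (z : R[i]^o) P <->
  exists2 r : R, 0 < r & forall w, cabs (w - z) < r -> P w.
Proof.
split=> [/nbhs_ballP[/= r /ltc0E[re r0] Hr]|[r r0 Hr]].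
  exists (complex.Re r) => // w wz; apply: Hr.
  by rewrite -ball_normE /= re cabs_norm ltcR cabsBC.
apply/nbhs_ballP; exists r%:C => /=; first by rewrite ltcR.
by move=> w; rewrite -ball_normE /= cabs_norm ltcR cabsBC => /Hr.
Qed.

Lemma cvgCP T (G : set_system T) (FG : Filter G) (F : T -> R[i]^o) (l : R[i]^o) :
  F @ G --> l <-> forall e : R, 0 < e -> \forall t \near G, cabs (F t - l) <= e.
Proof.
split=> [/cvgrPdist_le H e e0|H].
  have eC : (0 : C) < e%:C by rewrite ltcR.
  by apply: filterS (H _ eC) => t; rewrite cabs_norm lecR cabsBC.
apply/cvgrPdist_le => r /ltc0E[re /H]; rewrite re.
by apply: filterS => t; rewrite cabs_norm lecR cabsBC.
Qed.

(** First-order approximation without difference quotients, h = 0 included; [cderiv_derivable]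
    identifies it with derivability along 1, the form used for bounded analytic functions. *)
Definition cderiv (F : C -> C) z d := forall e, 0 < e ->
  exists2 r, 0 < r & forall h, cabs h < r ->
    cabs (F (z + h) - F z - d * h) <= e * cabs h.

Lemma cderiv_derivable F z : derivable (F : R[i]^o -> R[i]^o) z 1 <->
  exists d, cderiv F z d.
Proof.
have quot d h : h != 0 -> cabs (h^-1 *: (F (h%:A + z) - F z) - d) * cabs h =
    cabs (F (z + h) - F z - d * h).
  move=> h0; rewrite -cabsM mulrBl; congr cabs; congr (_ - _).
  rewrite -[_ *: _]/(h^-1 * _) mulrC mulrA divff // mul1r.
  by rewrite (mulr1 h : h *: (1 : R[i]^o) = h) [h + z]addrC.
split=> [/cvg_ex[/= d /cvgCP Hd]|[d Hd]].
  exists d => e e0.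
  have [r r0 Hr] := (nbhsCP _ _).1 (Hd e e0).
  exists r => // h hr; have [->|h0] := eqVneq h 0.
    by rewrite addr0 mulr0 !subrr cabs0 mulr0.
  rewrite -quot // ler_wpM2r ?cabs_ge0 //; apply: Hr => //.
  by rewrite subr0.
apply/cvg_ex; exists d; apply/cvgCP => e e0.
have [r r0 Hr] := Hd e e0; apply/nbhsCP; exists r => // h; rewrite subr0 => hr h0.
by rewrite -(ler_pM2r (x := cabs h)) ?cabs_gt0 // quot // Hr.
Qed.

Lemma cderiv_cont F z d : cderiv F z d -> forall e, 0 < e ->
  exists2 r, 0 < r & forall h, cabs h < r -> cabs (F (z + h) - F z) <= e.
Proof.
move=> Fd e e0; have [r r0 Hr] := Fd 1 ltr01.
have d0 := cabs_ge0 d.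
exists (Num.min r (e / (1 + cabs d))) => [|h].
  by rewrite lt_min r0 divr_gt0 // ltr_wpDr.
rewrite lt_min => /andP[h1 h2].
rewrite -[F _ - F z](subrK (d * h)); apply: le_trans (cabsD _ _) _.
apply: le_trans (lerD (Hr _ h1) (lexx _)) _.
rewrite cabsM -mulrDl; move: h2.
by rewrite ltr_pdivlMr ?ltr_wpDr // mulrC => /ltW.
Qed.

Lemma cderiv_const a z : cderiv (fun=> a) z 0.
Proof.
move=> e e0; exists 1 => // h _.
by rewrite mul0r !subrr cabs0 mulr_ge0 ?cabs_ge0 // ltW.
Qed.

Lemma cderiv_id z : cderiv id z 1.
Proof.
move=> e e0; exists 1 => // h _.
have -> : id (z + h) - id z - 1 * h = 0 by rewrite /=; ring.
by rewrite cabs0 mulr_ge0 ?cabs_ge0 // ltW.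
Qed.

Lemma cderivD F G z a b : cderiv F z a -> cderiv G z b ->
  cderiv (fun z => F z + G z) z (a + b).
Proof.
move=> HF HG e e0; have e2 : 0 < e / 2 by lra.
have [r r0 Hr] := HF _ e2; have [s s0 Hs] := HG _ e2.
exists (Num.min r s) => [|h]; first by rewrite lt_min r0.
rewrite lt_min => /andP[h1 h2]; have := Hr h h1; have := Hs h h2.
have -> : F (z + h) + G (z + h) - (F z + G z) - (a + b) * h =
  (F (z + h) - F z - a * h) + (G (z + h) - G z - b * h) by ring.
have := cabsD (F (z + h) - F z - a * h) (G (z + h) - G z - b * h); lra.
Qed.

Lemma cderiv_comp F G z a b : cderiv G z b -> cderiv F (G z) a ->
  cderiv (fun z => F (G z)) z (a * b).
Proof.
move=> HG HF e e0.
have b0 := cabs_ge0 b; have a0 := cabs_ge0 a.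
pose e1 := e / (2 * (1 + cabs b)); pose e2 := Num.min 1 (e / (2 * (1 + cabs a))).
have e10 : 0 < e1 by rewrite divr_gt0 // mulr_gt0 // ltr_wpDr.
have e20 : 0 < e2 by rewrite lt_min ltr01 divr_gt0 // mulr_gt0 // ltr_wpDr.
have [r r0 Hr] := HF _ e10; have [s s0 Hs] := HG _ e20.
have [t t0 Ht] := cderiv_cont HG (divr_gt0 r0 (ltr0Sn R 1)).
exists (Num.min s t) => [|h]; first by rewrite lt_min s0.
rewrite lt_min => /andP[h1 h2]; have h0 := cabs_ge0 h.
set k := G (z + h) - G z.
have kr : cabs k < r by apply: le_lt_trans (Ht _ h2) _; lra.
have := Hr k kr; rewrite {1}/k [G z + _]addrC subrK.
have := Hs h h1; rewrite -/k => g1 g2.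
have -> : F (G (z + h)) - F (G z) - a * b * h =
  (F (G (z + h)) - F (G z) - a * k) + a * (k - b * h) by ring.
apply: le_trans (cabsD _ _) _; rewrite cabsM.
have kb : cabs k <= (1 + cabs b) * cabs h.
  rewrite -[k](subrK (b * h)); apply: le_trans (cabsD _ _) _.
  rewrite mulrDl cabsM lerD2r; apply: le_trans g1 _.
  by rewrite ler_wpM2r // ge_min lexx.
have E1 : e1 * (1 + cabs b) = e / 2 by rewrite /e1; field; lra.
have E2 : e2 * (1 + cabs a) <= e / 2.
  apply: (@le_trans _ _ (e / (2 * (1 + cabs a)) * (1 + cabs a))).
    by rewrite ler_wpM2r ?ge_min ?lexx ?orbT //; lra.
  by rewrite (_ : e / _ * _ = e / 2) //; field; lra.
have E3 : e1 * cabs k <= e / 2 * cabs h.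
  by rewrite -E1 -mulrA ler_wpM2l // ltW.
have E4 : cabs a * cabs (k - b * h) <= e / 2 * cabs h.
  apply: le_trans (ler_wpM2l a0 g1) _.
  rewrite mulrA ler_wpM2r //; apply: le_trans E2; nra.
lra.
Qed.

Lemma cderivZ F z a c : cderiv F z a -> cderiv (fun z => c * F z) z (c * a).
Proof.
move=> HF e e0; have c0 := cabs_ge0 c.
have e1 : 0 < e / (1 + cabs c) by rewrite divr_gt0 // ltr_wpDr.
have [r r0 Hr] := HF _ e1; exists r => // h /Hr hr.
have -> : c * F (z + h) - c * F z - c * a * h = c * (F (z + h) - F z - a * h) by ring.
rewrite cabsM; apply: le_trans (ler_wpM2l c0 hr) _.
rewrite mulrA ler_wpM2r ?cabs_ge0 // mulrCA -[X in _ <= X]mulr1 ler_wpM2l ?(ltW e0) //.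
rewrite ler_pdivrMr; lra.
Qed.

(** Polarization, FG = ((F + G)^2 - (F - G)^2) / 4, reduces the product rule to the chain rule and
    the derivative of c z^2. *)
Lemma cderivM F G z a b : cderiv F z a -> cderiv G z b ->
  cderiv (fun z => F z * G z) z (a * G z + F z * b).
Proof.
have sq c w : cderiv (fun z => c * z ^+ 2) w (c * (2 * w)).
  apply: cderivZ => e e0; exists e => // h he.
  have -> : (w + h) ^+ 2 - w ^+ 2 - 2 * w * h = h * h by ring.
  by rewrite cabsM ler_wpM2r ?cabs_ge0 // ltW.
move=> HF HG.
have p1 := cderiv_comp (cderivD HF HG) (sq (4^-1) _).
have p2 := cderiv_comp (cderivD HF (cderivZ (-1) HG)) (sq (- 4^-1) _).
have := cderivD p1 p2; rewrite (_ : (fun _ => _) = (fun z => F z * G z)); last first.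
  by apply/funext => t; field.
by rewrite (_ : _ + _ * _ = a * G z + F z * b) //; field.
Qed.

Lemma cderiv_cexp z : cderiv (@cexp R) z (cexp z).
Proof.
have c0 := cabs_ge0 (cexp z).
move=> e e0; exists (Num.min 2^-1 (e / (8 * (1 + cabs (cexp z))))) => [|h].
  by rewrite lt_min divr_gt0 ?andbT // mulr_gt0 // ltr_wpDr.
rewrite lt_min => /andP[/ltW h1 h2].
have -> : cexp (z + h) - cexp z - cexp z * h = cexp z * (cexp h - 1 - h).
  by rewrite cexpD; ring.
have h0 := cabs_ge0 h; have := cexp_small h1; rewrite cabsM => h3.
apply: le_trans (ler_wpM2l c0 h3) _.
rewrite expr2 !mulrA ler_wpM2r //; move: h2.
rewrite ltr_pdivlMr; last by rewrite mulr_gt0 // ltr_wpDr.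
nra.
Qed.

Lemma cderiv_exp_lin F z a : cderiv F z a ->
  cderiv (fun z => cexp (F z)) z (cexp (F z) * a).
Proof. by move=> HF; apply: cderiv_comp HF (cderiv_cexp _). Qed.

Lemma cderivX F z a n : cderiv F z a ->
  exists b, cderiv (fun z => F z ^+ n) z b.
Proof.
move=> HF; elim: n => [|n [b Hb]]; first by exists 0; apply: cderiv_const.
exists (a * F z ^+ n + F z * b).
by have := cderivM HF Hb; under eq_fun do rewrite -exprS.
Qed.

Lemma cderiv_conj F z d : cderiv F (z^*) d -> cderiv (fun z => (F (z^*))^*) z (d^*).
Proof.
move=> HF e /HF[r r0 Hr]; exists r => // h hr.
have := Hr (h^*); rewrite cabs_conj => /(_ hr).
by rewrite -[cabs (_ - _)]cabs_conj !(rmorphB, rmorphD, rmorphM) /= conjcK.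
Qed.

End Estimates.

(** * Cauchy's theorem and boundary uniqueness *)

Section Integral.
Variable R : realType.
Local Notation C := R[i].
Local Notation mu := (@lebesgue_measure R).
Implicit Types (z w : C) (x y a b : R) (f g : R -> C).

Definition cint a b f : C :=
  (\int[mu]_(t in `[a, b]) complex.Re (f t)) +i*
  (\int[mu]_(t in `[a, b]) complex.Im (f t)).

Definition cintegrable a b f : Prop :=
  mu.-integrable `[a, b] (EFin \o (fun t => complex.Re (f t))) /\
  mu.-integrable `[a, b] (EFin \o (fun t => complex.Im (f t))).

Definition ccontinuous_on a b f : Prop :=
  forall x, a <= x <= b -> forall e, 0 < e -> exists2 r, 0 < r &
    forall y, a <= y <= b -> `|y - x| < r -> cabs (f y - f x) <= e.

Lemma ccontinuous_integrable a b f : ccontinuous_on a b f -> cintegrable a b f.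
Proof.
have gen (p : C -> R) : (forall z w, `|p z - p w| <= cabs (z - w)) ->
    ccontinuous_on a b f -> mu.-integrable `[a, b] (EFin \o (fun t => p (f t))).
  move=> pl cf; apply: continuous_compact_integrable; first exact: segment_compact.
  apply/subspace_continuousP => x; rewrite /= in_itv /= => xab.
  apply/cvgrPdist_le => e e0; have [r r0 Hr] := cf x xab e e0.
  rewrite near_withinE; exists r => // y yr; rewrite /= in_itv /= => yab.
  change (`|p (f x) - p (f y)| <= e); rewrite distrC.
  apply: le_trans (pl _ _) _; apply: Hr => //.
  by rewrite distrC; exact: yr.
move=> cf; split; apply: gen => // z w.
  by rewrite -cReN -cReD cabs_Re.
by rewrite -cImN -cImD cabs_Im.
Qed.

Lemma integrable_lin a b (c d : R) (u v : R -> R) :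
  mu.-integrable `[a, b] (EFin \o u) -> mu.-integrable `[a, b] (EFin \o v) ->
  mu.-integrable `[a, b] (EFin \o (fun t => c * u t + d * v t)).
Proof.
move=> iu iv.
rewrite (_ : EFin \o _ = (fun t => c%:E * (EFin \o u) t) \+ (fun t => d%:E * (EFin \o v) t))%E.
  by apply: integrableD => //; apply: integrableZl.
by apply/funext => t /=; rewrite EFinD !EFinM.
Qed.

Lemma Rintegral_lin a b (c d : R) (u v : R -> R) :
  mu.-integrable `[a, b] (EFin \o u) -> mu.-integrable `[a, b] (EFin \o v) ->
  \int[mu]_(t in `[a, b]) (c * u t + d * v t) =
  c * \int[mu]_(t in `[a, b]) u t + d * \int[mu]_(t in `[a, b]) v t.
Proof.
move=> iu iv; have h u' k : mu.-integrable `[a, b] (EFin \o u') ->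
    mu.-integrable `[a, b] (EFin \o (fun t => k * u' t)).
  move=> h; rewrite (_ : EFin \o _ = (fun t => k%:E * (EFin \o u') t))%E.
    exact: integrableZl.
  by apply/funext => t /=; rewrite EFinM.
by rewrite RintegralD //= ?RintegralZl //; apply: h.
Qed.

Lemma cintegrableZ a b f c : cintegrable a b f -> cintegrable a b (fun t => c * f t).
Proof.
move=> [f1 f2]; split.
  have -> : (fun t => complex.Re (c * f t)) = (fun t =>
      complex.Re c * complex.Re (f t) + - complex.Im c * complex.Im (f t)).
    by apply/funext => t; rewrite cReM mulNr.
  exact: integrable_lin.
have -> : (fun t => complex.Im (c * f t)) = (fun t =>
    complex.Im c * complex.Re (f t) + complex.Re c * complex.Im (f t)).
  by apply/funext => t; rewrite cImM addrC.
exact: integrable_lin.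
Qed.

Lemma cintZ a b f c : cintegrable a b f -> cint a b (fun t => c * f t) = c * cint a b f.
Proof.
move=> [f1 f2]; apply: complex_eq; rewrite ?cReM ?cImM /= -?mulNr.
  rewrite -Rintegral_lin //; by apply: eq_Rintegral => t _ /=; rewrite cReM mulNr.
by rewrite addrC -Rintegral_lin //; apply: eq_Rintegral => t _ /=; rewrite cImM addrC.
Qed.

Lemma cintD a b f g : cintegrable a b f -> cintegrable a b g ->
  cint a b (fun t => f t + g t) = cint a b f + cint a b g.
Proof.
move=> [f1 f2] [g1 g2]; apply: complex_eq; rewrite ?cReD ?cImD /= -RintegralD //;
  by apply: eq_Rintegral => t _ /=; rewrite ?cReD ?cImD.
Qed.

Lemma lebesgue_segment a b : a <= b -> fine (mu `[a, b]) = b - a.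
Proof.
move=> ab; rewrite lebesgue_measure_itv /= lte_fin.
by case: ltgtP ab => //= -> _; rewrite subrr.
Qed.

Lemma cint_cst a b c : a <= b -> cint a b (fun=> c) = (b - a)%:C * c.
Proof.
move=> ab; rewrite /cint !Rintegral_cst // lebesgue_segment //.
by apply: complex_eq; rewrite ?cReM ?cImM /=; ring.
Qed.

Lemma cintegrable_cst a b c : cintegrable a b (fun=> c).
Proof.
apply: ccontinuous_integrable => x _ e e0; exists 1 => // y _ _.
by rewrite subrr cabs0 ltW.
Qed.

Lemma cintegrable_id a b : cintegrable a b (fun t => t%:C).
Proof.
apply: ccontinuous_integrable => x _ e e0; exists e => // y _ /ltW.
by rewrite -rmorphB cabs_real.
Qed.

Lemma Rint_FTC a b (u U : R -> R) : a <= b ->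
  (forall t, is_derive (t : R) (1 : R) U (u t)) -> continuous u ->
  \int[mu]_(t in `[a, b]) u t = U b - U a.
Proof.
rewrite le_eqVlt => /orP[/eqP <-|ab] dU cu.
  by rewrite set_itv1 Rintegral_set1 subrr.
have cU : continuous U.
  move=> t; apply/differentiable_continuous/derivable1_diffP; by case: (dU t).
rewrite /Rintegral (continuous_FTC2 (F := U)) //.
- exact: continuous_subspaceT.
- split; first by move=> t _; case: (dU t).
    exact/cvg_at_right_filter/cU.
  exact/cvg_at_left_filter/cU.
- by move=> t _; rewrite derive1E; apply: derive_val.
Qed.

Lemma cint_id a b : a <= b -> cint a b (fun t => t%:C) = ((b ^+ 2 - a ^+ 2) / 2)%:C.
Proof.
move=> ab; apply: complex_eq => /=; last by rewrite Rintegral_cst // mul0r.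
have dU (t : R) : is_derive (t : R) (1 : R) (fun t : R => t ^+ 2 / 2) t.
  rewrite (_ : (fun t => _) = (2^-1 *: (fun t : R => t ^+ 2))); last first.
    by apply/funext => u; rewrite [RHS]mulrC.
  apply: is_derive_eq; rewrite /GRing.scale /=.
  by field.
rewrite (Rint_FTC ab dU); first by field.
by move=> t; apply: cvg_id.
Qed.

Lemma cint_bound a b f B : a <= b -> cintegrable a b f ->
  (forall t, a <= t <= b -> cabs (f t) <= B) -> cabs (cint a b f) <= B * (b - a).
Proof.
move=> ab cf fB; have [u u1 ->] := cabs_rot (cint a b f).
rewrite -cintZ //= -lebesgue_segment // -Rintegral_cst //.
have [h _] := cintegrableZ u cf; have [h2 _] := @cintegrable_cst a b B%:C.
apply: le_Rintegral => // t /=; rewrite in_itv /= => tab.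
apply: le_trans (ler_norm _) _; apply: le_trans (cabs_Re _) _.
rewrite cabsM; apply: le_trans (fB _ tab).
by rewrite ler_piMl // cabs_ge0.
Qed.

Lemma cint_split a m b f : a <= m -> m <= b -> cintegrable a b f ->
  [/\ cintegrable a m f, cintegrable m b f & cint a b f = cint a m f + cint m b f].
Proof.
move=> am mb [f1 f2].
have sub1 : `[a, m]%classic `<=` `[a, b].
  by apply: subset_itvl; rewrite bnd_simp.
have sub2 : `[m, b]%classic `<=` `[a, b].
  by apply: subset_itvr; rewrite bnd_simp.
have int1 (u : R -> \bar R) : mu.-integrable `[a, b] u -> mu.-integrable `[a, m] u.
  by apply: integrableS.
have int2 (u : R -> \bar R) : mu.-integrable `[a, b] u -> mu.-integrable `[m, b] u.
  by apply: integrableS.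
split; [by split; apply: int1|by split; apply: int2|].
have h (u : R -> R) : mu.-integrable `[a, b] (EFin \o u) ->
  \int[mu]_(t in `[a, b]) u t = \int[mu]_(t in `[a, m]) u t + \int[mu]_(t in `[m, b]) u t.
  move=> iu; have := Rintegral_itvB iu (_ : (BLeft a <= BRight m)%O) (_ : (BRight m <= BRight b)%O).
  rewrite !bnd_simp => /(_ am mb) E.
  rewrite -[X in _ = _ + X]Rintegral_itv_obnd_cbnd; last first.
    apply: integrableS (int2 _ iu) => //.
    by apply: subset_itvr; rewrite bnd_simp.
  by rewrite -E addrC subrK.
by apply: complex_eq; rewrite ?cReD ?cImD /=; apply: h.
Qed.

End Integral.

(** * Goursat's theorem on rectangles *)

Section Goursat.
Variable R : realType.
Local Notation C := R[i].
Implicit Types (z w : C) (x y a b c d : R) (F : C -> C).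

Definition holo_on F a b c d : Prop :=
  forall x y, a <= x <= b -> c <= y <= d -> exists l, cderiv F (x +i* y) l.

(** The integral of F dz over the boundary of [a, b] x [c, d], taken counterclockwise. *)
Definition rint F a b c d : C :=
  cint a b (fun t => F (t +i* c)) + 'i * cint c d (fun t => F (b +i* t))
  - cint a b (fun t => F (t +i* d)) - 'i * cint c d (fun t => F (a +i* t)).

Lemma holo_sub F a b c d a' b' c' d' : a <= a' -> b' <= b -> c <= c' -> d' <= d ->
  holo_on F a b c d -> holo_on F a' b' c' d'.
Proof. by move=> ? ? ? ? H x y ? ?; apply: H; lra. Qed.

Lemma holo_cont_h F a b c d y : holo_on F a b c d -> c <= y <= d ->
  ccontinuous_on a b (fun t => F (t +i* y)).
Proof.
move=> H yc x xab e e0; have [l Hl] := H x y xab yc.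
have [r r0 Hr] := cderiv_cont Hl e0; exists r => // t _ tx.
have := Hr (t - x)%:C; rewrite cabs_real => /(_ tx).
by rewrite (_ : (x +i* y) + (t - x)%:C = t +i* y) //; apply: complex_eq => /=; ring.
Qed.

Lemma holo_cont_v F a b c d x : holo_on F a b c d -> a <= x <= b ->
  ccontinuous_on c d (fun t => F (x +i* t)).
Proof.
move=> H xab y yc e e0; have [l Hl] := H x y xab yc.
have [r r0 Hr] := cderiv_cont Hl e0; exists r => // t _ ty.
have := Hr ('i * (t - y)%:C); rewrite cabsM cabs_real (cabsE 'i) /= expr0n add0r expr1n.
rewrite sqrtr1 mul1r => /(_ ty).
by rewrite (_ : (x +i* y) + 'i * (t - y)%:C = x +i* t) //; apply: complex_eq => /=; ring.
Qed.

Lemma holo_int_h F a b c d y : holo_on F a b c d -> c <= y <= d ->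
  cintegrable a b (fun t => F (t +i* y)).
Proof. by move=> H yc; apply: ccontinuous_integrable (holo_cont_h H yc). Qed.

Lemma holo_int_v F a b c d x : holo_on F a b c d -> a <= x <= b ->
  cintegrable c d (fun t => F (x +i* t)).
Proof. by move=> H yc; apply: ccontinuous_integrable (holo_cont_v H yc). Qed.

Lemma rint_splitx F a m b c d : a <= m -> m <= b -> c <= d -> holo_on F a b c d ->
  rint F a b c d = rint F a m c d + rint F m b c d.
Proof.
move=> am mb cd H.
have cc : c <= c <= d by lra.
have dd : c <= d <= d by lra.
have [_ _ E1] := cint_split am mb (holo_int_h H cc).
have [_ _ E2] := cint_split am mb (holo_int_h H dd).
by rewrite /rint E1 E2; ring.
Qed.

Lemma rint_splity F a b c m d : c <= m -> m <= d -> a <= b -> holo_on F a b c d ->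
  rint F a b c d = rint F a b c m + rint F a b m d.
Proof.
move=> am mb cd H.
have aa : a <= a <= b by lra.
have bb : a <= b <= b by lra.
have [_ _ E1] := cint_split am mb (holo_int_v H aa).
have [_ _ E2] := cint_split am mb (holo_int_v H bb).
by rewrite /rint E1 E2; ring.
Qed.

Lemma nested_intervals (a b : nat -> R) :
  (forall n, [/\ a n <= a n.+1, b n.+1 <= b n & a n <= b n]) ->
  exists x, forall n, a n <= x <= b n.
Proof.
move=> H.
have am n m : (n <= m)%N -> a n <= a m.
  elim: m => [|m IH]; first by rewrite leqn0 => /eqP ->.
  rewrite leq_eqVlt => /orP[/eqP -> //|/IH h]; apply: le_trans h _.
  by have [] := H m.
have bm n m : (n <= m)%N -> b m <= b n.
  elim: m => [|m IH]; first by rewrite leqn0 => /eqP ->.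
  rewrite leq_eqVlt => /orP[/eqP -> //|/IH h]; apply: le_trans _ h.
  by have [] := H m.
have ab n m : a n <= b m.
  have [nm|mn] := leqP n m.
    by apply: le_trans (am _ _ nm) _; have [] := H m.
  by apply: le_trans _ (bm _ _ (ltnW mn)); have [] := H n.
exists (sup (range a)) => n; apply/andP; split.
  by apply: ub_le_sup; [exists (b 0%N) => _ [k _ <-]|exists n].
by apply: sup_le_ub; [exists (a 0%N); exists 0%N|move=> _ [k _ <-]].
Qed.

(** One halving in each direction; each time one of the two pieces keeps at least half of the
    modulus of the boundary integral. *)
Lemma bisect_step F a b c d : a <= b -> c <= d -> holo_on F a b c d ->
  exists Q : (R * R) * (R * R),
  [/\ [/\ a <= Q.1.1, Q.1.2 <= b, c <= Q.2.1 & Q.2.2 <= d],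
      Q.1.2 - Q.1.1 = (b - a) / 2, Q.2.2 - Q.2.1 = (d - c) / 2 &
      cabs (rint F a b c d) / 4 <= cabs (rint F Q.1.1 Q.1.2 Q.2.1 Q.2.2)].
Proof.
have half (u v : C) : cabs (u + v) / 2 <= cabs u \/ cabs (u + v) / 2 <= cabs v.
  have := cabsD u v; have [h|h] := leP (cabs u) (cabs v); [right|left]; lra.
move=> ab cd H; pose m := (a + b) / 2; pose n := (c + d) / 2.
have [am mb] : a <= m /\ m <= b by rewrite /m; split; lra.
have [cn nd] : c <= n /\ n <= d by rewrite /n; split; lra.
have : exists P : R * R, [/\ a <= P.1, P.2 <= b, P.2 - P.1 = (b - a) / 2 &
    cabs (rint F a b c d) / 2 <= cabs (rint F P.1 P.2 c d)].
  rewrite (rint_splitx am mb cd H).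
  by have [h|h] := half (rint F a m c d) (rint F m b c d);
    [exists (a, m)|exists (m, b)]; split=> //=; rewrite /m; lra.
move=> [[a' b'] /= [aa bb E1 h1]].
have H' : holo_on F a' b' c d by apply: holo_sub H.
have ab' : a' <= b' by lra.
have : exists P : R * R, [/\ c <= P.1, P.2 <= d, P.2 - P.1 = (d - c) / 2 &
    cabs (rint F a' b' c d) / 2 <= cabs (rint F a' b' P.1 P.2)].
  rewrite (rint_splity cn nd ab' H').
  by have [h|h] := half (rint F a' b' c n) (rint F a' b' n d);
    [exists (c, n)|exists (n, d)]; split=> //=; rewrite /n; lra.
move=> [[c' d'] /= [cc dd E2 h2]].
by exists ((a', b'), (c', d')); split=> //=; lra.
Qed.

Lemma xiyE x y : x +i* y = x%:C + 'i * y%:C :> C.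
Proof. exact: (complexE (x +i* y)). Qed.

Lemma rint_affine a b c d (u v : C) : a <= b -> c <= d ->
  rint (fun z => u + v * z) a b c d = 0.
Proof.
move=> ab cd.
have aff s t (p q : C) : s <= t -> cint s t (fun x => p + q * x%:C) =
    (t - s)%:C * p + q * ((t ^+ 2 - s ^+ 2) / 2)%:C.
  move=> st; rewrite cintD; last 2 first.
  - exact: cintegrable_cst.
  - exact/cintegrableZ/cintegrable_id.
  by rewrite cint_cst // cintZ ?cint_id //; apply: cintegrable_id.
have hE y t : u + v * (t +i* y) = (u + v * 'i * y%:C) + v * t%:C.
  by rewrite xiyE; ring.
have vE x t : u + v * (x +i* t) = (u + v * x%:C) + v * 'i * t%:C.
  by rewrite xiyE; ring.
rewrite /rint; under eq_fun do rewrite hE; rewrite aff //.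
under [X in _ + _ * cint _ _ X]eq_fun do rewrite vE; rewrite aff //.
under [X in _ - cint _ _ X]eq_fun do rewrite hE; rewrite aff //.
under [X in _ - _ * cint _ _ X]eq_fun do rewrite vE; rewrite aff //.
rewrite !rmorphB /=; ring.
Qed.

Lemma rintB F G a b c d : a <= b -> c <= d -> holo_on F a b c d -> holo_on G a b c d ->
  rint (fun z => F z + (-1) * G z) a b c d = rint F a b c d - rint G a b c d.
Proof.
move=> ab cd HF HG.
have c0 : c <= c <= d by lra. have d0 : c <= d <= d by lra.
have a0 : a <= a <= b by lra. have b0 : a <= b <= b by lra.
have h y (hy : c <= y <= d) : cint a b (fun t => F (t +i* y) + (-1) * G (t +i* y)) =
    cint a b (fun t => F (t +i* y)) - cint a b (fun t => G (t +i* y)).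
  have iF := holo_int_h HF hy; have iG := holo_int_h HG hy.
  by rewrite cintD ?cintZ ?mulN1r //; apply: cintegrableZ.
have v x (hx : a <= x <= b) : cint c d (fun t => F (x +i* t) + (-1) * G (x +i* t)) =
    cint c d (fun t => F (x +i* t)) - cint c d (fun t => G (x +i* t)).
  have iF := holo_int_v HF hx; have iG := holo_int_v HG hx.
  by rewrite cintD ?cintZ ?mulN1r //; apply: cintegrableZ.
by rewrite /rint !h // !v //; ring.
Qed.

Lemma rint_bound F a b c d B : a <= b -> c <= d -> holo_on F a b c d ->
  (forall x y, a <= x <= b -> c <= y <= d -> cabs (F (x +i* y)) <= B) ->
  cabs (rint F a b c d) <= 2 * B * ((b - a) + (d - c)).
Proof.
move=> ab cd H FB.
have c0 : c <= c <= d by lra. have d0 : c <= d <= d by lra.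
have a0 : a <= a <= b by lra. have b0 : a <= b <= b by lra.
have h y (hy : c <= y <= d) : cabs (cint a b (fun t => F (t +i* y))) <= B * (b - a).
  by apply: cint_bound => //; [apply: holo_int_h H hy|move=> t tab; apply: FB].
have ci : cabs ('i : C) = 1 by rewrite cabsE /= expr0n add0r expr1n sqrtr1.
have v x (hx : a <= x <= b) : cabs ('i * cint c d (fun t => F (x +i* t))) <= B * (d - c).
  rewrite cabsM ci mul1r.
  by apply: cint_bound => //; [apply: holo_int_v H hx|move=> t tcd; apply: FB].
rewrite /rint; apply: le_trans (cabsB _ _) _.
apply: le_trans (lerD (cabsB _ _) (v _ a0)) _.
apply: le_trans (lerD (lerD (cabsD _ _) (h _ d0)) (lexx _)) _.
have := h _ c0; have := v _ b0; lra.
Qed.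

Theorem goursat F a b c d : a <= b -> c <= d -> holo_on F a b c d ->
  rint F a b c d = 0.
Proof.
move=> ab cd H.
pose valid (Q : (R * R) * (R * R)) := [/\ a <= Q.1.1, Q.1.2 <= b, c <= Q.2.1, Q.2.2 <= d
  & Q.1.1 <= Q.1.2 /\ Q.2.1 <= Q.2.2].
pose rQ (Q : (R * R) * (R * R)) := rint F Q.1.1 Q.1.2 Q.2.1 Q.2.2.
pose next (Q Q' : (R * R) * (R * R)) := [/\ [/\ Q.1.1 <= Q'.1.1, Q'.1.2 <= Q.1.2,
   Q.2.1 <= Q'.2.1 & Q'.2.2 <= Q.2.2], Q'.1.2 - Q'.1.1 = (Q.1.2 - Q.1.1) / 2,
   Q'.2.2 - Q'.2.1 = (Q.2.2 - Q.2.1) / 2 & cabs (rQ Q) / 4 <= cabs (rQ Q')].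
have /choice[f Hf] Q : exists Q', valid Q -> next Q Q'.
  have [[h1 h2 h3 h4 [h5 h6]]|nv] := pselect (valid Q); last by exists Q.
  have [Q' HQ'] := bisect_step h5 h6 (holo_sub h1 h2 h3 h4 H).
  by exists Q'.
pose S n := iter n f ((a, b), (c, d)).
have vS n : valid (S n).
  elim: n => [|n IH]; first by split.
  have := Hf _ IH; rewrite -/(S n.+1) => -[[h1 h2 h3 h4] h5 h6 _].
  move: IH => [k1 k2 k3 k4 [k5 k6]]; split; [lra|lra|lra|lra|split; lra].
have nS n : next (S n) (S n.+1) := Hf _ (vS n).
have [x Hx] : exists x, forall n, (S n).1.1 <= x <= (S n).1.2.
  apply: nested_intervals => n; have [[? ? ? ?] _ _ _] := nS n.
  by have [_ _ _ _ []] := vS n.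
have [y Hy] : exists y, forall n, (S n).2.1 <= y <= (S n).2.2.
  apply: nested_intervals => n; have [[? ? ? ?] _ _ _] := nS n.
  by have [_ _ _ _ []] := vS n.
set L := (b - a) + (d - c).
have LS n : ((S n).1.2 - (S n).1.1) + ((S n).2.2 - (S n).2.1) = L / 2 ^+ n.
  elim: n => [|n IH]; first by rewrite expr0 divr1.
  have [_ -> -> _] := nS n; rewrite -mulrDl IH exprSr invfM; ring.
have rS n : cabs (rint F a b c d) / 4 ^+ n <= cabs (rQ (S n)).
  elim: n => [|n IH]; first by rewrite expr0 divr1.
  have [_ _ _ h] := nS n; apply: le_trans h; rewrite exprSr invfM mulrA.
  by rewrite ler_wpM2r.
have L0 : 0 <= L by rewrite /L; lra.
have [l Hl] := H x y (Hx 0%N) (Hy 0%N).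
(* The error of the linear approximation and the perimeter both shrink like 2^-n, which compensates
   the factor 4^n, so the bound does not depend on n. *)
have small e : 0 < e -> cabs (rint F a b c d) <= e * (2 * L ^+ 2).
  move=> e0; have [r r0 Hr] := Hl e e0.
  have [n Hn] : exists n : nat, L / 2 ^+ n < r.
    exists (Num.bound (L / r)); rewrite ltr_pdivrMr ?exprn_gt0 // mulrC -ltr_pdivrMr //.
    apply: lt_le_trans (archi_boundP (divr_ge0 L0 (ltW r0))) _.
    by rewrite -natrX ler_nat ltnW // ltn_expl.
  have [h1 h2 h3 h4 [h5 h6]] := vS n.
  have HS := holo_sub h1 h2 h3 h4 H.
  (* The first-order part of F at the common point of the rectangles; its boundary integral vanishes
     by direct computation. *)
  pose A z := (F (x +i* y) - l * (x +i* y)) + l * z.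
  have HA : holo_on A (S n).1.1 (S n).1.2 (S n).2.1 (S n).2.2.
    move=> s t _ _; eexists; apply: cderivD; first exact: cderiv_const.
    by apply: cderivZ; apply: cderiv_id.
  have HD : holo_on (fun z => F z + (-1) * A z) (S n).1.1 (S n).1.2 (S n).2.1 (S n).2.2.
    move=> s t hs ht; have [p Hp] := HS s t hs ht; have [q Hq] := HA s t hs ht.
    by eexists; apply: cderivD Hp _; apply: cderivZ Hq.
  have B s t : (S n).1.1 <= s <= (S n).1.2 -> (S n).2.1 <= t <= (S n).2.2 ->
      cabs (F (s +i* t) + (-1) * A (s +i* t)) <= e * (L / 2 ^+ n).
    move=> hs ht; have := Hr ((s +i* t) - (x +i* y)).
    have hh : cabs ((s +i* t) - (x +i* y)) <= L / 2 ^+ n.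
      apply: le_trans (cabs_ReIm _) _; rewrite -LS /=.
      have := Hx n; have := Hy n; move: hs ht => /andP[? ?] /andP[? ?] /andP[? ?] /andP[? ?].
      by apply: lerD; rewrite ler_norml; apply/andP; split; lra.
    rewrite [_ + (_ - _)]addrC subrK => /(_ (le_lt_trans hh Hn)) hF.
    apply: le_trans (ler_wpM2l (ltW e0) hh); apply: le_trans hF.
    by rewrite (_ : F _ - _ - _ = F (s +i* t) + -1 * A (s +i* t)) // /A; ring.
  have := rint_bound h5 h6 HD B.
  rewrite (rintB h5 h6 HS HA) rint_affine // subr0 -/(rQ (S n)) LS => hb.
  have := le_trans (rS n) hb; rewrite ler_pdivrMr ?exprn_gt0 // => /le_trans; apply.
  have -> : 4 = 2 * 2 :> R by ring.
  rewrite exprMn le_eqVlt; apply/orP; left; apply/eqP; field.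
  by rewrite expf_neq0.
apply/eqP; rewrite -cabs_eq0 eq_le cabs_ge0 andbT.
apply/ler_addgt0Pr => e e0; rewrite add0r.
have p0 : 0 < 1 + 2 * L ^+ 2 by rewrite ltr_pwDl // mulr_ge0 // sqr_ge0.
apply: le_trans (small (e / (1 + 2 * L ^+ 2)) _) _; first by rewrite divr_gt0.
rewrite mulrAC ler_pdivrMr // ler_wpM2l ?(ltW e0) //; lra.
Qed.

End Goursat.

(** * Uniqueness from boundary values almost everywhere *)

Section BoundaryUniqueness.
Variable R : realType.
Local Notation C := R[i].
Local Notation mu := (@lebesgue_measure R).
Implicit Types (z w : C) (x y a b c d : R) (F : C -> C).

Lemma Rint_dominated a b B (u : nat -> R -> R) :
  (forall n, mu.-integrable `[a, b] (EFin \o u n)) ->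
  (forall n t, a <= t <= b -> `|u n t| <= B) ->
  {ae mu, forall t, forall e, 0 < e -> exists N, forall n, (N <= n)%N -> `|u n t| <= e} ->
  forall e, 0 < e -> exists N, forall n, (N <= n)%N ->
    `|\int[mu]_(t in `[a, b]) u n t| <= e.
Proof.
move=> iu uB u0 e e0.
have [] := @dominated_convergence _ _ _ mu `[a, b]%classic (measurable_itv _)
  (fun n => EFin \o u n) (cst 0%E) (cst B%:E).
- by move=> n; have /integrableP[] := iu n.
- exact: measurable_cst.
- move: u0; apply: (@filterS _ _ (ae_filter_ringOfSetsType mu)) => t ut _; apply: cvg_EFin; first by apply: nearW => n.
  apply/cvgrPdist_le => k k0; have [N HN] := ut _ k0.
  by exists N => // n /= Nn; rewrite sub0r normrN; exact: HN.
- have [h _] := @cintegrable_cst R a b B%:C; exact: h.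
- apply: aeW => t n /=; rewrite in_itv /= => tab.
  by rewrite lee_fin uB.
move=> _ _; rewrite integral0 => /fine_cvgP[_ /cvgrPdist_le/(_ _ e0)[N _ HN]].
by exists N => n /HN; rewrite /= sub0r normrN.
Qed.

Lemma cint_dominated a b B (f : nat -> R -> C) :
  (forall n, cintegrable a b (f n)) ->
  (forall n t, a <= t <= b -> cabs (f n t) <= B) ->
  {ae mu, forall t, forall e, 0 < e -> exists N, forall n, (N <= n)%N -> cabs (f n t) <= e} ->
  forall e, 0 < e -> exists n, cabs (cint a b (f n)) <= e.
Proof.
move=> cf fB f0 e e0; have e2 : 0 < e / 2 by lra.
have [||| N1 H1] := @Rint_dominated a b B (fun n t => complex.Re (f n t)) _ _ _ _ e2.
- by move=> n; have [] := cf n.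
- by move=> n t h; apply: le_trans (cabs_Re _) (fB n t h).
- move: f0; apply: (@filterS _ _ (ae_filter_ringOfSetsType mu)) => t H k k0; have [N HN] := H k k0.
  by exists N => n h; apply: le_trans (cabs_Re _) (HN n h).
have [||| N2 H2] := @Rint_dominated a b B (fun n t => complex.Im (f n t)) _ _ _ _ e2.
- by move=> n; have [] := cf n.
- by move=> n t h; apply: le_trans (cabs_Im _) (fB n t h).
- move: f0; apply: (@filterS _ _ (ae_filter_ringOfSetsType mu)) => t H k k0; have [N HN] := H k k0.
  by exists N => n h; apply: le_trans (cabs_Im _) (HN n h).
exists (maxn N1 N2); apply: le_trans (cabs_ReIm _) _.
by have := H1 _ (leq_maxl N1 N2); have := H2 _ (leq_maxr N1 N2); rewrite /cint /=; lra.
Qed.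

Lemma cint_ge a b f u m : a <= b -> cintegrable a b f ->
  (forall t, a <= t <= b -> m <= complex.Re (u * f t)) ->
  m * (b - a) <= complex.Re (u * cint a b f).
Proof.
move=> ab cf fm; rewrite -cintZ //= -lebesgue_segment // -Rintegral_cst //.
have [h _] := cintegrableZ u cf; have [h2 _] := @cintegrable_cst R a b m%:C.
by apply: le_Rintegral => // t /=; rewrite in_itv /= => /fm.
Qed.

(** Vertical limits are the part of the nontangential limits that the rectangle argument uses. *)
Definition vanishes_at_boundary F : Prop :=
  {ae mu, forall x, forall e, 0 < e ->
    exists2 r, 0 < r & forall y, 0 < y < r -> cabs (F (x +i* y)) <= e}.

(** Cauchy's theorem on rectangles whose lower side descends to the axis: by dominated convergence
    that side contributes nothing in the limit, so the top is bounded by the two vertical sides. *)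
Lemma rint_top F a b d K S : a <= b -> 0 < d ->
  (forall z, 0 < complex.Im z -> exists l, cderiv F z l) ->
  vanishes_at_boundary F ->
  (forall x y, a <= x <= b -> 0 < y <= d -> cabs (F (x +i* y)) <= K) ->
  (forall y, 0 < y <= d -> cabs (F (a +i* y)) <= S /\ cabs (F (b +i* y)) <= S) ->
  cabs (cint a b (fun t => F (t +i* d))) <= 2 * S * d.
Proof.
move=> ab d0 HF F0 FK FS.
have hF c : 0 < c -> holo_on F a b c d by move=> c0 x y _ yc; apply: HF => /=; lra.
pose h n := d / n.+1%:R.
have h0 n : 0 < h n <= d.
  by rewrite /h divr_gt0 //= ler_pdivrMr // ler_peMr ?ler1n // ltW.
apply/ler_addgt0Pr => e e0.
have [||| n Hn] := @cint_dominated a b K (fun n t => F (t +i* (h n))) _ _ _ _ e0.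
- move=> n; have /andP[p q] := h0 n; apply: (holo_int_h (hF _ p)); lra.
- by move=> n t tab; apply: FK.
- move: F0; apply: (@filterS _ _ (ae_filter_ringOfSetsType mu)) => x Hx k k0; have [r r0 Hr] := Hx k k0.
  exists (Num.bound (d / r)) => n Nn; apply: Hr.
  have /andP[-> _] /= := h0 n; rewrite /h ltr_pdivrMr // mulrC -ltr_pdivrMr //.
  apply: lt_le_trans (archi_boundP (divr_ge0 (ltW d0) (ltW r0))) _.
  by rewrite ler_nat leqW.
have /andP[p q] := h0 n.
have := goursat ab q (hF _ p); rewrite /rint => E.
have i1 : cabs ('i : C) = 1 by rewrite cabsE /= expr0n add0r expr1n sqrtr1.
have side x : a <= x <= b -> (forall y, 0 < y <= d -> cabs (F (x +i* y)) <= S) ->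
    cabs ('i * cint (h n) d (fun t => F (x +i* t))) <= S * d.
  move=> xab xS; rewrite cabsM i1 mul1r.
  have S0 : 0 <= S.
    by apply: le_trans (xS d _); rewrite ?cabs_ge0 // d0 lexx.
  apply: (@le_trans _ _ (S * (d - h n))); last by rewrite ler_wpM2l //; lra.
  apply: cint_bound => //; first exact: (holo_int_v (hF _ p)).
  by move=> t tn; apply: xS; lra.
have -> : cint a b (fun t => F (t +i* d)) = cint a b (fun t => F (t +i* h n)) +
   'i * cint (h n) d (fun t => F (b +i* t)) - 'i * cint (h n) d (fun t => F (a +i* t)).
  by apply/eqP; rewrite eq_sym -subr_eq0 -[X in _ == X]E; apply/eqP; ring.
apply: le_trans (cabsB _ _) _; apply: le_trans (lerD (cabsD _ _) (lexx _)) _.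
have ha : a <= a <= b by lra. have hb : a <= b <= b by lra.
have := side a ha (fun y hy => (FS y hy).1); have := side b hb (fun y hy => (FS y hy).2); lra.
Qed.

(* By Cauchy's theorem the integral of F(z) exp(-n (z - z0)^2) over a segment through z0
   is that over the remaining sides of a rectangle standing on the axis, where it is
   exponentially smaller than the contribution of a neighbourhood of z0 if F(z0) != 0. *)
Theorem boundary_uniqueness F B :
  (forall z, 0 < complex.Im z -> exists l, cderiv F z l) ->
  (forall z, 0 < complex.Im z -> cabs (F z) <= B) ->
  vanishes_at_boundary F -> forall z, 0 < complex.Im z -> F z = 0.
Proof.
move=> HF FB F0 [x0 Y] /= Y0; set z0 := x0 +i* Y.
apply/eqP; rewrite -cabs_eq0; apply/negPn/negP => c0.
have {}c0 : 0 < cabs (F z0) by rewrite lt_def c0 cabs_ge0.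
set c := F z0 in c0 *.
have B0 : 0 <= B by apply: le_trans (FB z0 Y0); apply: cabs_ge0.
(* The modulus of this Gaussian is exp(-n ((x - x0)^2 - (y - Y)^2)): along the horizontal through z0
   it peaks at z0. *)
pose k (n : nat) z := cexp (- n%:R * (z - z0) ^+ 2).
have kE n x y : cabs (k n (x +i* y)) = expR (- n%:R * ((x - x0) ^+ 2 - (y - Y) ^+ 2)).
  rewrite /k cabs_cexp; congr expR; rewrite -[n%:R](rmorph_nat (real_complex R)).
  by rewrite expr2 -rmorphN cReM /=; ring.
have k_mono (n : nat) (s t : R) : s <= t -> expR (- n%:R * t) <= expR (- n%:R * s).
  by move=> st; rewrite ler_expR !mulNr lerN2 ler_wpM2l.
pose G n z := F z * k n z.
have HG n z : 0 < complex.Im z -> exists l, cderiv (G n) z l.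
  move=> /HF[l Hl].
  have [l2 h2] := cderivX 2 (cderivD (cderiv_id z) (cderiv_const (- z0) z)).
  by eexists; apply: cderivM Hl _; apply: cderiv_exp_lin; apply: cderivZ h2.
have G0 n : vanishes_at_boundary (G n).
  move: F0; apply: (@filterS _ _ (ae_filter_ringOfSetsType mu)) => x Hx e e0.
  set K := expR (- n%:R * (- Y ^+ 2)).
  have K0 : 0 < K by apply: expR_gt0.
  have [r r0 Hr] := Hx (e / K) (divr_gt0 e0 K0).
  exists (Num.min r Y) => [|y /andP[y0]]; first by rewrite lt_min r0.
  rewrite lt_min => /andP[yr yY]; rewrite /G cabsM kE.
  have := Hr y; rewrite y0 yr => /(_ isT); rewrite ler_pdivlMr //; apply: le_trans.
  rewrite ler_wpM2l ?cabs_ge0 // /K; apply: k_mono.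
  have := sqr_ge0 (x - x0); nra.
have [u u1 uc] := cabs_rot c.
have [l0 Hl0] := HF z0 Y0.
have c2 : 0 < cabs c / 2 by lra.
have [r r0 Hr] := cderiv_cont Hl0 c2.
(* h < r keeps F close to F(z0); h <= Y makes exp(-n h^2) dominate the vertical sides. *)
pose h := Num.min (r / 2) Y.
have h0 : 0 < h by rewrite /h lt_min Y0 andbT; lra.
have hY : h <= Y by rewrite /h ge_min lexx orbT.
have hr : h < r by apply: (@le_lt_trans _ _ (r / 2)); [rewrite /h ge_min lexx | lra].
have near t : `|t - x0| <= h -> cabs c / 2 <= complex.Re (u * F (t +i* Y)).
  move=> th; have := Hr (t - x0)%:C; rewrite cabs_real => /(_ (le_lt_trans th hr)).
  rewrite (_ : z0 + _ = t +i* Y); last by apply: complex_eq => /=; ring.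
  rewrite -/c => hc.
  have : `|complex.Re (u * (F (t +i* Y) - c))| <= cabs c / 2.
    apply: le_trans (cabs_Re _) _; rewrite cabsM; apply: le_trans hc.
    by rewrite ler_piMl // cabs_ge0.
  rewrite mulrBr cReD cReN -uc ler_norml; lra.
have GE n t : u * G n (t +i* Y) = (expR (- n%:R * (t - x0) ^+ 2))%:C * (u * F (t +i* Y)).
  rewrite /G mulrA mulrC; congr (_ * _); rewrite /k /cexp.
  rewrite (_ : - n%:R * (t +i* Y - z0) ^+ 2 = (- n%:R * (t - x0) ^+ 2)%:C) /=.
    by rewrite cos0 sin0 (_ : 1 +i* 0 = 1) ?mulr1.
  rewrite rmorphM rmorphN rmorph_nat rmorphXn; congr (_ * _ ^+ 2).
  by apply: complex_eq => /=; ring.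
have GRe n t : complex.Re (u * G n (t +i* Y)) =
    expR (- n%:R * (t - x0) ^+ 2) * complex.Re (u * F (t +i* Y)).
  by rewrite GE cReM /= mul0r subr0.
have RB t : - B <= complex.Re (u * F (t +i* Y)).
  have : `|complex.Re (u * F (t +i* Y))| <= B.
    apply: le_trans (cabs_Re _) _; rewrite cabsM; apply: le_trans (FB (t +i* Y) Y0).
    by rewrite ler_piMl // cabs_ge0.
  by rewrite ler_norml => /andP[].
have hY2 : h ^+ 2 <= Y ^+ 2 by apply: lerXn2r => //; rewrite nnegrE ltW.
have sq_far v : h <= `|v - x0| -> h ^+ 2 <= (v - x0) ^+ 2.
  by move=> hv; rewrite -(real_normK (num_real (v - x0))); apply: lerXn2r; rewrite ?nnegrE ?(ltW h0).
have sq_near v : `|v - x0| <= h / 2 -> (v - x0) ^+ 2 <= (h / 2) ^+ 2.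
  move=> hv; rewrite -(real_normK (num_real (v - x0))); apply: lerXn2r; rewrite ?nnegrE //.
  by rewrite divr_ge0 // ltW.
(* The half-width 2 Y gives (x - x0)^2 - (y - Y)^2 >= 3 Y^2 on the vertical sides, which contribute
   2 B Y; the points of the segment at distance at least h from x0 contribute at most 4 B Y. In
   between the real part is nonnegative, and only the distances up to h/2 are counted from below. *)
have key n : cabs c / 2 * h * expR (- n%:R * (h / 2) ^+ 2) <= 6 * B * Y * expR (- n%:R * h ^+ 2).
  set top := cint (x0 - 2 * Y) (x0 + 2 * Y) (fun t => G n (t +i* Y)).
  have up : cabs top <= 2 * (B * expR (- n%:R * (3 * Y ^+ 2))) * Y.
    apply: (@rint_top (G n) _ _ Y (B * expR (- n%:R * (- Y ^+ 2)))) => //; first lra.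
    - exact: HG.
    - move=> x y _ /andP[y0 yY]; rewrite /G cabsM kE.
      apply: ler_pM; rewrite ?cabs_ge0 ?expR_ge0 //; first exact: FB.
      by apply: k_mono; have := sqr_ge0 (x - x0); nra.
    - move=> y /andP[y0 yY]; split; rewrite /G cabsM kE;
      apply: ler_pM; rewrite ?cabs_ge0 ?expR_ge0 //; try exact: FB;
      apply: k_mono; nra.
  have up2 : cabs top <= 2 * B * Y * expR (- n%:R * h ^+ 2).
    have kk : expR (- n%:R * (3 * Y ^+ 2)) <= expR (- n%:R * h ^+ 2).
      by apply: k_mono; have := sqr_ge0 Y; lra.
    have BY : 0 <= B * Y by rewrite mulr_ge0 // ltW.
    by have := ler_wpM2l BY kk; lra.
  have cI : cintegrable (x0 - 2 * Y) (x0 + 2 * Y) (fun t => G n (t +i* Y)).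
    apply: (@holo_int_h _ _ _ _ Y Y); last by rewrite lexx.
    by move=> x y _ yY; apply: HG => /=; lra.
  have out s t : s <= t -> (forall v, s <= v <= t -> h ^+ 2 <= (v - x0) ^+ 2) ->
      cintegrable s t (fun t => G n (t +i* Y)) ->
      - (B * expR (- n%:R * h ^+ 2)) * (t - s) <= complex.Re (u * cint s t (fun t => G n (t +i* Y))).
    move=> st hv ci; apply: cint_ge => // v vst; have hq := k_mono n _ _ (hv v vst); rewrite GRe.
    have := RB v; have := expR_ge0 (- n%:R * (v - x0) ^+ 2).
    move: (complex.Re _) (expR (- n%:R * (v - x0) ^+ 2)) hq => P E hq E0 BP.
    have : 0 <= E * (P + B) by apply: mulr_ge0 => //; lra.
    have : B * E <= B * expR (- n%:R * h ^+ 2) by rewrite ler_wpM2l.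
    lra.
  have mid s t : s <= t -> (forall v, s <= v <= t -> `|v - x0| <= h) ->
      cintegrable s t (fun t => G n (t +i* Y)) ->
      0 <= complex.Re (u * cint s t (fun t => G n (t +i* Y))).
    move=> st hv ci; rewrite -(mul0r (t - s)); apply: cint_ge => // v /hv /near hq; rewrite GRe.
    by rewrite mulr_ge0 ?expR_ge0 //; lra.
  have i1 : x0 - 2 * Y <= x0 - h by lra.
  have i2 : x0 - h <= x0 - h / 2 by lra.
  have i3 : x0 - h / 2 <= x0 + h / 2 by lra.
  have i4 : x0 + h / 2 <= x0 + h by lra.
  have i5 : x0 + h <= x0 + 2 * Y by lra.
  have [|ci1 cr1 E1] := cint_split i1 _ cI; first lra.
  have [|ci2 cr2 E2] := cint_split i2 _ cr1; first lra.
  have [|ci3 cr3 E3] := cint_split i3 _ cr2; first lra.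
  have [ci4 ci5 E4] := cint_split i4 i5 cr3.
  have far1 v : x0 - 2 * Y <= v <= x0 - h -> h ^+ 2 <= (v - x0) ^+ 2.
    by move=> hv; apply: sq_far; rewrite ler0_norm; lra.
  have far5 v : x0 + h <= v <= x0 + 2 * Y -> h ^+ 2 <= (v - x0) ^+ 2.
    by move=> hv; apply: sq_far; rewrite ger0_norm; lra.
  have b1 := out _ _ i1 far1 ci1.
  have b5 := out _ _ i5 far5 ci5.
  have b2 := mid _ _ i2 (fun v hv => ltac:(rewrite ler_norml; lra)) ci2.
  have b4 := mid _ _ i4 (fun v hv => ltac:(rewrite ler_norml; lra)) ci4.
  have b3 : cabs c / 2 * expR (- n%:R * (h / 2) ^+ 2) * (x0 + h / 2 - (x0 - h / 2)) <=
      complex.Re (u * cint (x0 - h / 2) (x0 + h / 2) (fun t => G n (t +i* Y))).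
    apply: cint_ge => // v hv; rewrite GRe mulrC.
    apply: ler_pM; rewrite ?expR_ge0 //; first lra.
      by apply: k_mono; apply: sq_near; rewrite ler_norml; lra.
    by apply: near; rewrite ler_norml; lra.
  have Rtop : complex.Re (u * top) <= cabs top.
    apply: le_trans (ler_norm _) _; apply: le_trans (cabs_Re _) _.
    by rewrite cabsM ler_piMl // cabs_ge0.
  move: Rtop; rewrite {1}/top E1 E2 E3 E4 !mulrDr !cReD.
  set E := expR (- n%:R * h ^+ 2) in b1 b5 up2 *.
  have E0 : 0 <= E by apply: expR_ge0.
  have BE : 0 <= B * E * h by rewrite !mulr_ge0 // ltW.
  move: b3; set T := expR _; move=> b3 Rtop; lra.
pose n := Num.bound ((6 * B * Y) / (cabs c / 2 * h * (h / 2) ^+ 2)).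
have ch : 0 < cabs c / 2 * h by rewrite mulr_gt0.
have h2 : 0 < (h / 2) ^+ 2 by rewrite exprn_gt0 // divr_gt0.
have := key n; set q := expR (- n%:R * (h / 2) ^+ 2).
have q0 : 0 < q by apply: expR_gt0.
(* As h is twice h/2, the right side of [key] carries the fourth power of the q on its left;
   dividing by q leaves a bound that tends to 0. *)
have -> : expR (- n%:R * h ^+ 2) = q ^+ 4.
  by rewrite -expRM_natl; congr expR; field.
have q1 : q * (1 + n%:R * (h / 2) ^+ 2) <= 1.
  have E : q * expR (n%:R * (h / 2) ^+ 2) = 1 by rewrite /q mulNr mulrC expRxMexpNx_1.
  by rewrite -[leRHS]E ler_wpM2l ?(ltW q0) // expR_ge1Dx.
have bn : 6 * B * Y < cabs c / 2 * h * (h / 2) ^+ 2 * n%:R.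
  have D0 : 0 < cabs c / 2 * h * (h / 2) ^+ 2 by rewrite mulr_gt0.
  have : 0 <= 6 * B * Y / (cabs c / 2 * h * (h / 2) ^+ 2).
    by apply: divr_ge0 (ltW D0); rewrite !mulr_ge0 // ltW.
  by move=> /archi_boundP; rewrite ltr_pdivrMr // [_ * (_ * _)]mulrC.
have n0 : 0 <= n%:R * (h / 2) ^+ 2 by rewrite mulr_ge0 // ltW.
have q1' : q <= 1 by nra.
have q3 : q ^+ 4 <= q * q.
  by rewrite -expr2 ler_wiXn2l // ltW.
move=> hk; suff : cabs c / 2 * h <= 6 * B * Y * q by nra.
rewrite -(ler_pM2r q0); apply: le_trans hk _.
by rewrite -[leRHS]mulrA ler_wpM2l // !mulr_ge0 // ltW.
Qed.

End BoundaryUniqueness.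

(** * Trigonometric polynomials and Bohr coefficients *)

Section TrigPoly.
Variable R : realType.
Local Notation C := R[i].
Implicit Types (s : seq (C * R)) (l x y a b : R) (f g : R -> C).

(** Trigonometric polynomials are lists of pairs (coefficient, frequency), repetitions allowed. Sums
    and products then act termwise and [nrm] is exactly additive and multiplicative, while it only
    bounds the coefficient norm of the function from above. *)
Definition ev s x : C := \sum_(t <- s) t.1 * e_ t.2 x.
Definition nrm s : R := \sum_(t <- s) cabs t.1.
Definition pmul s s' : seq (C * R) := [seq (t.1 * u.1, t.2 + u.2) | t <- s, u <- s'].
Definition pscale (c : C) s := [seq (c * t.1, t.2) | t <- s].
Definition pexp s n := iter n (pmul s) [:: (1, 0)].
Definition pconj s : seq (C * R) := [seq (t.1^*, - t.2) | t <- s].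
(* For a character [v] of the frequencies, the value of [s] at the point [v] of the Bohr
   compactification. *)
Definition pchar (v : R -> C) s : C := \sum_(t <- s) t.1 * v t.2.

Lemma nrm_ge0 s : 0 <= nrm s.
Proof. by apply: sumr_ge0 => t _; apply: cabs_ge0. Qed.

Lemma nrm_cat s s' : nrm (s ++ s') = nrm s + nrm s'.
Proof. by rewrite /nrm big_cat. Qed.

Lemma nrm_scale c s : nrm (pscale c s) = cabs c * nrm s.
Proof. by rewrite /nrm big_map mulr_sumr; apply: eq_bigr => t _; rewrite cabsM. Qed.

Lemma nrm_mul s s' : nrm (pmul s s') = nrm s * nrm s'.
Proof.
rewrite /nrm big_allpairs_dep mulr_suml; apply: eq_bigr => t _.
by rewrite mulr_sumr; apply: eq_bigr => u _; rewrite cabsM.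
Qed.

Lemma pchar_cat v s s' : pchar v (s ++ s') = pchar v s + pchar v s'.
Proof. by rewrite /pchar big_cat. Qed.

Lemma pchar_scale v c s : pchar v (pscale c s) = c * pchar v s.
Proof. by rewrite /pchar big_map mulr_sumr; apply: eq_bigr => t _; rewrite mulrA. Qed.

Lemma pchar_mul (S : set R) v s s' :
  (forall l m, S l -> S m -> v (l + m) = v l * v m) ->
  (forall t, t \in s -> S t.2) -> (forall t, t \in s' -> S t.2) ->
  pchar v (pmul s s') = pchar v s * pchar v s'.
Proof.
move=> vM sS sS'; rewrite /pchar big_allpairs_dep mulr_suml.
rewrite big_seq [RHS]big_seq; apply: eq_bigr => t ts.
rewrite mulr_sumr big_seq [RHS]big_seq; apply: eq_bigr => u us.
by rewrite /= (vM _ _ (sS _ ts) (sS' _ us)); ring.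
Qed.

Lemma evE s x : ev s x = pchar (fun l => e_ l x) s. Proof. by []. Qed.

Lemma ev_cat s s' x : ev (s ++ s') x = ev s x + ev s' x.
Proof. by rewrite !evE pchar_cat. Qed.

Lemma ev_scale c s x : ev (pscale c s) x = c * ev s x.
Proof. by rewrite !evE pchar_scale. Qed.

Lemma ev_mul s s' x : ev (pmul s s') x = ev s x * ev s' x.
Proof. by rewrite !evE (@pchar_mul setT) // => l m _ _; rewrite e_D. Qed.

Lemma ev_exp s n x : ev (pexp s n) x = ev s x ^+ n.
Proof.
elim: n => [|n IH]; first by rewrite /ev big_seq1 e_0 mulr1.
by rewrite /pexp iterS ev_mul IH exprS.
Qed.

Lemma ev_conj s x : ev (pconj s) x = (ev s x)^*.
Proof.
rewrite /ev big_map rmorph_sum; apply: eq_bigr => t _.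
by rewrite rmorphM; congr (_ * _); apply/esym; exact: e_conj.
Qed.

Lemma ev_nil x : ev [::] x = 0. Proof. by rewrite /ev big_nil. Qed.

Lemma ev_seq1 c l x : ev [:: (c, l)] x = c * e_ l x.
Proof. by rewrite /ev big_seq1. Qed.

Lemma ev_bound s x : cabs (ev s x) <= nrm s.
Proof.
apply: le_trans (cabs_sum _ _ _) _; apply: ler_sum => t _.
by rewrite cabsM cabs_e mulr1.
Qed.

Lemma mem_pmul (S : set R) s s' : (forall l m, S l -> S m -> S (l + m)) ->
  (forall t, t \in s -> S t.2) -> (forall t, t \in s' -> S t.2) ->
  forall t, t \in pmul s s' -> S t.2.
Proof.
by move=> SD hs hs' t /allpairsP[[p q] /= [ps qs ->]] /=; apply: SD; [apply: hs|apply: hs'].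
Qed.

Lemma mem_pexp (S : set R) s n : S 0 -> (forall l m, S l -> S m -> S (l + m)) ->
  (forall t, t \in s -> S t.2) -> forall t, t \in pexp s n -> S t.2.
Proof.
move=> S0 SD hs; elim: n => [|n IH] t; first by rewrite inE => /eqP ->.
by rewrite /pexp iterS; apply: mem_pmul.
Qed.

Lemma pchar_exp (S : set R) v s n : S 0 -> (forall l m, S l -> S m -> S (l + m)) ->
  v 0 = 1 -> (forall l m, S l -> S m -> v (l + m) = v l * v m) ->
  (forall t, t \in s -> S t.2) -> pchar v (pexp s n) = pchar v s ^+ n.
Proof.
move=> S0 SD v0 vM hs; elim: n => [|n IH]; first by rewrite /pchar big_seq1 v0 mulr1.
rewrite /pexp iterS (pchar_mul vM) ?IH ?exprS //.
exact: mem_pexp.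
Qed.

(** All sums of the k_l l with 0 <= k_l <= n. They contain the frequencies of an n-th power, and
    their number is polynomial in n. *)
Fixpoint combos n (ls : seq R) : seq R :=
  if ls is l :: ls' then [seq l *+ i + m | i <- iota 0 n.+1, m <- combos n ls']
  else [:: 0].

Lemma size_combos n ls : size (combos n ls) = (n.+1 ^ size ls)%N.
Proof.
elim: ls => // l ls IH; rewrite [combos _ _]/(allpairs (fun i m => l *+ i + m) (iota 0 n.+1) (combos n ls)).
by rewrite size_allpairs size_iota IH expnS.
Qed.

Lemma combosP n l ls m : m \in combos n (l :: ls) ->
  exists i m', [/\ (i <= n)%N, m' \in combos n ls & m = l *+ i + m'].
Proof.
move=> /allpairsP[[i m'] [/=]]; rewrite -/(iota 0 n.+1) mem_iota /= => hi hm ->.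
by exists i, m'.
Qed.

Lemma combosI n l ls i m : (i <= n)%N -> m \in combos n ls -> l *+ i + m \in combos n (l :: ls).
Proof.
move=> hi hm; apply/allpairsP; exists (i, m); split=> //=.
by rewrite -/(iota 0 n.+1) mem_iota.
Qed.

Lemma combosS n ls m : m \in combos n ls -> m \in combos n.+1 ls.
Proof.
elim: ls m => // l ls IH m /combosP[i [m' [hi /IH hm ->]]].
by apply: combosI => //; apply: leqW.
Qed.

Lemma combosD n ls l m : l \in ls -> m \in combos n ls -> l + m \in combos n.+1 ls.
Proof.
elim: ls m => // k ls IH m; rewrite inE => /orP[/eqP ->|ll] /combosP[i [m' [hi hm ->]]].
  by rewrite addrA -mulrS; apply: combosI => //; apply: combosS.
by rewrite addrCA; apply: combosI; [apply: leqW|apply: IH].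
Qed.

Lemma combos0 n ls : 0 \in combos n ls.
Proof.
by elim: ls => [|l ls IH]; rewrite ?inE // -[0](addr0) -{1}(mulr0n l) combosI.
Qed.

Lemma pexp_combos s n t : t \in pexp s n -> t.2 \in combos n [seq u.2 | u <- s].
Proof.
elim: n t => [|n IH] t; first by rewrite inE => /eqP ->; apply: combos0.
rewrite /pexp iterS => /allpairsP[[p q] /= [ps qs ->]] /=.
by apply: combosD; [apply: map_f|apply: IH].
Qed.

Definition coef s l : C := \sum_(t <- s | t.2 == l) t.1.

Lemma pcharE (L : seq R) v s : (forall t, t \in s -> t.2 \in L) ->
  pchar v s = \sum_(l <- undup L) coef s l * v l.
Proof.
move=> sL; rewrite /coef; under eq_bigr do rewrite big_mkcond mulr_suml.
rewrite exchange_big /= /pchar big_seq [RHS]big_seq; apply: eq_bigr => t ts.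
rewrite (bigD1_seq t.2) ?mem_undup ?undup_uniq ?sL //= eqxx big1 ?addr0 // => l.
by rewrite eq_sym => /negbTE ->; rewrite mul0r.
Qed.

Lemma coef_notin s l : (forall t, t \in s -> t.2 != l) -> coef s l = 0.
Proof.
move=> h; rewrite /coef big_seq_cond big1 // => t /andP[/h/negbTE ->].
by [].
Qed.

(** Induction on D: writing q = r^2, Bernoulli's inequality absorbs one factor n + 1 into r^n, and
    the rest is the induction hypothesis at r. *)
Lemma poly_exp_bound D (q : R) : 0 < q < 1 ->
  exists2 K, 0 < K & forall n : nat, n.+1%:R ^+ D * q ^+ n <= K.
Proof.
elim: D q => [|D IH] q /andP[q0 q1].
  by exists 1 => // n; rewrite expr0 mul1r exprn_ile1 // ltW.
have r0 : 0 < Num.sqrt q by rewrite sqrtr_gt0.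
have r1 : Num.sqrt q < 1 by rewrite -[X in _ < X]sqrtr1 ltr_sqrt.
have [K K0 HK] := IH (Num.sqrt q) (introT andP (conj r0 r1)).
set r := Num.sqrt q in r0 r1 HK.
have qr n : q ^+ n = r ^+ n * r ^+ n by rewrite -exprMn -expr2 sqr_sqrtr // ltW.
pose d := r^-1 - 1.
have d0 : 0 < d by rewrite subr_gt0 invf_gt1.
exists (K * (1 + d^-1)); first by rewrite mulr_gt0 // addr_gt0 // invr_gt0.
move=> n; rewrite qr exprSr mulrACA ler_pM ?mulr_ge0 ?exprn_ge0 ?(ltW r0) //.
have B : 1 + n%:R * d <= r^-1 ^+ n.
  elim: n => [|n IHn]; first by rewrite mul0r addr0.
  rewrite exprS (_ : r^-1 = 1 + d); last by rewrite /d; ring.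
  have p1 : 0 <= 1 + d by lra.
  rewrite (_ : r^-1 = 1 + d) in IHn; last by rewrite /d; ring.
  apply: le_trans (ler_wpM2l p1 IHn).
  by rewrite -natr1; have := ler0n R n; nra.
have rn : 0 < r ^+ n by rewrite exprn_gt0.
have B2 : (1 + n%:R * d) * r ^+ n <= 1 by rewrite -ler_pdivlMr // div1r -exprVn.
have -> : n.+1%:R * r ^+ n = r ^+ n + (n%:R * d * r ^+ n) / d.
  by rewrite -natr1; field; rewrite gt_eqF.
have h1 : r ^+ n <= 1 by rewrite exprn_ile1 // ltW.
have h2 : n%:R * d * r ^+ n <= 1 by lra.
by rewrite lerD // ler_pdivrMr // mulVf ?gt_eqF.
Qed.

(** The bound in degree D + 1 gains a factor 1/(n + 1). It is applied at r = (1 + q)/2, which is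
    positive even for q = 0. *)
Lemma poly_exp_small D (q e : R) : 0 <= q < 1 -> 0 < e ->
  exists n : nat, n.+1%:R ^+ D * q ^+ n <= e.
Proof.
move=> /andP[q0 q1] e0; pose r := (1 + q) / 2.
have r01 : 0 < r < 1 by rewrite /r; lra.
have [K K0 HK] := poly_exp_bound D.+1 r01.
exists (Num.bound (K / e)); set n := Num.bound _.
have nK : K < e * n.+1%:R.
  rewrite mulrC -ltr_pdivrMr //; apply: lt_le_trans (archi_boundP _) _.
    by rewrite divr_ge0 // ltW.
  by rewrite ler_nat.
rewrite -(ler_pM2r (ltr0Sn R n)); apply: le_trans (ltW nK).
apply: le_trans (HK n); rewrite exprSr mulrAC ler_wpM2l ?mulr_ge0 ?exprn_ge0 //.
by apply: lerXn2r; rewrite ?nnegrE; rewrite /r; lra.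
Qed.

End TrigPoly.

(** * Continuity and means of almost periodic functions *)

Section Means.
Variable R : realType.
Local Notation C := R[i].
Local Notation mu := (@lebesgue_measure R).
Implicit Types (s : seq (C * R)) (l x y a b T : R) (f g : R -> C).

Definition ccontinuous f : Prop :=
  forall x e, 0 < e -> exists2 r, 0 < r & forall y, `|y - x| < r -> cabs (f y - f x) <= e.

Lemma ccontinuous_cintegrable f a b : ccontinuous f -> cintegrable a b f.
Proof.
move=> cf; apply: ccontinuous_integrable => x _ e /(cf x)[r r0 Hr].
by exists r => // y _; apply: Hr.
Qed.

Lemma e_sub1_le l x : cabs (e_ l x - 1 : C) <= 2 * `|l * x|.
Proof.
apply: le_trans (cabs_ReIm _) _; rewrite e_E cReD cImD cReN cImN /= oppr0 addr0.
have := sin_le_norm (l * x); suff : `|cos (l * x) - 1| <= `|l * x| by lra.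
have [c _ E] := mvt0 (l * x) (@is_derive_cos R).
by move: E; rewrite cos0 => ->; rewrite normrM normrN ler_piMl // sin_max.
Qed.

Lemma e_sub l x y : cabs (e_ l y - e_ l x : C) = cabs (e_ l (y - x) - 1 : C).
Proof.
have -> : e_ l y - e_ l x = e_ l x * (e_ l (y - x) - 1) :> C.
  by rewrite mulrBr -e_Dx mulr1 addrCA subrr addr0.
by rewrite cabsM cabs_e mul1r.
Qed.

Lemma ev_continuous s : ccontinuous (ev s).
Proof.
move=> x e e0; pose K := 1 + \sum_(t <- s) cabs t.1 * (2 * `|t.2|).
have K1 : 1 <= K by rewrite lerDl sumr_ge0 // => t _; rewrite !mulr_ge0 ?cabs_ge0.
have K0 : 0 < K by lra.
exists (e / K) => [|y]; first by rewrite divr_gt0.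
rewrite ltr_pdivlMr // => h; rewrite /ev -sumrB.
apply: le_trans (cabs_sum _ _ _) _; apply: (@le_trans _ _ (`|y - x| * K)); last exact: ltW.
rewrite /K mulrDr mulr1 mulr_sumr ler_wpDl //.
apply: ler_sum => t _; rewrite -mulrBr cabsM e_sub mulrCA ler_wpM2l ?cabs_ge0 //.
by apply: le_trans (e_sub1_le _ _) _; rewrite normrM; lra.
Qed.

Lemma uniform_limit_continuous f :
  (forall e, 0 < e -> exists2 g, ccontinuous g & forall x, cabs (f x - g x) <= e) ->
  ccontinuous f.
Proof.
move=> H x e e0; have e3 : 0 < e / 3 by lra.
have [g cg fg] := H _ e3; have [r r0 Hr] := cg x _ e3; exists r => // y /Hr h.
have -> : f y - f x = (f y - g y) + (g y - g x) - (f x - g x) by ring.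
apply: le_trans (cabsB _ _) _; apply: le_trans (lerD (cabsD _ _) (lexx _)) _.
have := fg x; have := fg y; lra.
Qed.

Lemma APP f : AP f <->
  forall e, 0 < e -> exists s, forall x, cabs (f x - ev s x) <= e.
Proof.
split=> H e /H[p]; last by exists (ev p) => //; exists p.
by move=> [s ps] h; exists s => x; rewrite /ev -ps.
Qed.

Lemma AP_continuous f : AP f -> ccontinuous f.
Proof.
move=> /APP Af; apply: uniform_limit_continuous => e /Af[s h].
by exists (ev s) => //; apply: ev_continuous.
Qed.

Lemma AP_ev s : AP (ev s).
Proof. by apply/APP => e e0; exists s => x; rewrite subrr cabs0 ltW. Qed.

Lemma AP_bounded f : AP f -> exists2 B, 0 <= B & forall x, cabs (f x) <= B.
Proof.
move=> /APP/(_ 1 ltr01)[s h]; exists (1 + nrm s) => [|x].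
  by rewrite addr_ge0 // nrm_ge0.
rewrite -[f x](subrK (ev s x)); apply: le_trans (cabsD _ _) _.
by rewrite lerD // ev_bound.
Qed.

Lemma AP_D f g : AP f -> AP g -> AP (fun x => f x + g x).
Proof.
move=> /APP Af /APP Ag; apply/APP => e e0; have e2 : 0 < e / 2 by lra.
have [s hs] := Af _ e2; have [s' hs'] := Ag _ e2; exists (s ++ s') => x.
rewrite ev_cat (_ : _ - _ = (f x - ev s x) + (g x - ev s' x)); last by ring.
by apply: le_trans (cabsD _ _) _; have := hs x; have := hs' x; lra.
Qed.

Lemma AP_Z c f : AP f -> AP (fun x => c * f x).
Proof.
move=> /APP Af; apply/APP => e e0.
have c0 : 0 < 1 + cabs c by rewrite ltr_wpDr // cabs_ge0.
have [s hs] := Af _ (divr_gt0 e0 c0); exists (pscale c s) => x.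
rewrite ev_scale -mulrBr cabsM; have := hs x; rewrite ler_pdivlMr //.
by have := cabs_ge0 (f x - ev s x); have := cabs_ge0 c; nra.
Qed.

Lemma AP_M f g : AP f -> AP g -> AP (fun x => f x * g x).
Proof.
move=> Af Ag; have [B B0 fB] := AP_bounded Af.
move/APP: Af => Af; move/APP: Ag => Ag; apply/APP => e e0.
have b0 : 0 < 2 * (1 + B) by lra.
have [s' hs'] := Ag _ (divr_gt0 e0 b0).
have k0 : 0 < 2 * (1 + nrm s') by have := nrm_ge0 s'; lra.
have [s hs] := Af _ (divr_gt0 e0 k0).
exists (pmul s s') => x; rewrite ev_mul.
have -> : f x * g x - ev s x * ev s' x = f x * (g x - ev s' x) + (f x - ev s x) * ev s' x by ring.
apply: le_trans (cabsD _ _) _; rewrite !cabsM.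
have := hs x; have := hs' x; have := fB x; have := ev_bound s' x; rewrite !ler_pdivlMr //.
have := cabs_ge0 (f x); have := cabs_ge0 (g x - ev s' x); have := cabs_ge0 (f x - ev s x).
have := cabs_ge0 (ev s' x); have := nrm_ge0 s'.
move: (cabs (f x)) (cabs (g x - _)) (cabs (f x - _)) (cabs (ev s' x)) (nrm s') => F D1 D2 E N.
move=> N0 E0 D20 D10 F0 EN FB h1 h2.
have : F * D1 <= B * D1 by rewrite ler_wpM2r.
have : D2 * E <= D2 * N by rewrite ler_wpM2l.
nra.
Qed.

Lemma AP_e l : AP (fun x => e_ l x).
Proof.
by apply/APP => e e0; exists [:: (1, l)] => x; rewrite ev_seq1 mul1r subrr cabs0 ltW.
Qed.

(** The value m is explicit, so that means can be computed before [lim] is known to exist;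
    [has_mean_lim] returns to [bohr_mean]. *)
Definition has_mean f (m : C) : Prop :=
  forall e, 0 < e -> exists T0, forall T, T0 < T -> cabs (average f T - m) <= e.

Lemma averageE f T : average f T = ((2 * T)^-1)%:C * cint (- T) T f.
Proof. by []. Qed.

Lemma has_mean_lim f m : has_mean f m -> bohr_mean f = m.
Proof.
move=> H; apply: (@cvg_lim R[i]^o); first exact: norm_hausdorff.
apply/cvgCP => e /H[T0 HT]; exists T0; split; first by rewrite num_real.
by move=> T /HT.
Qed.

Lemma averageD f g T : ccontinuous f -> ccontinuous g ->
  average (fun x => f x + g x) T = average f T + average g T.
Proof.
move=> cf cg; rewrite !averageE cintD ?mulrDr //; exact: ccontinuous_cintegrable.
Qed.

Lemma averageZ c f T : ccontinuous f -> average (fun x => c * f x) T = c * average f T.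
Proof.
move=> cf; rewrite !averageE cintZ; last exact: ccontinuous_cintegrable.
by ring.
Qed.

Lemma average_bound f B T : 0 < T -> ccontinuous f -> (forall x, cabs (f x) <= B) ->
  cabs (average f T) <= B.
Proof.
move=> T0 cf fB; rewrite averageE cabsM cabs_real.
have T2 : 0 < 2 * T by lra.
rewrite ger0_norm; last by rewrite invr_ge0 ltW.
rewrite [_^-1 * _]mulrC ler_pdivrMr //.
have -> : 2 * T = T - (- T) by ring.
apply: cint_bound; [lra|exact: ccontinuous_cintegrable|by []].
Qed.

Lemma has_meanD f g m n : ccontinuous f -> ccontinuous g -> has_mean f m -> has_mean g n ->
  has_mean (fun x => f x + g x) (m + n).
Proof.
move=> cf cg Hf Hg e e0; have e2 : 0 < e / 2 by lra.
have [T0 h0] := Hf _ e2; have [T1 h1] := Hg _ e2.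
exists (Num.max T0 T1) => T; rewrite gt_max => /andP[/h0 k0 /h1 k1].
rewrite averageD // (_ : _ - _ = (average f T - m) + (average g T - n)); last by ring.
by apply: le_trans (cabsD _ _) _; lra.
Qed.

Lemma has_meanZ c f m : ccontinuous f -> has_mean f m -> has_mean (fun x => c * f x) (c * m).
Proof.
move=> cf Hf e e0; have c0 : 0 < 1 + cabs c by rewrite ltr_wpDr // cabs_ge0.
have [T0 h0] := Hf _ (divr_gt0 e0 c0); exists T0 => T /h0.
rewrite averageZ // -mulrBr cabsM ler_pdivlMr //.
by have := cabs_ge0 (average f T - m); have := cabs_ge0 c; nra.
Qed.

Lemma has_mean_e l : has_mean (fun x => e_ l x) (if l == 0 then 1 else 0).
Proof.
move=> e e0; have [->|l0] := eqVneq l 0.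
  exists 0 => T T0; rewrite (_ : (fun x => _) = fun=> 1 : C); last by apply/funext => x; rewrite e_0.
  rewrite averageE cint_cst; last by lra.
  rewrite mulr1 -rmorphM (_ : (2 * T)^-1 * (T - - T) = 1); last by field; lra.
  by rewrite subrr cabs0 ltW.
have cL : 0 < `|l| by rewrite normr_gt0.
(* The average over [-T, T] is sin(l T) / (l T), the imaginary part cancelling. *)
exists (Num.max 1 (2 / (`|l| * e))) => T; rewrite gt_max => /andP[T1 hT].
have T0 : 0 < T by lra.
have TT : - T <= T by lra.
rewrite subr0 averageE cabsM cabs_real ger0_norm; last by rewrite invr_ge0; lra.
rewrite [_^-1 * _]mulrC ler_pdivrMr ?mulr_gt0 //.
have dlin (t : R) : is_derive (t : R) (1 : R) (fun t : R => l * t) l.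
  by apply: is_derive_eq; rewrite /GRing.scale /= mulr1.
have clin : continuous (fun t : R => l * t) by move=> t; apply: mulrl_continuous.
have d1 (t : R) : is_derive (t : R) (1 : R) (fun t : R => l^-1 * sin (l * t)) (cos (l * t)).
  have := is_derive1_comp (is_derive_sin (l * t)) (dlin t).
  move=> /(is_deriveZ (l^-1)) h.
  by rewrite (_ : cos (l * t) = l^-1 *: (cos (l * t) * l)) //; rewrite /GRing.scale /=; field.
have d2 (t : R) : is_derive (t : R) (1 : R) (fun t : R => (- l^-1) * cos (l * t)) (sin (l * t)).
  have := is_derive1_comp (is_derive_cos (l * t)) (dlin t).
  move=> /(is_deriveZ (- l^-1)) h.
  by rewrite (_ : sin (l * t) = - l^-1 *: (- sin (l * t) * l)) //; rewrite /GRing.scale /=; field.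
have I1 : \int[mu]_(t in `[- T, T]) complex.Re (e_ l t : C) =
    l^-1 * sin (l * T) - l^-1 * sin (l * - T).
  rewrite -(Rint_FTC TT d1); last first.
    by move=> t; apply: continuous_comp; [exact: clin|exact: continuous_cos].
  by apply: eq_Rintegral => t _; rewrite e_E.
have I2 : \int[mu]_(t in `[- T, T]) complex.Im (e_ l t : C) =
    (- l^-1) * cos (l * T) - (- l^-1) * cos (l * - T).
  rewrite -(Rint_FTC TT d2); last first.
    by move=> t; apply: continuous_comp; [exact: clin|exact: continuous_sin].
  by apply: eq_Rintegral => t _; rewrite e_E.
apply: le_trans (cabs_ReIm _) _; rewrite /cint /= I1 I2 mulrN sinN cosN subrr normr0 addr0.
move: hT; rewrite ltr_pdivrMr ?mulr_gt0 // => hT.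
rewrite (_ : _ - _ = 2 * sin (l * T) / l); last by field.
rewrite !normrM normfV ler_pdivrMr // ger0_norm //.
by have := sin_max (l * T); lra.
Qed.

End Means.

(** * Bohr coefficients and their uniqueness theorem *)

Section BohrCoef.
Variable R : realType.
Local Notation C := R[i].
Implicit Types (s : seq (C * R)) (l x y a b T : R) (f g : R -> C).

Lemma has_mean_bound f m B : ccontinuous f -> has_mean f m ->
  (forall x, cabs (f x) <= B) -> cabs m <= B.
Proof.
move=> cf Hf fB; apply/ler_addgt0Pr => e e0; have [T0 HT] := Hf e e0.
pose T := Num.max 1 (T0 + 1).
have T1 : 0 < T by rewrite /T lt_max ltr01.
have T2 : T0 < T by rewrite /T lt_max ltrDl ltr01 orbT.
have -> : m = average f T - (average f T - m) by ring.
by apply: le_trans (cabsB _ _) _; apply: lerD (average_bound T1 cf fB) (HT _ T2).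
Qed.

Lemma has_mean_ge0 f m : has_mean f m -> (forall x, 0 <= complex.Re (f x)) ->
  0 <= complex.Re m.
Proof.
move=> Hf f0; apply/ler_addgt0Pr => e e0; have [T0 HT] := Hf e e0.
pose T := Num.max 1 (T0 + 1).
have T1 : 0 < T by rewrite /T lt_max ltr01.
have T2 : T0 < T by rewrite /T lt_max ltrDl ltr01 orbT.
have A0 : 0 <= complex.Re (average f T).
  rewrite averageE cReM /= mul0r subr0 mulr_ge0 //.
    by rewrite invr_ge0; lra.
  by apply: Rintegral_ge0.
have := le_trans (cabs_Re _) (HT _ T2); rewrite cReD cReN ler_norml; lra.
Qed.

Lemma ccontinuousD f g : ccontinuous f -> ccontinuous g -> ccontinuous (fun x => f x + g x).
Proof.
move=> cf cg x e e0; have e2 : 0 < e / 2 by lra.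
have [r r0 Hr] := cf x _ e2; have [t t0 Ht] := cg x _ e2.
exists (Num.min r t) => [|y]; first by rewrite lt_min r0.
rewrite lt_min => /andP[/Hr h1 /Ht h2].
rewrite (_ : _ - _ = (f y - f x) + (g y - g x)); last by ring.
by apply: le_trans (cabsD _ _) _; lra.
Qed.

Lemma ccontinuousZ c f : ccontinuous f -> ccontinuous (fun x => c * f x).
Proof.
move=> cf x e e0; have c0 : 0 < 1 + cabs c by rewrite ltr_wpDr // cabs_ge0.
have [r r0 Hr] := cf x _ (divr_gt0 e0 c0); exists r => // y /Hr.
rewrite -mulrBr cabsM ler_pdivlMr //.
by have := cabs_ge0 (f y - f x); have := cabs_ge0 c; nra.
Qed.

Lemma has_mean_dist f g m n e : ccontinuous f -> ccontinuous g ->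
  has_mean f m -> has_mean g n -> (forall x, cabs (f x - g x) <= e) -> cabs (m - n) <= e.
Proof.
move=> cf cg Hf Hg fg.
have H := has_meanD cf (ccontinuousZ (-1) cg) Hf (has_meanZ (-1) cg Hg).
rewrite -[n]mul1r -mulNr; apply: has_mean_bound H _.
  exact: ccontinuousD (ccontinuousZ _ _).
by move=> x; rewrite mulN1r.
Qed.

Lemma eq_has_mean f g m : (forall x, f x = g x) -> has_mean f m -> has_mean g m.
Proof. by move=> /funext ->. Qed.

Lemma has_mean_ev s : has_mean (ev s) (coef s 0).
Proof.
elim: s => [|t s IH].
  apply: (@eq_has_mean (fun x => 0 * e_ 0 x)) => [x|]; first by rewrite ev_nil mul0r.
  have := has_meanZ 0 (AP_continuous (AP_e 0)) (@has_mean_e R 0).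
  by rewrite mul0r /coef big_nil.
apply: (@eq_has_mean (fun x => t.1 * e_ t.2 x + ev s x)) => [x|].
  by rewrite /ev big_cons.
rewrite /coef big_cons; have -> : (if t.2 == 0 then t.1 + \sum_(j <- s | j.2 == 0) j.1 else
   \sum_(j <- s | j.2 == 0) j.1) = t.1 * (if t.2 == 0 then 1 else 0) + coef s 0.
  by rewrite /coef; case: ifP; rewrite ?mulr1 ?mulr0 ?add0r.
apply: has_meanD => //; first exact/ccontinuousZ/AP_continuous/AP_e.
  exact: ev_continuous.
exact: has_meanZ (AP_continuous (AP_e _)) (has_mean_e _).
Qed.

Lemma real_cauchy (u : nat -> R) :
  (forall e, 0 < e -> exists N, forall n m, (N <= n)%N -> (N <= m)%N -> `|u n - u m| <= e) ->
  exists l, forall e, 0 < e -> exists N, forall n, (N <= n)%N -> `|u n - l| <= e.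
Proof.
move=> H; have : cauchy (u @ \oo).
  apply: cauchy_exP => e e0; have e2 : 0 < e / 2 by lra.
  have [N HN] := H _ e2; exists (u N); exists N => // n /= Nn.
  by rewrite -ball_normE /=; apply: le_lt_trans (HN _ _ _ Nn) _ => //; lra.
move=> /cauchy_cvg/cvg_ex[l /cvgrPdist_le Hl]; exists l => e e0.
by have [N _ HN] := Hl e e0; exists N => n /HN; rewrite /= distrC.
Qed.

Lemma complex_cauchy (u : nat -> C) :
  (forall e, 0 < e -> exists N, forall n m, (N <= n)%N -> (N <= m)%N -> cabs (u n - u m) <= e) ->
  exists z : C, forall e, 0 < e -> exists N, forall n, (N <= n)%N -> cabs (u n - z) <= e.
Proof.
move=> H.
have [a Ha] : exists l, forall e, 0 < e -> exists N, forall n, (N <= n)%N ->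
    `|complex.Re (u n) - l| <= e.
  apply: real_cauchy => e /H[N HN]; exists N => n m hn hm.
  by apply: le_trans (HN _ _ hn hm); rewrite -cReN -cReD cabs_Re.
have [b Hb] : exists l, forall e, 0 < e -> exists N, forall n, (N <= n)%N ->
    `|complex.Im (u n) - l| <= e.
  apply: real_cauchy => e /H[N HN]; exists N => n m hn hm.
  by apply: le_trans (HN _ _ hn hm); rewrite -cImN -cImD cabs_Im.
exists (a +i* b) => e e0; have e2 : 0 < e / 2 by lra.
have [N1 H1] := Ha _ e2; have [N2 H2] := Hb _ e2; exists (maxn N1 N2) => n.
rewrite geq_max => /andP[/H1 h1 /H2 h2]; apply: le_trans (cabs_ReIm _) _.
by rewrite cReD cImD cReN cImN /=; lra.
Qed.

(** The means of uniform approximants form a Cauchy sequence, since a mean is bounded by the sup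
    norm. *)
Lemma AP_has_mean f : AP f -> exists m, has_mean f m.
Proof.
move=> Af; have cf := AP_continuous Af; move/APP: Af => Af.
have p0 (n : nat) : 0 < n.+1%:R^-1 :> R by rewrite invr_gt0.
have /choice[s Hs] (n : nat) := Af _ (p0 n).
have sm n m : (n <= m)%N -> m.+1%:R^-1 <= n.+1%:R^-1 :> R.
  by move=> nm; rewrite lef_pV2 ?posrE // ler_nat.
have [m Hm] : exists z : C, forall e, 0 < e -> exists N, forall n, (N <= n)%N ->
    cabs (coef (s n) 0 - z) <= e.
  apply: complex_cauchy => e e0; exists (Num.bound (2 / e)) => n m hn hm.
  set N := Num.bound _ in hn hm.
  have hN : N.+1%:R^-1 <= e / 2.
    rewrite -[e / 2]invrK lef_pV2 ?posrE ?invr_gt0 ?divr_gt0 //.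
    rewrite invf_div; apply: le_trans (ltW (archi_boundP _)) _; first by rewrite divr_ge0 // ltW.
    by rewrite ler_nat.
  apply: has_mean_dist (has_mean_ev _) (has_mean_ev _) _; try exact: ev_continuous.
  move=> x; rewrite (_ : _ - _ = (f x - ev (s m) x) - (f x - ev (s n) x)); last by ring.
  apply: le_trans (cabsB _ _) _.
  apply: le_trans (lerD (le_trans (Hs m x) (le_trans (sm _ _ hm) hN))
    (le_trans (Hs n x) (le_trans (sm _ _ hn) hN))) _; lra.
exists m => e e0; have e3 : 0 < e / 3 by lra.
have [N HN] := Hm _ e3.
pose n := maxn N (Num.bound (3 / e)).
have hn : n.+1%:R^-1 <= e / 3.
  rewrite -[e / 3]invrK lef_pV2 ?posrE ?invr_gt0 ?divr_gt0 //.
  rewrite invf_div; apply: le_trans (ltW (archi_boundP _)) _; first by rewrite divr_ge0 // ltW.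
  by rewrite ler_nat leqW // leq_maxr.
have [T0 HT] := has_mean_ev (s n) e3.
exists (Num.max T0 0) => T; rewrite gt_max => /andP[/HT h1 T1].
have h2 := HN n (leq_maxl _ _).
have cs := ev_continuous (s n).
have h3 : cabs (average f T - average (ev (s n)) T) <= e / 3.
  rewrite -[average (ev _) T]mul1r -mulNr -averageZ // -averageD //; last exact: ccontinuousZ.
  apply: average_bound => //; first exact: ccontinuousD (ccontinuousZ _ _).
  by move=> x; rewrite mulN1r; apply: le_trans (Hs _ _) hn.
rewrite (_ : _ - _ = (average f T - average (ev (s n)) T) + (average (ev (s n)) T - coef (s n) 0)
  + (coef (s n) 0 - m)); last by ring.
by apply: le_trans (cabsD _ _) _; apply: le_trans (lerD (cabsD _ _) (lexx _)) _; lra.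
Qed.

Lemma bohr_coef_mean f l : AP f -> has_mean (fun x => e_ (- l) x * f x) (bohr_coef f l).
Proof.
move=> Af; have [m Hm] := AP_has_mean (AP_M (AP_e (- l)) Af).
by rewrite /bohr_coef (has_mean_lim Hm).
Qed.

Lemma has_mean_uniq f m n : has_mean f m -> has_mean f n -> m = n.
Proof. by move=> /has_mean_lim <- /has_mean_lim <-. Qed.

Lemma bohr_coefD f g l : AP f -> AP g ->
  bohr_coef (fun x => f x + g x) l = bohr_coef f l + bohr_coef g l.
Proof.
move=> Af Ag; apply: has_mean_uniq (bohr_coef_mean l (AP_D Af Ag)) _.
have := has_meanD (AP_continuous (AP_M (AP_e (- l)) Af)) (AP_continuous (AP_M (AP_e (- l)) Ag))
  (bohr_coef_mean l Af) (bohr_coef_mean l Ag).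
by apply: eq_has_mean => x; rewrite mulrDr.
Qed.

Lemma bohr_coefZ c f l : AP f -> bohr_coef (fun x => c * f x) l = c * bohr_coef f l.
Proof.
move=> Af; apply: has_mean_uniq (bohr_coef_mean l (AP_Z c Af)) _.
have := has_meanZ c (AP_continuous (AP_M (AP_e (- l)) Af)) (bohr_coef_mean l Af).
by apply: eq_has_mean => x; rewrite mulrCA.
Qed.

Lemma bohr_coef_bound f l B : AP f -> (forall x, cabs (f x) <= B) -> cabs (bohr_coef f l) <= B.
Proof.
move=> Af fB; apply: has_mean_bound (bohr_coef_mean l Af) _.
  exact: AP_continuous (AP_M (AP_e _) Af).
by move=> x; rewrite cabsM cabs_e mul1r.
Qed.

Lemma bohr_coef_dist f g l e : AP f -> AP g -> (forall x, cabs (f x - g x) <= e) ->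
  cabs (bohr_coef f l - bohr_coef g l) <= e.
Proof.
move=> Af Ag fg; rewrite -[bohr_coef g l]mul1r -mulNr -bohr_coefZ // -bohr_coefD //; last exact: AP_Z.
by apply: bohr_coef_bound => [|x]; [apply: AP_D (AP_Z _ _)|rewrite mulN1r].
Qed.

Lemma coef_shift s l : coef (pmul [:: (1, - l)] s) 0 = coef s l.
Proof.
rewrite /coef /pmul /= cats0 big_map /=; apply: eq_big => [t|t _]; last by rewrite mul1r.
by rewrite addrC subr_eq0.
Qed.

Lemma bohr_coef_ev s l : bohr_coef (ev s) l = coef s l.
Proof.
apply: has_mean_uniq (bohr_coef_mean l (AP_ev s)) _.
have := has_mean_ev (pmul [:: (1, - l)] s).
rewrite coef_shift.
by apply: eq_has_mean => x; rewrite ev_mul ev_seq1 mul1r.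
Qed.

Lemma bohr_coef_e f l m : AP f -> bohr_coef (fun x => e_ m x * f x) l = bohr_coef f (l - m).
Proof.
move=> Af; apply: has_mean_uniq (bohr_coef_mean l (AP_M (AP_e m) Af)) _.
have := bohr_coef_mean (l - m) Af.
by apply: eq_has_mean => x; rewrite mulrA -e_D opprB addrC.
Qed.

(** Each coefficient is a mean, hence at most the sup norm; summing over distinct frequencies costs
    a factor [size L]. For powers of a polynomial this factor grows only polynomially. *)
Lemma pchar_bound (L : seq R) v s B : (forall t, t \in s -> t.2 \in L) ->
  (forall l, l \in L -> cabs (v l) <= 1) -> (forall x, cabs (ev s x) <= B) ->
  cabs (pchar v s) <= (size L)%:R * B.
Proof.
move=> sL vL sB; rewrite (pcharE v sL); apply: le_trans (cabs_sum _ _ _) _.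
have B0 : 0 <= B by apply: le_trans (sB 0); apply: cabs_ge0.
apply: (@le_trans _ _ (\sum_(l <- undup L) B)).
  rewrite big_seq [leRHS]big_seq; apply: ler_sum => l; rewrite mem_undup => /vL vl.
  rewrite cabsM -bohr_coef_ev.
  have := bohr_coef_bound l (AP_ev s) sB; have := cabs_ge0 (bohr_coef (ev s) l).
  by have := cabs_ge0 (v l); nra.
by rewrite big_const_seq count_predT iter_addr addr0 -[B *+ _]mulr_natl ler_wpM2r // ler_nat size_undup.
Qed.

Lemma has_mean_trig0 f s : AP f -> (forall l, bohr_coef f l = 0) ->
  has_mean (fun x => ev s x * f x) 0.
Proof.
move=> Af f0; elim: s => [|t s IH].
  have h := has_mean_ev [::]; rewrite /coef big_nil in h.
  by apply: eq_has_mean h => x; rewrite ev_nil mul0r.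
have h := bohr_coef_mean (- t.2) Af; rewrite opprK f0 in h.
have cf : ccontinuous (fun x => e_ t.2 x * f x) by apply: AP_continuous (AP_M (AP_e _) Af).
have := has_meanD (ccontinuousZ t.1 cf) (AP_continuous (AP_M (AP_ev s) Af))
  (has_meanZ t.1 cf h) IH.
rewrite mulr0 addr0; apply: eq_has_mean => x.
by rewrite /ev big_cons mulrDl mulrA.
Qed.

Lemma coef_cat s s' l : coef (s ++ s') l = coef s l + coef s' l.
Proof. by rewrite /coef big_cat. Qed.

Lemma coef_scale c s l : coef (pscale c s) l = c * coef s l.
Proof. by rewrite /coef big_map mulr_sumr. Qed.

Lemma coef_conj0 s : coef (pconj s) 0 = (coef s 0)^*.
Proof.
rewrite /coef big_map rmorph_sum; apply: eq_bigl => t /=.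
by rewrite oppr_eq0.
Qed.

Lemma mulr_conj z : z * z^* = (cabs z ^+ 2)%:C :> C.
Proof. by rewrite -sqr_normc cabs_norm -rmorphXn. Qed.

(** Bessel's inequality for one frequency: with c the coefficient, the mean of |s - c e_l|^2 is the
    mean of |s|^2 minus |c|^2. *)
Lemma coef_sqr_le s l : cabs (coef s l) ^+ 2 <= complex.Re (coef (pmul s (pconj s)) 0).
Proof.
set c := coef s l; pose A := pmul [:: (1, - l)] s.
pose T := (pmul s (pconj s) ++ pscale (- c^*) A) ++ (pscale (- c) (pconj A) ++ [:: (c * c^*, 0)]).
have TE x : ev T x = (ev s x - c * e_ l x) * (ev s x - c * e_ l x)^*.
  rewrite [X in _ * X](_ : _ = (ev s x)^* - c^* * e_ (- l) x); last first.
    by rewrite rmorphB rmorphM; congr (_ - _ * _); exact: e_conj.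
  have cA : (e_ (- l) x * ev s x)^* = e_ l x * (ev s x)^*.
    by rewrite rmorphM; congr (_ * _); rewrite [LHS]e_conj opprK.
  rewrite !ev_cat !ev_scale ev_mul !ev_conj /A ev_mul !ev_seq1 e_0 mul1r cA.
  have := e_KN l x; set E := e_ l x; set E' := e_ (- l) x; pose Q := (ev s x)^*; pose d := c^*.
  change (E * E' = 1 -> ev s x * Q + - d * (E' * ev s x) + (- c * (E * Q) + c * d * 1) =
    (ev s x - c * E) * (Q - d * E')).
  by move=> h; ring: h.
have h0 : 0 <= complex.Re (coef T 0).
  apply: has_mean_ge0 (has_mean_ev T) _ => x; rewrite TE mulr_conj /=.
  by rewrite sqr_ge0.
move: h0; rewrite /T !coef_cat !coef_scale coef_conj0 coef_shift -/c.
rewrite /coef big_cons big_nil eqxx addr0 -/(coef _ _) !mulNr [_^* * c]mulrC mulr_conj.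
rewrite !cReD !cReN /=; lra.
Qed.

Lemma cabs_sq z : cabs z ^+ 2 = complex.Re z ^+ 2 + complex.Im z ^+ 2 :> R.
Proof. by rewrite cabsE sqr_sqrtr // addr_ge0 ?sqr_ge0. Qed.

Lemma parallelogram z w : cabs (z + w) ^+ 2 + cabs (z - w) ^+ 2 = 2 * (cabs z ^+ 2 + cabs w ^+ 2) :> R.
Proof. by rewrite !cabs_sq !(cReD, cImD, cReN, cImN); ring. Qed.

(* The product over the frequencies l of the (1 + conj(u l) e_l) / 2: it is small
   at x unless all the e_l(x) are close to u l. *)
Lemma peak_poly (S : set R) (u : R -> C) (L : seq R) : S 0 ->
  (forall l m, S l -> S m -> S (l + m)) -> u 0 = 1 ->
  (forall l m, S l -> S m -> u (l + m) = u l * u m) ->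
  (forall l, l \in L -> S l /\ cabs (u l) = 1) ->
  exists P : seq (C * R), [/\ forall t, t \in P -> S t.2, pchar u P = 1,
    forall x, cabs (ev P x) <= 1 &
    forall x l, l \in L -> cabs (ev P x) <= cabs ((1 + (u l)^* * e_ l x) / 2)].
Proof.
move=> S0 SD u0 uM; elim: L => [_|l L IH HL].
  exists [:: (1, 0)]; split=> [t|||x l]; rewrite ?in_nil // ?inE.
  - by move=> /eqP ->.
  - by rewrite /pchar big_seq1 u0 mulr1.
  - by move=> x; rewrite ev_seq1 e_0 mulr1 cabs1.
have [|P [PS P1 PB PL]] := IH; first by move=> m mL; apply: HL; rewrite inE mL orbT.
have [Sl ul] := HL l (mem_head _ _).
have g1 x : cabs ((1 + (u l)^* * e_ l x) / 2) <= 1.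
  rewrite cabsM cabsV cabs_nat ler_pdivrMr // mul1r.
  by apply: le_trans (cabsD _ _) _; rewrite cabs1 cabsM cabs_conj ul cabs_e mul1r.
pose f := [:: (2^-1, 0); (2^-1 * (u l)^*, l)] : seq (C * R).
have fS t : t \in f -> S t.2 by rewrite !inE => /orP[/eqP ->|/eqP ->].
have fE x : ev f x = (1 + (u l)^* * e_ l x) / 2.
  by rewrite /ev big_cons big_seq1 /= e_0; ring.
exists (pmul f P); split=> [||x|x m].
- exact: mem_pmul.
- rewrite (pchar_mul uM) // P1 mulr1 /pchar big_cons big_seq1 /= u0 mulr1 -mulrA [_^* * _]mulrC.
  by rewrite mulr_conj ul expr1n rmorph1; field.
- by rewrite ev_mul fE cabsM mulr_ile1 ?cabs_ge0.
- rewrite inE ev_mul fE cabsM => /orP[/eqP ->|/(PL x)]; first by rewrite ler_piMr ?cabs_ge0.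
  by apply: le_trans; rewrite ler_piMl ?cabs_ge0.
Qed.

(** Suppose |f(x0)| > 4 e. Take the peak polynomial P at x0 for the frequencies of an approximant of
    f, and K = |P^m|^2. The coefficients of f being 0, the mean of K f is 0. Yet f is close to f(x0)
    wherever |P|^2 > q, elsewhere K is at most q^m, and the mean of K decays at most polynomially in
    m. *)
Theorem bohr_uniqueness f : AP f -> (forall l, bohr_coef f l = 0) -> forall x, f x = 0.
Proof.
move=> Af f0 x0; apply/eqP; rewrite -cabs_eq0 eq_le cabs_ge0 andbT.
apply/ler_addgt0Pr => e4 e40; rewrite add0r.
pose e := e4 / 4; have e0 : 0 < e by rewrite /e; lra.
rewrite (_ : e4 = 4 * e); last by rewrite /e; field.
set a := f x0; have [F F0 FB] := AP_bounded Af.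
have [//|ha] := leP (cabs a) (4 * e).
have [s hs] := (APP f).1 Af e e0.
have n0 := nrm_ge0 s.
pose eta := Num.min 1 (e / (1 + nrm s)).
have eta0 : 0 < eta by rewrite lt_min ltr01 divr_gt0 //; lra.
have eta1 : eta <= 1 by rewrite ge_min lexx.
have [|P [_ P1 PB PL]] := @peak_poly setT (fun l => e_ l x0) [seq t.2 | t <- s]
  I (fun _ _ _ _ => I) (e_0 _) (fun l m _ _ => e_D l m x0).
  by move=> l _; split; last exact: cabs_e.
have Ps x t : t \in s -> cabs (ev P x) <= cabs ((1 + e_ t.2 (x - x0)) / 2).
  move=> ts; have := PL x t.2 (map_f _ ts).
  by rewrite [_ * e_ t.2 x](_ : _ = e_ t.2 (x - x0)) // e_Dx e_Nx mulrC; congr (_ * _); exact: e_conj.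
(* By the parallelogram law |(1 + z)/2|^2 = 1 - |1 - z|^2/4 for unimodular z. *)
pose q := 1 - eta ^+ 2 / 4.
have q01 : 0 <= q < 1 by rewrite /q; apply/andP; split; nra.
have Pdich x : cabs (f x - a) <= 3 * e \/ cabs (ev P x) ^+ 2 <= q.
  have [h|/existsNP[t /not_implyP[ts ht]]] :=
      pselect (forall t, t \in s -> cabs (e_ t.2 (x - x0) - 1 : C) <= eta); [left|right].
    have d : cabs (ev s x - ev s x0) <= e.
      rewrite /ev -sumrB; apply: le_trans (cabs_sum _ _ _) _.
      apply: (@le_trans _ _ (\sum_(t <- s) cabs t.1 * eta)).
        rewrite big_seq [leRHS]big_seq; apply: ler_sum => t ts.
        by rewrite -mulrBr cabsM e_sub ler_wpM2l ?cabs_ge0 ?h.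
      rewrite -mulr_suml -/(nrm s).
      apply: (@le_trans _ _ (nrm s * (e / (1 + nrm s)))).
        by rewrite ler_wpM2l // ge_min lexx orbT.
      rewrite mulrCA ler_piMr ?(ltW e0) // ler_pdivrMr; lra.
    have -> : f x - a = (f x - ev s x) + (ev s x - ev s x0) - (f x0 - ev s x0) by rewrite /a; ring.
    apply: le_trans (cabsB _ _) _; apply: le_trans (lerD (cabsD _ _) (lexx _)) _.
    by have := hs x; have := hs x0; lra.
  have := Ps x t ts; move/negP: ht; rewrite -ltNge => ht.
  have := parallelogram (e_ t.2 (x - x0)) 1; rewrite cabs_e cabs1 addrC [e_ _ _ + 1]addrC => hp.
  rewrite cabsM cabsV cabs_nat => hP; rewrite /q.
  have p0 := cabs_ge0 (ev P x).
  have := cabs_ge0 (1 + e_ t.2 (x - x0) : C).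
  move: (cabs (1 + _)) (cabs (_ - 1)) (cabs (ev P x)) hp hP ht p0 => A B Z hp hP ht p0 A0.
  have : Z ^+ 2 <= A ^+ 2 / 4 by nra.
  have : eta ^+ 2 <= B ^+ 2 by nra.
  lra.
pose D := size P.
have eF : 0 < e / (1 + 2 * F) by rewrite divr_gt0 //; lra.
have [m Hm] := poly_exp_small (D + D) q01 eF.
pose Q := pexp P m; pose K := pmul Q (pconj Q); set M := complex.Re (coef K 0).
have KE x : ev K x = (cabs (ev P x) ^+ 2 ^+ m)%:C.
  by rewrite ev_mul ev_conj ev_exp mulr_conj cabsX exprAC.
(* P^m takes the value 1 at x0 and has at most (m + 1)^D frequencies, each with a coefficient of
   modulus at most sqrt(M) by Bessel's inequality. *)
have M1 : 1 <= (m.+1%:R ^+ (D + D)) * M.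
  pose L := combos m [seq u.2 | u <- P].
  have QL t : t \in Q -> t.2 \in L by apply: pexp_combos.
  have M0 : 0 <= M by apply: le_trans (coef_sqr_le Q 0); apply: sqr_ge0.
  have cM l : cabs (coef Q l) <= Num.sqrt M.
    by rewrite -[leLHS]ger0_norm ?cabs_ge0 // -sqrtr_sqr ler_sqrt // coef_sqr_le.
  have : 1 <= m.+1%:R ^+ D * Num.sqrt M.
    rewrite -[leLHS](cabs1 R) -(expr1n _ m) -P1 -ev_exp evE (pcharE _ QL).
    apply: le_trans (cabs_sum _ _ _) _.
    apply: (@le_trans _ _ (\sum_(l <- undup L) Num.sqrt M)).
      by apply: ler_sum => l _; rewrite cabsM cabs_e mulr1.
    rewrite big_const_seq count_predT iter_addr addr0 -[Num.sqrt M *+ _]mulr_natl.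
    rewrite ler_wpM2r ?sqrtr_ge0 // -natrX ler_nat; apply: leq_trans (size_undup _) _.
    by rewrite size_combos size_map.
  move=> h; rewrite exprD -[M](sqr_sqrtr M0) expr2 mulrACA.
  by have := ler_pM ler01 ler01 h h; rewrite mulr1.
have [u u1 ua] := cabs_rot a.
pose r := q ^+ m.
have r0 : 0 <= r by rewrite exprn_ge0 //; case/andP: q01.
have AK := AP_ev K.
(* This is the mean of K (3 e - |a|) + 2 F r + Re(u K f), nonnegative at each point: either f is
   within 3 e of a, or K <= r and |f - a| <= 2 F. The term [u * 0] is the vanishing mean of u K
   f. *)
have : 0 <= complex.Re ((3 * e)%:C * coef K 0 + (2 * F * r)%:C + u * 0 + (- cabs a)%:C * coef K 0).
  pose W x := (3 * e)%:C * ev K x + (2 * F * r)%:C + u * (ev K x * f x) + (- cabs a)%:C * ev K x.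
  have cK := ev_continuous K.
  have cc : ccontinuous (fun _ : R => (2 * F * r)%:C).
    by move=> x k k0; exists 1 => // y _; rewrite subrr cabs0 ltW.
  have cKf : ccontinuous (fun x => ev K x * f x) by apply: AP_continuous (AP_M _ Af).
  have mc : has_mean (fun _ : R => (2 * F * r)%:C) (2 * F * r)%:C.
    have := has_meanZ (2 * F * r)%:C (AP_continuous (AP_e 0)) (@has_mean_e R 0).
    by rewrite eqxx mulr1; apply: eq_has_mean => x; rewrite e_0 mulr1.
  have mW := has_meanD (ccontinuousD (ccontinuousD (ccontinuousZ (3 * e)%:C cK) cc) (ccontinuousZ u cKf))
    (ccontinuousZ (- cabs a)%:C cK)
    (has_meanD (ccontinuousD (ccontinuousZ (3 * e)%:C cK) cc) (ccontinuousZ u cKf)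
      (has_meanD (ccontinuousZ (3 * e)%:C cK) cc (has_meanZ (3 * e)%:C cK (has_mean_ev K)) mc)
      (has_meanZ u cKf (has_mean_trig0 K Af f0)))
    (has_meanZ (- cabs a)%:C cK (has_mean_ev K)).
  apply: has_mean_ge0 mW _ => x; rewrite KE.
  set k := cabs (ev P x) ^+ 2 ^+ m.
  have k0 : 0 <= k by rewrite !exprn_ge0 ?cabs_ge0.
  have ru : `|complex.Re (u * (f x - a))| <= cabs (f x - a).
    by apply: le_trans (cabs_Re _) _; rewrite cabsM ler_piMl ?cabs_ge0.
  have -> : (3 * e)%:C * k%:C + (2 * F * r)%:C + u * (k%:C * f x) + (- cabs a)%:C * k%:C =
      (3 * e * k + 2 * F * r - cabs a * k)%:C + k%:C * (u * (f x - a)) + k%:C * (u * a).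
    by rewrite !(rmorphD, rmorphM, rmorphN) /=; ring.
  have ReZ (c : R) z : complex.Re (c%:C * z) = c * complex.Re z.
    by rewrite cReM /= mul0r subr0.
  rewrite !cReD !ReZ -ua /=.
  move: ru; rewrite ler_norml => /andP[+ _]; set v := complex.Re _ => hv.
  have fa2 : cabs (f x - a) <= 2 * F.
    by apply: le_trans (cabsB _ _) _; have := FB x; have := FB x0; rewrite -/a; lra.
  have [h|h] := Pdich x.
    have : 0 <= k * (3 * e + v) by apply: mulr_ge0 => //; lra.
    have : 0 <= 2 * F * r by rewrite !mulr_ge0.
    lra.
  have kr : k <= r by apply: lerXn2r; rewrite ?nnegrE ?sqr_ge0 //; case/andP: q01.
  have : 0 <= k * (v + 2 * F) by apply: mulr_ge0 => //; lra.
  have : 0 <= F * (r - k) by apply: mulr_ge0 => //; lra.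
  have : 0 <= k * e by apply: mulr_ge0 => //; lra.
  lra.
have ReZ (c : R) z : complex.Re (c%:C * z) = c * complex.Re z.
  by rewrite cReM /= mul0r subr0.
rewrite !cReD !ReZ mulr0 /= -/M => hM.
set N := m.+1%:R ^+ (D + D) in M1 Hm; rewrite -/r in Hm.
have N0 : 0 <= N by rewrite exprn_ge0.
have hN : N * (2 * F * r) <= e.
  apply: (@le_trans _ _ (N * r * (1 + 2 * F))).
    by have : 0 <= N * r; [rewrite mulr_ge0|lra].
  by move: Hm; rewrite ler_pdivlMr //; lra.
have : (cabs a - 3 * e) * (N * M) <= e.
  apply: le_trans hN; rewrite mulrCA ler_wpM2l //; lra.
have : (cabs a - 3 * e) * 1 <= (cabs a - 3 * e) * (N * M).
  by rewrite ler_wpM2l //; lra.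
lra.
Qed.

End BohrCoef.

(** * The Wiener algebra *)

Section Series.
Variable R : realType.
Local Notation C := R[i].
Implicit Types (s : seq (C * R)) (l x y a b T : R) (f g : R -> C)
  (S : set R) (w : nat -> seq (C * R)) (v : R -> C).

Definition freq_in S s : Prop := forall t, t \in s -> S t.2.

Lemma freq_in_cat S s s' : freq_in S s -> freq_in S s' -> freq_in S (s ++ s').
Proof. by move=> h h' t; rewrite mem_cat => /orP[/h|/h']. Qed.

Lemma freq_in_scale S c s : freq_in S s -> freq_in S (pscale c s).
Proof. by move=> h t /mapP[u us ->]; apply: h us. Qed.

Lemma pchar_nrm S v s : freq_in S s -> (forall l, S l -> cabs (v l) <= 1) ->
  cabs (pchar v s) <= nrm s.
Proof.
move=> hs hv; apply: le_trans (cabs_sum _ _ _) _; rewrite /nrm.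
rewrite big_seq [leRHS]big_seq; apply: ler_sum => t /hs/hv h.
by rewrite cabsM ler_piMr // cabs_ge0.
Qed.

Fixpoint psum w n := if n is n'.+1 then psum w n' ++ w n' else [::].
Definition pshift w N : nat -> seq (C * R) := fun k => w (N + k)%N.
Definition pbounded w B := forall n, nrm (psum w n) <= B.

Lemma psum_add w n m : psum w (n + m) = psum w n ++ psum (pshift w n) m.
Proof.
elim: m => [|m IH]; first by rewrite addn0 cats0.
by rewrite addnS /= IH catA.
Qed.

Lemma freq_in_psum S w n : (forall k, freq_in S (w k)) -> freq_in S (psum w n).
Proof. by move=> h; elim: n => // n IH; apply: freq_in_cat. Qed.

Lemma pbounded_tail w B e : pbounded w B -> 0 < e ->
  exists N, forall n, (N <= n)%N -> pbounded (pshift w n) e.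
Proof.
move=> wB e0; pose A := range (fun n => nrm (psum w n)).
have hA : has_sup A by split; [exists (nrm (psum w 0)); exists 0%N|exists B => _ [n _ <-]].
have [_ [N _ <-] hN] := sup_adherent e0 hA.
exists N => n Nn m; rewrite -(subnKC Nn).
have : nrm (psum w (n + m)) <= sup A by apply: sup_upper_bound => //; exists (n + m)%N.
rewrite psum_add nrm_cat -{1}(subnKC Nn) psum_add nrm_cat subnKC //.
by have := nrm_ge0 (psum (pshift w N) (n - N)); lra.
Qed.

(** The value is 0 when there is no limit; [plimP] gives convergence for bounded series. The
    argument v is left free so that one series yields both the function, with v l = e_l(x), and its
    analytic extension, with v l = exp(i l z). *)
Definition plim w v : C :=
  xget 0 [set z | forall e, 0 < e -> exists N, forall n, (N <= n)%N ->
    cabs (pchar v (psum w n) - z) <= e].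

Lemma plimP S w B v : (forall k, freq_in S (w k)) -> pbounded w B ->
  (forall l, S l -> cabs (v l) <= 1) ->
  forall e, 0 < e -> exists N, forall n, (N <= n)%N -> cabs (pchar v (psum w n) - plim w v) <= e.
Proof.
move=> hw wB hv; rewrite /plim; case: xgetP => [z _ //|nz].
have [z Hz] : exists z : C, forall e, 0 < e -> exists N, forall n, (N <= n)%N ->
    cabs (pchar v (psum w n) - z) <= e.
  apply: complex_cauchy => e e0; have e2 : 0 < e / 2 by lra.
  have [N HN] := pbounded_tail wB e2; exists N => n m hn hm.
  have tailb k : (N <= k)%N -> cabs (pchar v (psum w k) - pchar v (psum w N)) <= e / 2.
    move=> Nk; rewrite -(subnKC Nk) psum_add pchar_cat addrAC subrr add0r.
    apply: le_trans (HN N (leqnn _) (k - N)%N).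
    by apply: pchar_nrm hv; apply: freq_in_psum => j; apply: hw.
  rewrite (_ : _ - _ = (pchar v (psum w n) - pchar v (psum w N)) -
    (pchar v (psum w m) - pchar v (psum w N))); last by ring.
  by apply: le_trans (cabsB _ _) _; have := tailb n hn; have := tailb m hm; lra.
by case: (nz z).
Qed.

Lemma plim_tail S w B v n e : (forall k, freq_in S (w k)) -> pbounded w B ->
  (forall l, S l -> cabs (v l) <= 1) -> pbounded (pshift w n) e ->
  cabs (plim w v - pchar v (psum w n)) <= e.
Proof.
move=> hw wB hv wn; apply/ler_addgt0Pr => d d0.
have [N HN] := plimP hw wB hv d0.
have h1 := HN _ (leq_addl n N); rewrite psum_add pchar_cat in h1.
set p := pchar v (psum (pshift w n) N) in h1.
have h2 : cabs p <= e.
  apply: le_trans (wn N); apply: pchar_nrm hv.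
  by apply: freq_in_psum => j; apply: hw.
have -> : plim w v - pchar v (psum w n) = p - (pchar v (psum w n) + p - plim w v) by ring.
by apply: le_trans (cabsB _ _) _; lra.
Qed.

Lemma plim_eq S w B v z : (forall k, freq_in S (w k)) -> pbounded w B ->
  (forall l, S l -> cabs (v l) <= 1) ->
  (forall e, 0 < e -> exists N, forall n, (N <= n)%N -> cabs (pchar v (psum w n) - z) <= e) ->
  plim w v = z.
Proof.
move=> hw wB hv Hz; apply/eqP; rewrite -subr_eq0 -cabs_eq0 eq_le cabs_ge0 andbT.
apply/ler_addgt0Pr => e e0; have e2 : 0 < e / 2 by lra.
have [N HN] := plimP hw wB hv e2; have [N' HN'] := Hz _ e2.
have h1 := HN _ (leq_maxl N N'); have h2 := HN' _ (leq_maxr N N').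
set p := pchar _ _ in h1 h2.
have -> : plim w v - z = (p - z) - (p - plim w v) by ring.
by apply: le_trans (cabsB _ _) _; lra.
Qed.

Lemma plim_bound S w B v : (forall k, freq_in S (w k)) -> pbounded w B ->
  (forall l, S l -> cabs (v l) <= 1) -> cabs (plim w v) <= B.
Proof.
move=> hw wB hv; have := @plim_tail S w B v 0%N B hw wB hv.
by rewrite /pchar big_nil subr0; apply.
Qed.

(* The ball of radius r of the Wiener norm with spectrum in S, without coefficients:
   l^1-balls are closed under uniform limits. *)
Definition Wn S f (r : R) : Prop := forall e, 0 < e ->
  exists s, [/\ freq_in S s, nrm s <= r & forall x, cabs (f x - ev s x) <= e].

Lemma Wn_AP S f r : Wn S f r -> AP f.
Proof. by move=> H; apply/APP => e /H[s [_ _ h]]; exists s. Qed.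

Lemma Wn_bound S f r x : Wn S f r -> cabs (f x) <= r.
Proof.
move=> H; apply/ler_addgt0Pr => e /H[s [_ hs h]].
rewrite -[f x](subrK (ev s x)); apply: le_trans (cabsD _ _) _.
by rewrite addrC lerD // (le_trans (ev_bound _ _)).
Qed.

Lemma Wn_ge0 S f r : Wn S f r -> 0 <= r.
Proof. by move=> /(Wn_bound 0); apply: le_trans; apply: cabs_ge0. Qed.

Lemma Wn_weaken S S' f r r' : S `<=` S' -> r <= r' -> Wn S f r -> Wn S' f r'.
Proof.
move=> SS rr H e /H[s [h1 h2 h3]]; exists s; split=> //; last exact: le_trans rr.
by move=> t /h1/SS.
Qed.

Lemma Wn_ext S f g r : (forall x, f x = g x) -> Wn S f r -> Wn S g r.
Proof. by move=> /funext ->. Qed.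

Lemma Wn_ev S s : freq_in S s -> Wn S (ev s) (nrm s).
Proof. by move=> h e e0; exists s; split=> // x; rewrite subrr cabs0 ltW. Qed.

Lemma Wn_e S l : S l -> Wn S (fun x => e_ l x) 1.
Proof.
move=> Sl; apply: (@Wn_ext _ (ev [:: (1, l)])) => [x|]; first by rewrite ev_seq1 mul1r.
have -> : 1 = nrm [:: ((1 : C), l)] by rewrite /nrm big_seq1 cabs1.
by apply: Wn_ev => t; rewrite inE => /eqP ->.
Qed.

Lemma WnD S f g r r' : Wn S f r -> Wn S g r' -> Wn S (fun x => f x + g x) (r + r').
Proof.
move=> Hf Hg e e0; have e2 : 0 < e / 2 by lra.
have [s [s1 s2 s3]] := Hf _ e2; have [t [t1 t2 t3]] := Hg _ e2.
exists (s ++ t); split; first exact: freq_in_cat.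
  by rewrite nrm_cat lerD.
move=> x; rewrite ev_cat (_ : _ - _ = (f x - ev s x) + (g x - ev t x)); last by ring.
by apply: le_trans (cabsD _ _) _; have := s3 x; have := t3 x; lra.
Qed.

Lemma WnZ S c f r : Wn S f r -> Wn S (fun x => c * f x) (cabs c * r).
Proof.
move=> Hf e e0; have c0 : 0 < 1 + cabs c by rewrite ltr_wpDr // cabs_ge0.
have [s [s1 s2 s3]] := Hf _ (divr_gt0 e0 c0); exists (pscale c s); split.
- exact: freq_in_scale.
- by rewrite nrm_scale ler_wpM2l // cabs_ge0.
move=> x; rewrite ev_scale -mulrBr cabsM; have := s3 x; rewrite ler_pdivlMr //.
by have := cabs_ge0 (f x - ev s x); have := cabs_ge0 c; nra.
Qed.

Lemma Wn_0 S : Wn S (fun=> 0) 0.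
Proof.
move=> e e0; exists [::]; split=> //; first by rewrite /nrm big_nil.
by move=> x; rewrite ev_nil subrr cabs0 ltW.
Qed.

Lemma Wn_cst S c : S 0 -> Wn S (fun=> c) (cabs c).
Proof.
move=> S0; have := WnZ c (Wn_e S0); rewrite mulr1.
by apply: Wn_ext => x; rewrite e_0 mulr1.
Qed.

Lemma WnM S f g r r' : (forall l m, S l -> S m -> S (l + m)) ->
  Wn S f r -> Wn S g r' -> Wn S (fun x => f x * g x) (r * r').
Proof.
move=> SD Hf Hg e e0; have r0 := Wn_ge0 Hf; have r'0 := Wn_ge0 Hg.
have d0 : 0 < 2 * (1 + r) by lra.
have d'0 : 0 < 2 * (1 + r') by lra.
have [s [s1 s2 s3]] := Hf _ (divr_gt0 e0 d'0).
have [t [t1 t2 t3]] := Hg _ (divr_gt0 e0 d0).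
exists (pmul s t); split; first exact: mem_pmul.
  by rewrite nrm_mul ler_pM // nrm_ge0.
move=> x; rewrite ev_mul.
have -> : f x * g x - ev s x * ev t x = f x * (g x - ev t x) + (f x - ev s x) * ev t x by ring.
apply: le_trans (cabsD _ _) _; rewrite !cabsM.
have := s3 x; have := t3 x; have := Wn_bound x Hf; have := le_trans (ev_bound t x) t2.
rewrite !ler_pdivlMr //.
have := cabs_ge0 (f x); have := cabs_ge0 (g x - ev t x); have := cabs_ge0 (f x - ev s x).
have := cabs_ge0 (ev t x).
move: (cabs (f x)) (cabs (g x - _)) (cabs (f x - _)) (cabs (ev t x)) => F D1 D2 E.
move=> E0 D20 D10 F0 EN FB h1 h2.
have : F * D1 <= r * D1 by rewrite ler_wpM2r.
have : D2 * E <= D2 * r' by rewrite ler_wpM2l.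
lra.
Qed.

Lemma WnX S f r n : S 0 -> (forall l m, S l -> S m -> S (l + m)) ->
  Wn S f r -> Wn S (fun x => f x ^+ n) (r ^+ n).
Proof.
move=> S0 SD Hf; elim: n => [|n IH].
  by rewrite expr0 -(cabs1 R); apply: Wn_cst.
rewrite exprS; apply: Wn_ext (WnM SD Hf IH) => x; by rewrite exprS.
Qed.

Lemma Wn_lim S f r : (forall e, 0 < e -> exists2 g, Wn S g r & forall x, cabs (f x - g x) <= e) ->
  Wn S f r.
Proof.
move=> H e e0; have e2 : 0 < e / 2 by lra.
have [g Hg fg] := H _ e2; have [s [s1 s2 s3]] := Hg _ e2; exists s; split=> // x.
rewrite (_ : _ - _ = (f x - g x) + (g x - ev s x)); last by ring.
by apply: le_trans (cabsD _ _) _; have := s3 x; have := fg x; lra.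
Qed.

Lemma Wn_sum S (f : nat -> R -> C) (r : nat -> R) n : (forall k, Wn S (f k) (r k)) ->
  Wn S (fun x => \sum_(k < n) f k x) (\sum_(k < n) r k).
Proof.
move=> H; elim: n => [|n IH].
  by rewrite big_ord0; apply: Wn_ext (Wn_0 S) => x; rewrite big_ord0.
by rewrite big_ord_recr /=; apply: Wn_ext (WnD IH (H n)) => x; rewrite big_ord_recr.
Qed.

(** Convergence is assumed pointwise only; the bounded sums of radii make it uniform, and the balls
    are closed under uniform limits. *)
Lemma Wn_series S (f : nat -> R -> C) (r : nat -> R) B F : (forall k, Wn S (f k) (r k)) ->
  (forall n, \sum_(k < n) r k <= B) ->
  (forall x e, 0 < e -> exists N, forall n, (N <= n)%N -> cabs (F x - \sum_(k < n) f k x) <= e) ->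
  Wn S F B.
Proof.
move=> H rB HF; apply: Wn_lim => e e0.
pose A := range (fun n => \sum_(k < n) r k).
have hA : has_sup A by split; [exists (\sum_(k < 0) r k); exists 0%N|exists B => _ [n _ <-]].
have [_ [N _ <-] hN] := sup_adherent e0 hA.
exists (fun x => \sum_(k < N) f k x).
  exact: Wn_weaken (rB N) (Wn_sum N H).
move=> x; apply/ler_addgt0Pr => d d0; have [M HM] := HF x d d0.
have h1 := HM _ (leq_addl N M).
have -> : F x - \sum_(k < N) f k x = (F x - \sum_(k < N + M) f k x) +
    \sum_(k < M) f (N + k)%N x by rewrite big_split_ord /=; ring.
apply: le_trans (cabsD _ _) _; rewrite addrC lerD //.
have h2 : \sum_(k < N + M) r k <= sup A by apply: sup_upper_bound => //; exists (N + M)%N.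
rewrite big_split_ord /= in h2.
apply: le_trans (cabs_sum _ _ _) _; apply: (@le_trans _ _ (\sum_(k < M) r (N + k)%N)); last by lra.
by apply: ler_sum => k _; apply: Wn_bound (H _).
Qed.

Lemma Wn_coef S f r l : Wn S f r -> ~ S l -> bohr_coef f l = 0.
Proof.
move=> H Sl; apply/eqP; rewrite -cabs_eq0 eq_le cabs_ge0 andbT.
apply/ler_addgt0Pr => e e0; rewrite add0r; have [s [s1 s2 s3]] := H _ e0.
have := bohr_coef_dist l (Wn_AP H) (AP_ev s) s3.
rewrite bohr_coef_ev coef_notin ?subr0 // => t /s1 St.
by apply/eqP => tl; rewrite tl in St.
Qed.

Lemma coef_nrm s (L : seq R) : uniq L -> \sum_(l <- L) cabs (coef s l) <= nrm s.
Proof.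
move=> uL; apply: (@le_trans _ _ (\sum_(l <- L) \sum_(t <- s | t.2 == l) cabs t.1)).
  by apply: ler_sum => l _; apply: cabs_sum.
under eq_bigr do rewrite big_mkcond; rewrite exchange_big /=; apply: ler_sum => t _.
have [tL|tL] := boolP (t.2 \in L).
  rewrite (bigD1_seq t.2) //= eqxx big1 ?addr0 // => l.
  by rewrite eq_sym => /negbTE ->.
rewrite big_seq big1 ?cabs_ge0 // => l lL; case: eqP => // tl.
by rewrite tl lL in tL.
Qed.

Lemma Wn_coef_sum S f r (L : seq R) : Wn S f r -> uniq L ->
  \sum_(l <- L) cabs (bohr_coef f l) <= r.
Proof.
move=> H uL; apply/ler_addgt0Pr => e e0.
have n0 : 0 < 1 + (size L)%:R :> R by rewrite ltr_wpDr.
have [s [s1 s2 s3]] := H _ (divr_gt0 e0 n0).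
set d := e / _ in s3.
apply: (@le_trans _ _ (\sum_(l <- L) (cabs (coef s l) + d))).
  apply: ler_sum => l _; have := bohr_coef_dist l (Wn_AP H) (AP_ev s) s3.
  rewrite bohr_coef_ev => h; rewrite -[bohr_coef f l](subrK (coef s l)).
  by apply: le_trans (cabsD _ _) _; rewrite addrC lerD2l.
rewrite big_split /= lerD //; first exact: le_trans (coef_nrm s uL) s2.
rewrite big_const_seq count_predT iter_addr addr0 -[d *+ _]mulr_natl /d.
rewrite mulrCA ler_piMr ?(ltW e0) // ler_pdivrMr //; lra.
Qed.

End Series.

(** * Absolutely convergent series and the class [APW] *)

Section Wiener.
Variable R : realType.
Local Notation C := R[i].
Implicit Types (s : seq (C * R)) (l x y a b T : R) (f g : R -> C)
  (S : set R) (w : nat -> seq (C * R)) (v : R -> C).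

(** [Wn] allows unrelated approximants for different precisions. Here one absolutely convergent
    series is fixed, in blocks, so that it can be truncated, split by frequency and extended to the
    half-plane. *)
Definition rep S f w (B : R) : Prop :=
  [/\ forall k, freq_in S (w k), pbounded w B & forall x, f x = plim w (fun l => e_ l x)].

Lemma cabs_e_le (S : set R) x l : S l -> cabs (e_ l x : C) <= 1.
Proof. by rewrite cabs_e. Qed.

Lemma rep_Wn S f w B : rep S f w B -> Wn S f B.
Proof.
move=> [hw wB fE]; apply: Wn_lim => e e0; have [N HN] := pbounded_tail wB e0.
exists (ev (psum w N)).
  by apply: (Wn_weaken (@subset_refl _ S) (wB N)); apply: Wn_ev; apply: freq_in_psum.
move=> x; rewrite fE; apply: plim_tail hw wB (cabs_e_le x (S := S)) _.
exact: HN.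
Qed.

Lemma rep_tail S f w B n e : rep S f w B -> pbounded (pshift w n) e ->
  Wn S (fun x => f x - ev (psum w n) x) e.
Proof.
move=> [hw wB fE] we; apply: (@rep_Wn _ _ (pshift w n)); split=> // [k|x]; first exact: hw.
apply/esym; apply: (@plim_eq _ S _ e) => // [k|l Sl|d d0]; first exact: hw.
  exact: cabs_e_le Sl.
have [N HN] := plimP hw wB (cabs_e_le x (S := S)) d0; exists N => m Nm.
have := HN (n + m)%N (leq_trans Nm (leq_addl _ _)).
rewrite psum_add pchar_cat fE -evE => h; apply: le_trans h.
by rewrite le_eqVlt; apply/orP; left; apply/eqP; congr cabs; rewrite evE; ring.
Qed.

Lemma Wn_APW S f r : Wn S f r -> APW f /\ bohr_spectrum f `<=` S.
Proof.
move=> H; split; last first.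
  by move=> l /eqP hl; apply: contrapT => /(Wn_coef H).
split; first exact: Wn_AP H.
apply: (@le_lt_trans _ _ r%:E); last by rewrite ltry.
apply: ub_ereal_sup => _ [A [fA _] <-]; rewrite fsbig_finite //=.
under eq_bigr do rewrite ger0_norm ?cabs_ge0 //.
rewrite sumEFin lee_fin; exact: Wn_coef_sum H (fset_uniq _).
Qed.

Lemma APW_coef_sum f : APW f -> exists B, forall L : seq R, uniq L ->
  \sum_(l <- L) cabs (bohr_coef f l) <= B.
Proof.
move=> [_ sf]; pose E := (\esum_(l in bohr_spectrum f) `|(cabs (bohr_coef f l))%:E|)%E.
have E0 : (0 <= E)%E by apply: esum_ge0.
have EF : E \is a fin_num by rewrite ge0_fin_numE.
exists (fine E) => L uL; rewrite -lee_fin fineK //.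
rewrite (bigID (fun l => bohr_coef f l == 0)) /= big1 ?add0r => [|l /eqP ->]; last by rewrite cabs0.
rewrite -big_filter; apply: esum_ge.
set M := [seq l <- L | _]; exists [set` M].
  by split; [exact: finite_seq|move=> l; rewrite /= mem_filter => /andP[]].
rewrite -fsbig_seq ?filter_uniq // -sumEFin le_eqVlt; apply/orP; left; apply/eqP.
by apply: eq_bigr => l _; rewrite gee0_abs // lee_fin cabs_ge0.
Qed.

(** Finite sets of frequencies that nearly exhaust the sum of the moduli of the coefficients are
    merged into one enumeration. The resulting series has the same Bohr coefficients as f, hence
    equals f by uniqueness. *)
Theorem APW_rep S f : APW f -> bohr_spectrum f `<=` S -> exists w B, rep S f w B.
Proof.
move=> Wf fS; have [B HB] := APW_coef_sum Wf; have [Af _] := Wf.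
pose sumL (L : seq R) := \sum_(l <- L) cabs (bohr_coef f l).
pose A := [set sumL L | L in [set L | uniq L]].
have hA : has_sup A by split; [exists (sumL [::]); exists [::]|exists B => _ [L uL <-]; apply: HB].
have p0 (n : nat) : 0 < n.+1%:R^-1 :> R by rewrite invr_gt0.
have /choice[L HL] (n : nat) : exists L, uniq L /\ sup A - n.+1%:R^-1 < sumL L.
  by have [_ [L uL <-] h] := sup_adherent (p0 n) hA; exists L.
(* [M] merges the lists [L n] without repetition; [new] also drops zero coefficients, so that only
   frequencies of the spectrum enter the series. *)
pose fix M n := if n is n'.+1 then M n' ++ [seq l <- L n' | l \notin M n'] else [::].
pose new n := [seq l <- L n | (l \notin M n) && (bohr_coef f l != 0)].
pose w n := [seq (bohr_coef f l, l) | l <- new n].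
have uM n : uniq (M n).
  elim: n => //= n IH; rewrite cat_uniq IH filter_uniq ?(HL n).1 // andbT.
  by apply/hasPn => l; rewrite mem_filter => /andP[].
have wM n : psum w n = [seq (bohr_coef f l, l) | l <- [seq l <- M n | bohr_coef f l != 0]].
  elim: n => //= n ->; rewrite filter_cat map_cat /w /new; congr (_ ++ map _ _).
  by rewrite -filter_predI; apply: eq_filter => l /=; rewrite andbC.
have sumM n : nrm (psum w n) = sumL (M n).
  rewrite wM /nrm big_map big_filter /sumL.
  rewrite [RHS](bigID (fun l => bohr_coef f l == 0)) /= [X in _ = X + _]big1 ?add0r // => l /eqP ->.
  by rewrite cabs0.
have subM n m : (n <= m)%N -> {subset M n <= M m}.
  elim: m => [|m IH]; first by rewrite leqn0 => /eqP ->.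
  rewrite leq_eqVlt => /orP[/eqP -> //|/IH h] l /h lM /=.
  by rewrite mem_cat lM.
have LM n : {subset L n <= M n.+1}.
  by move=> l lL /=; rewrite mem_cat mem_filter lL andbT; case: (l \in M n).
have wB : pbounded w B by move=> n; rewrite sumM; apply: HB.
have wS k : freq_in S (w k).
  by move=> t /mapP[l]; rewrite mem_filter => /andP[/andP[_ h] _] -> /=; apply: fS.
exists w, B; split=> // x0.
pose g x := plim w (fun l => e_ l x).
have Wg : Wn S g B by apply: (@rep_Wn _ _ w).
have Ag := Wn_AP Wg.
suff fg : forall l, bohr_coef (fun x => f x + (-1) * g x) l = 0.
  have := bohr_uniqueness (AP_D Af (AP_Z (-1) Ag)) fg x0.
  by move=> /eqP; rewrite mulN1r subr_eq0 => /eqP.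
move=> l; rewrite bohr_coefD ?bohr_coefZ //; last exact: AP_Z.
apply/eqP; rewrite mulN1r -cabs_eq0 eq_le cabs_ge0 andbT.
apply/ler_addgt0Pr => e e0; rewrite add0r; have e2 : 0 < e / 2 by lra.
have [N HN] := pbounded_tail wB e2.
have near n : (N <= n)%N -> cabs (bohr_coef f l - bohr_coef g l) <=
    cabs (bohr_coef f l - coef (psum w n) l) + e / 2.
  move=> Nn; rewrite -bohr_coef_ev.
  apply: le_trans (cabs_triangle (bohr_coef (ev (psum w n)) l) _ _) _; rewrite lerD2l.
  apply: bohr_coef_dist => // [|x]; first exact: AP_ev.
  by rewrite cabsBC; apply: plim_tail wS wB (cabs_e_le x (S := S)) _; apply: HN.
have coefM n : coef (psum w n) l = if l \in M n then bohr_coef f l else 0.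
  rewrite wM /coef big_map big_filter_cond /=; case: ifP => [lM|/negP lM].
    rewrite big_mkcondl -big_filter (filter_pred1_uniq (uM n) lM) big_seq1.
    by case: eqP => [->|].
  by rewrite big_seq_cond big1 // => m /andP[mM /andP[_ /eqP ml]]; rewrite ml in mM.
have [[n lM]|nM] := pselect (exists n, l \in M n).
  apply: le_trans (near (maxn n N) (leq_maxr _ _)) _.
  by rewrite coefM (subM _ _ (leq_maxl _ _) _ lM) subrr cabs0 add0r; lra.
(* A frequency l that is never collected can be added to [M n.+1] without exceeding the supremum, so
   its coefficient is at most 1/(n + 1). *)
pose n := maxn N (Num.bound (2 / e)).
apply: le_trans (near n (leq_maxl _ _)) _; rewrite coefM.
have lM k : l \notin M k by apply/negP => h; apply: nM; exists k.
rewrite (negbTE (lM n)) subr0.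
have h1 : sumL (l :: M n.+1) <= sup A.
  by apply: sup_upper_bound => //; exists (l :: M n.+1) => //; rewrite /mkset cons_uniq lM uM.
have h2 : sumL (L n) <= sumL (M n.+1).
  have h : perm_eq (M n.+1) ([seq k <- M n.+1 | k \in L n] ++ [seq k <- M n.+1 | k \notin L n]).
    by rewrite perm_sym; apply/permPl; exact: perm_filterC.
  rewrite {2}/sumL (perm_big _ h) big_cat /= {1}/sumL.
  rewrite (perm_big [seq k <- M n.+1 | k \in L n]).
    by rewrite lerDl; apply: sumr_ge0 => k _; apply: cabs_ge0.
  apply: uniq_perm; rewrite ?filter_uniq ?uM ?(HL n).1 // => k; rewrite mem_filter.
  by case: (boolP (k \in L n)) => //= /LM.
have [_ h3] := HL n.
have h4 : n.+1%:R^-1 <= e / 2.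
  rewrite -[e / 2]invrK lef_pV2 ?posrE ?invr_gt0 ?divr_gt0 //.
  rewrite invf_div; apply: le_trans (ltW (archi_boundP _)) _; first by rewrite divr_ge0 // ltW.
  by rewrite ler_nat leqW // leq_maxr.
move: h1; rewrite {1}/sumL big_cons -/(sumL _) => h1.
have : cabs (bohr_coef f l) <= n.+1%:R^-1 by move: h3 h2 h1; set q := n.+1%:R^-1; lra.
by move=> h; have := le_trans h h4; lra.
Qed.

Theorem APW_WnP S f : (APW f /\ bohr_spectrum f `<=` S) <-> exists r, Wn S f r.
Proof.
split=> [[Wf fS]|[r]]; last exact: Wn_APW.
by have [w [B /rep_Wn h]] := APW_rep Wf fS; exists B.
Qed.

Lemma APWP f : APW f <-> exists r, Wn setT f r.
Proof. by rewrite -APW_WnP; split=> [|[]//]. Qed.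

Lemma APWpP f : APWp f <-> exists r, Wn [set l | 0 <= l] f r.
Proof. exact: APW_WnP. Qed.

Lemma APWmP f : APWm f <-> exists r, Wn [set l | l <= 0] f r.
Proof. exact: APW_WnP. Qed.

End Wiener.

(** * Exponentials and logarithms *)

Section ExpLog.
Variable R : realType.
Local Notation C := R[i].
Implicit Types (s : seq (C * R)) (l x y a b T : R) (f g : R -> C)
  (S : set R) (z w : C).

Lemma cabs_subX (z w : C) (M : R) n : cabs z <= M -> cabs w <= M -> 1 <= M ->
  cabs (z ^+ n - w ^+ n) <= n%:R * cabs (z - w) * M ^+ n.
Proof.
move=> zM wM M1; have M0 : 0 <= M by lra.
elim: n => [|n IH]; first by rewrite !expr0 subrr cabs0 !mul0r.
have -> : z ^+ n.+1 - w ^+ n.+1 = z * (z ^+ n - w ^+ n) + (z - w) * w ^+ n.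
  by rewrite !exprS; ring.
apply: le_trans (cabsD _ _) _; rewrite !cabsM cabsX -natr1 !mulrDl mul1r exprS.
have Mn : 0 <= M ^+ n by rewrite exprn_ge0.
apply: lerD.
  have -> : n%:R * cabs (z - w) * (M * M ^+ n) = M * (n%:R * cabs (z - w) * M ^+ n) by ring.
  by apply: ler_pM; rewrite ?cabs_ge0.
rewrite ler_wpM2l ?cabs_ge0 //; apply: (@le_trans _ _ (M ^+ n)).
  by apply: lerXn2r; rewrite ?nnegrE ?cabs_ge0.
by rewrite ler_peMl.
Qed.

Lemma cexp_lim (r e : R) : 0 <= r -> 0 < e -> exists n : nat, forall w, cabs w <= r ->
  cabs (cexp w - (1 + n.+1%:R^-1 * w) ^+ n.+1) <= e.
Proof.
move=> r0 e0; pose n := maxn (Num.bound (2 * r)) (Num.bound (8 * r ^+ 2 * expR r / e)).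
exists n => w wr; set N : R := n.+1%:R.
have N0 : 0 < N by rewrite ltr0Sn.
have n1 : 2 * r <= N.
  apply: le_trans (ltW (archi_boundP _)) _; first by rewrite mulr_ge0.
  by rewrite /N ler_nat leqW // leq_maxl.
have n2 : 8 * r ^+ 2 * expR r <= e * N.
  rewrite [e * N]mulrC -ler_pdivrMr //; apply: le_trans (ltW (archi_boundP _)) _.
    by rewrite !divr_ge0 ?mulr_ge0 ?expR_ge0 ?sqr_ge0 // ltW.
  by rewrite /N ler_nat leqW // leq_maxr.
set z := n.+1%:R^-1 * w.
have zE : cabs z <= r / N.
  by rewrite /z cabsM cabsV cabs_nat mulrC ler_wpM2r // invr_ge0 ltW.
have z2 : cabs z <= 2^-1 by apply: le_trans zE _; rewrite ler_pdivrMr //; lra.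
have -> : cexp w = cexp z ^+ n.+1.
  by rewrite -cexpMn -mulr_natl /z mulrA divff ?mul1r // pnatr_eq0.
have M1 : 1 <= expR (r / N) by rewrite -expR0 ler_expR divr_ge0 // ltW.
have hb : cabs (1 + z) <= expR (r / N).
  apply: le_trans (cabsD _ _) _; rewrite cabs1; apply: le_trans (expR_ge1Dx _).
  by rewrite lerD2l.
have ha : cabs (cexp z) <= expR (r / N).
  by rewrite cabs_cexp ler_expR; apply: le_trans zE; apply: le_trans (cabs_Re z); apply: ler_norm.
apply: le_trans (cabs_subX _ ha hb M1) _.
rewrite -expRM_natl (_ : n.+1%:R * (r / N) = r); last by rewrite mulrCA divff ?mulr1 // gt_eqF.
have hd : cabs (cexp z - (1 + z)) <= 8 * (r / N) ^+ 2.
  rewrite opprD addrA; apply: le_trans (cexp_small z2) _.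
  rewrite ler_wpM2l //; apply: lerXn2r; rewrite ?nnegrE ?cabs_ge0 //.
  by rewrite divr_ge0 // ltW.
apply: (@le_trans _ _ (N * (8 * (r / N) ^+ 2) * expR r)).
  by rewrite ler_wpM2r ?expR_ge0 // ler_wpM2l // ltW.
rewrite -(ler_pM2r N0); apply: le_trans n2; rewrite le_eqVlt; apply/orP; left; apply/eqP.
by field; rewrite gt_eqF.
Qed.

(** Euler's limit (1 + f/n)^n replaces the exponential series: its radius (1 + r/n)^n is at most
    exp(r), and the convergence is uniform on the disc of radius r. *)
Lemma Wn_cexp S f r : S 0 -> (forall l m, S l -> S m -> S (l + m)) ->
  Wn S f r -> Wn S (fun x => cexp (f x)) (expR r).
Proof.
move=> S0 SD Hf; have r0 := Wn_ge0 Hf; apply: Wn_lim => e e0.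
have [n Hn] := cexp_lim r0 e0.
exists (fun x => (1 + n.+1%:R^-1 * f x) ^+ n.+1); last by move=> x; apply/Hn/(Wn_bound x Hf).
have := WnX n.+1 S0 SD (WnD (Wn_cst 1 S0) (WnZ (n.+1%:R^-1) Hf)).
apply: Wn_weaken => //; rewrite cabs1 cabsV cabs_nat.
apply: (@le_trans _ _ (expR (n.+1%:R^-1 * r) ^+ n.+1)).
  apply: lerXn2r; rewrite ?nnegrE ?expR_ge0 ?expR_ge1Dx //.
  by rewrite addr_ge0 // mulr_ge0 // invr_ge0.
by rewrite -expRM_natl mulrA divff ?mul1r // pnatr_eq0.
Qed.

Lemma geom_sum (q : R) n : 0 <= q < 1 -> \sum_(k < n) q ^+ k <= (1 - q)^-1.
Proof.
move=> /andP[q0 q1]; have d0 : 0 < 1 - q by lra.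
rewrite -[leRHS]div1r ler_pdivlMr // mulrC.
have -> : (1 - q) * \sum_(k < n) q ^+ k = 1 - q ^+ n.
  by rewrite -[in RHS](expr1n R n) subrXX; congr (_ * _); apply: eq_bigr => k _; rewrite expr1n mul1r.
by have := exprn_ge0 n q0; lra.
Qed.

Lemma expr_small (q e : R) : 0 <= q < 1 -> 0 < e -> exists N, forall n, (N <= n)%N -> q ^+ n <= e.
Proof.
move=> q01 e0; have [N HN] := poly_exp_small 0 q01 e0; exists N => n Nn.
case/andP: q01 => q0 q1; rewrite expr0 mul1r in HN; apply: le_trans HN.
by rewrite ler_wiXn2l // ltW.
Qed.

Lemma Wn_neumann S f r : S 0 -> (forall l m, S l -> S m -> S (l + m)) ->
  Wn S f r -> r < 1 -> (forall x, 1 - f x != 0) /\ Wn S (fun x => (1 - f x)^-1) (1 - r)^-1.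
Proof.
move=> S0 SD Hf r1; have r0 := Wn_ge0 Hf.
have r01 : 0 <= r < 1 by rewrite r0.
have nz x : 1 - f x != 0.
  apply/eqP => /eqP; rewrite subr_eq0 => /eqP h.
  by have := Wn_bound x Hf; rewrite -h cabs1; lra.
split=> //; apply: (@Wn_series _ _ (fun k x => f x ^+ k) (fun k => r ^+ k)).
- by move=> k; apply: WnX.
- by move=> n; apply: geom_sum.
move=> x e e0; have fx := Wn_bound x Hf.
have c0 : 0 < cabs (1 - f x) by rewrite cabs_gt0.
have [N HN] := expr_small r01 (mulr_gt0 e0 c0); exists N => n /HN h.
have E : (1 - f x) * \sum_(k < n) f x ^+ k = 1 - f x ^+ n.
  by rewrite -[in RHS](expr1n C n) subrXX; congr (_ * _); apply: eq_bigr => k _; rewrite expr1n mul1r.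
have -> : (1 - f x)^-1 - \sum_(k < n) f x ^+ k = f x ^+ n / (1 - f x).
  apply: (mulfI (nz x)); rewrite mulrBr E divff // mulrCA divff //; ring.
rewrite cabsM cabsV ler_pdivrMr // cabsX; apply: le_trans h.
by apply: lerXn2r; rewrite ?nnegrE ?cabs_ge0.
Qed.

Lemma Wn_few s (L : seq R) B : (forall t, t \in s -> t.2 \in L) ->
  (forall x, cabs (ev s x) <= B) -> Wn setT (ev s) ((size L)%:R * B).
Proof.
move=> sL sB; pose s' := [seq (coef s l, l) | l <- undup L].
apply: (@Wn_ext _ _ (ev s')) => [x|].
  by rewrite [RHS]evE (pcharE _ sL) /ev big_map.
have B0 : 0 <= B by apply: le_trans (sB 0); apply: cabs_ge0.
apply: (Wn_weaken (@subset_refl _ setT) _ (@Wn_ev _ setT s' (fun _ _ => I))).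
rewrite /nrm big_map /=; apply: (@le_trans _ _ (\sum_(l <- undup L) B)).
  by apply: ler_sum => l _; rewrite -bohr_coef_ev; apply: bohr_coef_bound (AP_ev s) sB.
by rewrite big_const_seq count_predT iter_addr addr0 -[B *+ _]mulr_natl ler_wpM2r // ler_nat size_undup.
Qed.

Lemma addr_setT : forall l m : R, [set: R] l -> [set: R] m -> [set: R] (l + m).
Proof. by []. Qed.

(* The Wiener spectral radius equals the sup norm: the n-th power of a
   trigonometric polynomial has only polynomially many frequencies. *)
Lemma Wn_spectral_radius f r (p q : R) : Wn setT f r -> (forall x, cabs (f x) <= p) -> p < q ->
  exists2 K, 0 < K & forall n, Wn setT (fun x => f x ^+ n) (K * q ^+ n).
Proof.
move=> Hf fp pq; have p0 : 0 <= p by apply: le_trans (fp 0); apply: cabs_ge0.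
have [w [B Hw]] := APW_rep (Wn_APW Hf).1 (Wn_APW Hf).2.
have [_ wB _] := Hw.
(* f is a polynomial s of sup norm at most p + e plus a remainder of Wiener radius e. The binomial
   formula then gives (n + 1)^(size s) (p + 2 e)^n, and p + 2 e < q leaves room for the polynomial
   factor. *)
pose e := (q - p) / 4; have e0 : 0 < e by rewrite /e; lra.
have [N HN] := pbounded_tail wB e0.
have := rep_tail Hw (HN N (leqnn N)); set s := psum w N => Hb.
have sB x : cabs (ev s x) <= p + e.
  rewrite (_ : ev s x = f x - (f x - ev s x)); last by ring.
  by apply: le_trans (cabsB _ _) _; rewrite lerD // (Wn_bound x Hb).
have Hs k : Wn setT (fun x => ev s x ^+ k) (k.+1%:R ^+ size s * (p + e) ^+ k).
  apply: (@Wn_ext _ _ (ev (pexp s k))) => [x|]; first by rewrite ev_exp.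
  have h x : cabs (ev (pexp s k) x) <= (p + e) ^+ k.
    by rewrite ev_exp cabsX; apply: lerXn2r; rewrite ?nnegrE ?cabs_ge0 //; lra.
  have := Wn_few (@pexp_combos _ s k) h.
  by rewrite size_combos size_map natrX.
have Q01 : 0 < (p + e + e) / q < 1.
  have q0 : 0 < q by lra.
  by rewrite divr_gt0 ?ltr_pdivrMr //= /e; lra.
have [K K0 HK] := poly_exp_bound (size s) Q01.
exists K => // n.
have h : Wn setT (fun x => f x ^+ n)
    (\sum_(i < n.+1) 'C(n, i)%:R * (((n - i).+1%:R ^+ size s * (p + e) ^+ (n - i)) * e ^+ i)).
  have := @Wn_sum _ setT (fun i x => 'C(n, i)%:R * (ev s x ^+ (n - i) * (f x - ev s x) ^+ i)) _ n.+1
    (fun i => WnZ ('C(n, i)%:R) (WnM addr_setT (Hs (n - i)%N) (WnX i I addr_setT Hb))).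
  under [X in Wn _ _ X]eq_bigr do rewrite cabs_nat.
  apply: Wn_ext => x; rewrite -{2}[f x](subrKC (ev s x)) exprDn.
  by apply: eq_bigr => i _; rewrite mulr_natl.
apply: Wn_weaken h => //.
apply: (@le_trans _ _ (n.+1%:R ^+ size s * (p + e + e) ^+ n)).
  rewrite exprDn mulr_sumr; apply: ler_sum => i _.
  rewrite -[((p + e) ^+ (n - i) * _) *+ _]mulr_natl [leRHS]mulrCA ler_wpM2l // mulrA ler_wpM2r ?exprn_ge0 ?(ltW e0) //.
  rewrite ler_wpM2r ?exprn_ge0 //; first lra.
  by apply: lerXn2r; rewrite ?nnegrE // ler_nat ltnS leq_subr.
have qn : 0 < q ^+ n by rewrite exprn_gt0 //; lra.
by have := HK n; rewrite expr_div_n mulrA ler_pdivrMr.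
Qed.

Lemma is_derive_eps (p : R -> R) (t d : R) :
  (forall e, 0 < e -> exists2 r, 0 < r & forall h, `|h| < r -> `|p (t + h) - p t - d * h| <= e * `|h|) ->
  is_derive t (1 : R) p d.
Proof.
move=> H; have hc : (fun h => h^-1 *: (p (h *: 1 + t) - p t)) @ (0 : R)^' --> d.
  apply/cvgrPdist_le => e /H[r r0 Hr]; rewrite near_withinE; exists r => // h hb h0.
  have hr : `|h| < r by move: hb; rewrite /ball_ /= sub0r normrN.
  rewrite -(ler_pM2r (_ : 0 < `|h|)) ?normr_gt0 //; apply: le_trans (Hr h hr).
  rewrite (mulr1 h : h *: (1 : R) = h) [h + t]addrC -[_ *: _]/(h^-1 * _) -normrM -normrN.
  by rewrite le_eqVlt; apply/orP; left; apply/eqP; congr `|_|; field.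
split; last exact: cvg_lim hc.
by apply/cvg_ex; exists d.
Qed.

(** The real mean value theorem applied to the real part of u F on [0, 1], where u rotates F(1) -
    F(0) to its modulus. *)
Lemma cderiv_mvt (F d : C -> C) (M : R) :
  (forall t : R, 0 <= t <= 1 -> cderiv F t%:C (d t%:C) /\ cabs (d t%:C) <= M) ->
  cabs (F 1 - F 0) <= M.
Proof.
move=> H; have [u u1 ->] := cabs_rot (F 1 - F 0).
pose p (t : R) := complex.Re (u * F t%:C).
have dp (t : R) : 0 <= t <= 1 -> is_derive t (1 : R) p (complex.Re (u * d t%:C)).
  move=> /H[hd _]; apply: is_derive_eps => e /hd[r r0 Hr]; exists r => // h hr.
  have := Hr h%:C; rewrite cabs_real => /(_ hr); apply: le_trans.
  rewrite /p rmorphD -cReN -cReD.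
  have -> : complex.Re (u * d t%:C) * h = complex.Re (u * d t%:C * h%:C).
    by rewrite [RHS]cReM /= mulr0 subr0.
  rewrite -cReN -cReD; apply: le_trans (cabs_Re _) _.
  have -> : u * F (t%:C + h%:C) - u * F t%:C - u * d t%:C * h%:C =
    u * (F (t%:C + h%:C) - F t%:C - d t%:C * h%:C) by ring.
  by rewrite cabsM ler_piMl ?cabs_ge0.
have cp : {within `[0, 1], continuous p}.
  apply: derivable_within_continuous => t; rewrite in_itv /= => /dp[]; exact.
have dp' (t : R) : t \in `]0, 1[%R -> is_derive t (1 : R) p (complex.Re (u * d t%:C)).
  by rewrite in_itv /= => /andP[t0 t1]; apply: dp; rewrite !ltW.
have [c ci E] := MVT ltr01 dp' cp.
move: E; rewrite subr0 mulr1 /p -cReN -cReD -mulrBr => ->.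
apply: le_trans (ler_norm _) _; apply: le_trans (cabs_Re _) _.
have /H[_ hM] : 0 <= c <= 1 by move: ci; rewrite in_itv /= => /andP[? ?]; rewrite !ltW.
by rewrite cabsM; apply: le_trans hM; rewrite ler_piMl ?cabs_ge0.
Qed.

(** Along z -> z w, the n-th partial sum of log(1 + (e^(zw) - 1)) minus z w has derivative -w (1 -
    e^(zw))^n, and |w| <= 1/8 keeps |1 - e^(tw)| at most 1/4 for t in [0, 1]. *)
Lemma log_series_bound w n : cabs w <= 8^-1 ->
  cabs (w - \sum_(k < n) (-1) ^+ k / k.+1%:R * (cexp w - 1) ^+ k.+1) <= 4^-1 ^+ n.
Proof.
move=> hw.
pose L (m : nat) z := \sum_(k < m) (-1) ^+ k / k.+1%:R * z ^+ k.+1 : C.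
pose D (m : nat) z := \sum_(k < m) (- z) ^+ k : C.
have dX z m : cderiv (fun z => z ^+ m.+1) z (m.+1%:R * z ^+ m).
  elim: m => [|m IH].
    by rewrite expr0 mulr1; apply: cderiv_id.
  have := cderivM (cderiv_id z) IH.
  rewrite (_ : (fun z => id z * z ^+ m.+1) = (fun z => z ^+ m.+2)); last first.
    by apply/funext => y; rewrite [RHS]exprS.
  by rewrite (_ : _ + _ = m.+2%:R * z ^+ m.+1) //= -[m.+2%:R]natr1 exprS; ring.
have dL m z : cderiv (L m) z (D m z).
  rewrite /L /D; elim: m => [|m IH].
    rewrite big_ord0 (_ : (fun z => _) = fun=> 0); last by apply/funext => y; rewrite big_ord0.
    exact: cderiv_const.
  have := cderivD IH (cderivZ ((-1) ^+ m / m.+1%:R) (dX z m)).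
  rewrite (_ : (fun z => _ + _) = (fun z => \sum_(k < m.+1) (-1) ^+ k / k.+1%:R * z ^+ k.+1)); last first.
    by apply/funext => y; rewrite [RHS]big_ord_recr.
  rewrite big_ord_recr /= (_ : _ / _ * _ = (- z) ^+ m) //.
  by rewrite mulrA mulfVK ?pnatr_eq0 // -exprMn mulN1r.
have sumD z : (1 + z) * D n z = 1 - (- z) ^+ n.
  rewrite -[in RHS](expr1n C n) subrXX opprK; congr (_ * _).
  by apply: eq_bigr => k _; rewrite expr1n mul1r.
pose F z := L n (cexp (z * w) - 1) + (-1) * (z * w).
pose d z := - w * (1 - cexp (z * w)) ^+ n.
have hF (t : R) : 0 <= t <= 1 -> cderiv F t%:C (d t%:C) /\ cabs (d t%:C) <= 4^-1 ^+ n.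
  move=> /andP[t0 t1]; split.
    have h1 : cderiv (fun z => z * w) t%:C w.
      have := cderivZ w (cderiv_id t%:C); rewrite mulr1.
      by rewrite (_ : (fun z => w * id z) = (fun z => z * w)) //; apply/funext => y; rewrite mulrC.
    have h2 := cderivD (cderiv_exp_lin h1) (cderiv_const (-1) t%:C).
    have h3 := cderiv_comp h2 (dL n _).
    have := cderivD h3 (cderivZ (-1) h1).
    rewrite (_ : _ + _ = d t%:C) // /d.
    have := sumD (cexp (t%:C * w) - 1); rewrite (_ : 1 + (_ - 1) = cexp (t%:C * w)); last by ring.
    rewrite opprB; set E := cexp _; set Q := D _ _ => hQ.
    have -> : Q * (E * w + 0) + -1 * w = w * (E * Q) - w by ring.
    by rewrite hQ; ring.
  rewrite /d cabsM cabsN cabsX.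
  have tw : cabs (t%:C * w) <= 8^-1.
    rewrite cabsM cabs_real ger0_norm //; have := cabs_ge0 w; nra.
  have ht : cabs (1 - cexp (t%:C * w)) <= 4^-1.
    have t2 : cabs (t%:C * w) <= 2^-1 by lra.
    have hs := cexp_small t2; rewrite cabsBC.
    have -> : cexp (t%:C * w) - 1 = (cexp (t%:C * w) - 1 - t%:C * w) + t%:C * w by ring.
    apply: le_trans (cabsD _ _) _; have := cabs_ge0 (t%:C * w).
    move: (cabs (t%:C * w)) (cabs (cexp _ - _ - _)) hs tw => Y Z; nra.
  have e0 : 0 <= 4^-1 ^+ n :> R by rewrite exprn_ge0.
  have : cabs (1 - cexp (t%:C * w)) ^+ n <= 4^-1 ^+ n.
    by apply: lerXn2r; rewrite ?nnegrE ?cabs_ge0.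
  have : 0 <= cabs (1 - cexp (t%:C * w)) ^+ n by rewrite exprn_ge0 ?cabs_ge0.
  have := cabs_ge0 w; nra.
have F1 : F 1 = L n (cexp w - 1) - w by rewrite /F mulN1r mul1r.
have F0 : F 0 = 0.
  rewrite /F mul0r cexp0 subrr mulr0 addr0 /L big1 // => k _.
  by rewrite expr0n mulr0.
by have := cderiv_mvt hF; rewrite F1 F0 subr0 cabsBC.
Qed.

(** Subtracting from g a polynomial s within 1/8 leaves w for which e^w - 1 = e^g e^(-s) - 1 is in
    the Wiener algebra and has sup norm at most 1/4. By the spectral radius formula its n-th power
    has radius at most K 2^(-n), so the logarithmic series converges in the algebra, to w. *)
Theorem APW_log g r : AP g -> Wn setT (fun x => cexp (g x)) r -> exists r', Wn setT g r'.
Proof.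
move=> /APP/(_ 8^-1)[|s hs Hu]; first by rewrite invr_gt0.
pose w x := g x - ev s x.
have Hs : Wn setT (fun x => (-1) * ev s x) (cabs (-1 : C) * nrm s) by apply/WnZ/Wn_ev.
have Hw : Wn setT (fun x => cexp (w x) - 1) (r * expR (cabs (-1 : C) * nrm s) + cabs (-1 : C)).
  have := WnD (WnM addr_setT Hu (Wn_cexp I addr_setT Hs)) (Wn_cst (-1) (I : setT 0)).
  by apply: Wn_ext => x; rewrite -cexpD mulN1r.
have wB x : cabs (cexp (w x) - 1) <= 4^-1.
  have t2 : cabs (w x) <= 2^-1 by have := hs x; rewrite -/(w x); lra.
  have h2 := cexp_small t2; have h1 : cabs (w x) <= 8^-1 := hs x.
  have -> : cexp (w x) - 1 = (cexp (w x) - 1 - w x) + w x by ring.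
  apply: le_trans (cabsD _ _) _; have := cabs_ge0 (w x).
  move: (cabs (w x)) (cabs (cexp _ - _ - _)) h1 h2 => Y Z; nra.
have q42 : 4^-1 < 2^-1 :> R by lra.
have [K K0 HK] := Wn_spectral_radius Hw wB q42.
pose c (k : nat) : C := (-1) ^+ k / k.+1%:R.
have c1 k : cabs (c k) <= 1.
  by rewrite /c cabsM cabsX cabsN cabs1 expr1n mul1r cabsV cabs_nat invf_le1 ?ltr0Sn // ler1n.
have Ww : Wn setT w (K * (1 - 2^-1)^-1).
  apply: (@Wn_series _ _ (fun k x => c k * (cexp (w x) - 1) ^+ k.+1) (fun k => K * 2^-1 ^+ k)).
  - move=> k; apply: Wn_weaken (WnZ (c k) (HK k.+1)) => //.
    have k0 : 0 <= K * 2^-1 ^+ k by rewrite mulr_ge0 ?exprn_ge0 // ltW.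
    apply: (@le_trans _ _ (1 * (K * 2^-1 ^+ k))); last by rewrite mul1r.
    apply: ler_pM; rewrite ?cabs_ge0 //; first by rewrite mulr_ge0 ?exprn_ge0 // ltW.
    by rewrite ler_wpM2l ?(ltW K0) // exprS ler_piMl ?exprn_ge0 //; lra.
  - move=> n; rewrite -mulr_sumr ler_wpM2l ?(ltW K0) //; apply: geom_sum; lra.
  - move=> x e e0; have q01 : 0 <= (4^-1 : R) < 1 by lra.
    have [N HN] := expr_small q01 e0; exists N => n /HN h.
    by apply: le_trans h; apply: log_series_bound; apply: hs.
exists (K * (1 - 2^-1)^-1 + nrm s).
by apply: Wn_ext (WnD Ww (Wn_ev (fun _ _ => I))) => x; rewrite /w subrK.
Qed.

End ExpLog.

(** * Characters of seminormed algebras *)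

Section Gelfand.
Variable R : realType.
Local Notation C := R[i].

(** Compactness of the square [-L, L]^2; it turns the local bounds on the resolvent into one on a
    closed disc. *)
Lemma locally_bounded_disc (phi : C -> R) (L : R) :
  (forall z, exists2 d, 0 < d & exists B, forall w, cabs (w - z) < d -> phi w <= B) ->
  exists M, forall z, cabs z <= L -> phi z <= M.
Proof.
move=> H; pose K : set (R * R) := `[- L, L]%classic `*` `[- L, L]%classic.
have cK : compact K by apply: compact_setX; apply: segment_compact.
have /compact_near_coveringP cover := cK.
have := cover R (pinfty_nbhs R) (fun M (x : R * R) => phi (x.1 +i* x.2) <= M).
move=> /(_ _)[x _|M [_ HM]].
  have [d d0 [B HB]] := H (x.1 +i* x.2).
  have d2 : 0 < d / 2 by lra.
  exists (ball x (d / 2), [set M | B < M]) => [|[y M] [/= [y1 y2] BM]].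
    split => /=; first exact: nbhsx_ballx.
    by exists B; split; first exact: num_real.
  apply: le_trans (ltW BM); apply: HB; apply: le_lt_trans (cabs_ReIm _) _ => /=.
  by move: y1 y2; rewrite -!ball_normE /= distrC => y1; rewrite distrC => y2; lra.
have MM : M < M + 1 by rewrite ltrDl.
exists (M + 1) => z zL; have := HM _ MM (complex.Re z, complex.Im z).
rewrite /K /= !in_itv /= -!ler_norml => /(_ _)/=; rewrite (_ : _ +i* _ = z); last by case: z {zL}.
by apply; split; apply: le_trans zL; [apply: cabs_Re|apply: cabs_Im].
Qed.

Lemma root_minus1 j : exists2 z : C, z ^+ (2 ^ j) = -1 & cabs z = 1.
Proof.
elim: j => [|j [z zE z1]]; first by exists (-1); rewrite ?expr1 ?cabsN ?cabs1.
exists (sqrtc z); first by rewrite expnS exprM sqr_sqrtc.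
apply/eqP; rewrite -(@eqrXn2 _ 2) ?cabs_ge0 // expr1n -cabsX sqr_sqrtc.
by apply/eqP.
Qed.

Lemma bernoulli (x : R) n : 0 <= x <= 1 -> 1 - n%:R * x <= (1 - x) ^+ n.
Proof.
move=> /andP[x0 x1]; elim: n => [|n IH]; first by rewrite expr0 mul0r subr0.
rewrite exprS -natr1; have n0 := ler0n R n.
by apply: (@le_trans _ _ ((1 - x) * (1 - n%:R * x))); [nra|rewrite ler_wpM2l //; lra].
Qed.

(** With d = 1/(4 n), Bernoulli's inequality gives (1 - d)^n >= 3/4. The number nu (1 - d) will
    contradict the minimality of nu. *)
Lemma bernoulli_gap (nu : R) n : 0 < nu -> (0 < n)%N ->
  exists2 d, 0 < d < 1 & nu ^+ n / 2 < (nu * (1 - d)) ^+ n.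
Proof.
move=> nu0 n0; have nR : 1 <= n%:R :> R by rewrite ler1n.
have n4 : 0 < 4 * n%:R :> R by rewrite mulr_gt0 // (lt_le_trans ltr01).
have d1 : (4 * n%:R)^-1 < 1 :> R
  by rewrite invf_lt1 // (@lt_le_trans _ _ 4) ?ltr1n // ler_peMr.
exists (4 * n%:R)^-1; first by rewrite invr_gt0 n4.
rewrite exprMn ltr_pM2l ?exprn_gt0 //; apply: lt_le_trans (bernoulli n _); last first.
  by rewrite invr_ge0 !ltW.
have -> : n%:R * (4 * n%:R)^-1 = 4^-1 :> R by rewrite invfM mulrCA divff ?mulr1 // pnatr_eq0 -lt0n.
lra.
Qed.

Section Spectrum.
Variables (A : comNzRingType) (i : {rmorphism C -> A}) (q : A -> R).
Hypothesis q_ge0 : forall x, 0 <= q x.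
Hypothesis qD : forall x y, q (x + y) <= q x + q y.
Hypothesis qM : forall x y, q (x * y) <= q x * q y.
Hypothesis qi : forall c, q (i c) <= cabs c.
Hypothesis q1 : 1 <= q 1.

Lemma qZ c x : q (i c * x) <= cabs c * q x.
Proof. by apply: le_trans (qM _ _) _; rewrite ler_wpM2r. Qed.

Lemma q0 : q 0 = 0.
Proof. by apply/eqP; rewrite eq_le q_ge0 andbT -(rmorph0 i) -(cabs0 R). Qed.

Lemma qN x : q (- x) = q x.
Proof.
have h y : q (- y) <= q y.
  by have := qZ (-1) y; rewrite rmorphN rmorph1 mulN1r cabsN cabs1 mul1r.
by apply/eqP; rewrite eq_le h -{1}[x]opprK h.
Qed.

Lemma qB x y : q (x - y) <= q x + q y.
Proof. by rewrite -(qN y). Qed.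

Lemma qX x n : q (x ^+ n.+1) <= q x ^+ n.+1.
Proof.
elim: n => [|n IH]; first by rewrite !expr1.
rewrite exprS [leRHS]exprS; apply: le_trans (qM _ _) _; exact: ler_wpM2l.
Qed.

Lemma qle0 x : q x <= 0 -> q x = 0.
Proof. by move=> h; apply/eqP; rewrite eq_le h q_ge0. Qed.

Lemma q_mul0 x y : q y = 0 -> q (x * y) = 0.
Proof. by move=> h; apply: qle0; apply: le_trans (qM _ _) _; rewrite h mulr0. Qed.

(** Equality in the quotient by the kernel of q is written [q (x - y) = 0]; this lemma lets q be
    computed modulo that kernel. *)
Lemma q_eqD x y : q y = 0 -> q (x + y) = q x.
Proof.
move=> h; apply/eqP; rewrite eq_le; apply/andP; split.
  by have := qD x y; rewrite h addr0.
by have := qB (x + y) y; rewrite addrK h addr0.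
Qed.

Lemma q_add0 x y : q x = 0 -> q y = 0 -> q (x + y) = 0.
Proof. by move=> h k; rewrite q_eqD. Qed.

(* Rickart: averaging the resolvent over the 2^j-th roots of unity gives the
   resolvent of a^(2^j), which tends to 1 outside the spectral circle but, by
   uniform continuity, also on it. *)
Theorem spectrum_nonempty (a : A) : exists c, forall b, q (b * (a - i c) - 1) != 0.
Proof.
apply: contrapT => /forallNP H.
have /choice[b Hb] c : exists b, q (b * (a - i c) - 1) = 0.
  by have /existsNP[b /negP] := H c; rewrite negbK => /eqP; exists b.
(* [g s] inverts 1 - s a modulo the kernel of q: the resolvent in the variable s = 1/c, so that s =
   0 is included, with value 1. *)
have /choice[g Hg] s : exists g, q (g * (1 - i s * a) - 1) = 0.
  have [->|s0] := eqVneq s 0.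
    by exists 1; rewrite rmorph0 mul0r subr0 mulr1 subrr q0.
  exists (- (i s^-1 * b s^-1)); rewrite -(Hb s^-1); congr (q (_ - 1)).
  have h : i s^-1 * i s = 1 by rewrite -rmorphM mulVf // rmorph1.
  have -> : - (i s^-1 * b s^-1) * (1 - i s * a) = - (i s^-1 * b s^-1) + (i s^-1 * i s) * b s^-1 * a by ring.
  by rewrite h; ring.
have lip s t : q (g s - g t) <= cabs (s - t) * q a * q (g s) * q (g t).
  have h1 := q_mul0 (g s) (Hg t); have h2 := q_mul0 (- g t) (Hg s).
  have -> : g s - g t = i (s - t) * a * g s * g t +
     (- (g s * (g t * (1 - i t * a) - 1)) - (- g t * (g s * (1 - i s * a) - 1))).
    by rewrite rmorphB; ring.
  rewrite q_eqD; last by rewrite -opprD qN q_add0.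
  apply: le_trans (qM _ _) _; rewrite ler_wpM2r //.
  apply: le_trans (qM _ _) _; rewrite ler_wpM2r //; exact: qZ.
have loc z : exists2 d, 0 < d & exists B, forall w, cabs (w - z) < d -> q (g w) <= B.
  have a0 := q_ge0 a; have g0 := q_ge0 (g z).
  have D0 : 0 < 2 * (1 + q a * q (g z)) by rewrite mulr_gt0 // ltr_wpDr // mulr_ge0.
  exists (2 * (1 + q a * q (g z)))^-1; first by rewrite invr_gt0.
  exists (2 * q (g z)) => w; rewrite -[ltRHS]div1r ltr_pdivlMr // => hw.
  have := lip w z; have := qD (g z) (g w - g z); rewrite subrKC => h1 h2.
  have w0 := q_ge0 (g w); have c0 := cabs_ge0 (w - z).
  have : cabs (w - z) * q a * q (g w) * q (g z) <= 2^-1 * q (g w).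
    have -> : cabs (w - z) * q a * q (g w) * q (g z) = cabs (w - z) * (q a * q (g z)) * q (g w) by ring.
    by rewrite ler_wpM2r //; lra.
  lra.
(* Its infimum is that of the q(a^(2^j))^(1/2^j), the spectral radius of a. *)
pose S := [set t : R | 0 < t /\ exists j, q (a ^+ (2 ^ j)) < t ^+ (2 ^ j)].
pose b0 := b 0.
have hb0 : q (b0 * a - 1) = 0 by have := Hb 0; rewrite rmorph0 subr0.
have b0X n : q ((b0 * a) ^+ n - 1) = 0.
  elim: n => [|n IH]; first by rewrite expr0 subrr q0.
  have -> : (b0 * a) ^+ n.+1 - 1 = (b0 * a) ^+ n * (b0 * a - 1) + ((b0 * a) ^+ n - 1).
    by rewrite exprSr; ring.
  by rewrite q_add0 // q_mul0.
(* Modulo the kernel of q, b0 is an inverse of a (the case c = 0); this keeps S above 1/q(b0), hence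
   the spectral radius positive. *)
have Slow t : S t -> 1 <= t * q b0.
  move=> [t0 [j hj]]; rewrite leNgt; apply/negP => h.
  have n0 : (0 < 2 ^ j)%N by rewrite expn_gt0.
  have : q 1 <= (t * q b0) ^+ (2 ^ j).
    rewrite -[1](subKr ((b0 * a) ^+ (2 ^ j))) q_eqD; last by rewrite qN b0X.
    rewrite exprMn; apply: le_trans (qM _ _) _.
    rewrite mulrC exprMn; apply: ler_pM => //; first exact: ltW.
    by rewrite -(prednK n0) qX.
  apply/negP; rewrite -ltNge; apply: lt_le_trans q1; rewrite exprn_ilt1 ?mulr_ge0 ?(ltW t0) //.
  by rewrite -lt0n.
have S1 : S (q a + 1).
  split; first by rewrite ltr_wpDl.
  by exists 0%N; rewrite !expr1 ltrDl.
have qb0 : 0 < q b0.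
  rewrite lt_def q_ge0 andbT; apply/eqP => h; have := Slow _ S1.
  by rewrite h mulr0 ler10.
have hS : has_inf S.
  by split; [exists (q a + 1)|exists 0 => t [/ltW]].
pose nu := inf S.
have nu0 : 0 < nu.
  apply: (@lt_le_trans _ _ (q b0)^-1); first by rewrite invr_gt0.
  apply: lb_le_inf; first by exists (q a + 1).
  by move=> t /Slow h; rewrite -[leLHS]div1r ler_pdivrMr.
pose rho := nu^-1.
have rho0 : 0 < rho by rewrite invr_gt0.
have [M HM] := locally_bounded_disc rho loc.
have M0 : 0 <= M by apply: le_trans (HM 0 _); rewrite ?cabs0 // ltW.
pose W := q a * M * M.
have W0 : 0 <= W by rewrite !mulr_ge0.
have e0 : 0 < nu ^+ 2 / (12 * (1 + W)) by rewrite divr_gt0 ?exprn_gt0 // mulr_gt0 // ltr_wpDr.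
have [t [t0 [j0 ht]] tnu] := inf_adherent e0 hS.
have nut : nu <= t by apply: ge_inf; [case: hS|split=> //; exists j0].
(* The circle of radius rho = 1/nu is the critical one; scaling by tau moves it to radius 1/t, where
   (a/t)^(2^j) tends to 0 because t is in S. *)
pose tau := nu / t.
have tau0 : 0 < tau by rewrite divr_gt0.
have tau1 : tau <= 1 by rewrite ler_pdivrMr // mul1r.
have lipt s : cabs s = rho -> q (g s - g (tau%:C * s)) <= 12^-1.
  move=> sr; apply: le_trans (lip _ _) _.
  have gs : q (g s) <= M by apply: HM; rewrite sr.
  have gts : q (g (tau%:C * s)) <= M.
    by apply: HM; rewrite cabsM cabs_real sr ger0_norm ?(ltW tau0) // ler_piMl ?(ltW rho0).
  have d : cabs (s - tau%:C * s) <= (12 * (1 + W))^-1.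
    rewrite -{1}[s]mul1r -mulrBl cabsM sr -(rmorph1 (real_complex R)) -rmorphB cabs_real.
    rewrite ger0_norm ?subr_ge0 //.
    have -> : (1 - tau) * rho = (t - nu) / (t * nu) by rewrite /tau /rho; field; rewrite !gt_eqF.
    rewrite ler_pdivrMr ?mulr_gt0 //; apply: (@le_trans _ _ (nu ^+ 2 / (12 * (1 + W)))).
      by move: tnu; rewrite -/nu; lra.
    by rewrite mulrC ler_wpM2l ?expr2 ?ler_wpM2r ?(ltW nu0) // invr_ge0 mulr_ge0 // addr_ge0.
  apply: (@le_trans _ _ ((12 * (1 + W))^-1 * W)).
    rewrite /W !mulrA; do 2 (apply: ler_pM => //; rewrite ?mulr_ge0 ?cabs_ge0 ?q_ge0 //).
    by rewrite ler_wpM2r.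
  by rewrite mulrC ler_pdivrMr ?mulr_gt0 ?ltr_wpDr //; lra.
(* [h] averages the resolvent over the 2^j-th roots of unity; one more step averages the values at s
   and z s, with z^(2^j) = -1. Averaging preserves the bound 1/12. *)
have avg j : exists h : C -> A,
    (forall s, q (h s * (1 - i (s ^+ (2 ^ j)) * a ^+ (2 ^ j)) - 1) = 0) /\
    (forall s, cabs s = rho -> q (h s - h (tau%:C * s)) <= 12^-1).
  elim: j => [|j [h [h1 h2]]]; first by exists g; split=> // s; rewrite !expr1.
  have [z zE z1] := root_minus1 j.
  exists (fun s => i 2^-1 * (h s + h (z * s))); split=> s; last first.
    move=> sr; have -> : i 2^-1 * (h s + h (z * s)) - i 2^-1 * (h (tau%:C * s) + h (z * (tau%:C * s)))
      = i 2^-1 * ((h s - h (tau%:C * s)) + (h (z * s) - h (tau%:C * (z * s)))).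
      by rewrite [z * (_ * s)]mulrCA; ring.
    apply: le_trans (qZ _ _) _; rewrite cabsV cabs_nat.
    have k1 := h2 s sr; have k2 : q (h (z * s) - h (tau%:C * (z * s))) <= 12^-1.
      by apply: h2; rewrite cabsM z1 mul1r.
    by have := qD (h s - h (tau%:C * s)) (h (z * s) - h (tau%:C * (z * s))); lra.
  have k1 := h1 s; have := h1 (z * s); rewrite exprMn zE mulN1r rmorphN mulNr opprK => k2.
  rewrite expnS mulnC !exprM rmorphXn.
  set X := i (s ^+ (2 ^ j)) in k1 k2 *; set a' := a ^+ (2 ^ j) in k1 k2 *.
  have i2 : i 2^-1 * (1 + 1) = 1.
    by rewrite -(rmorph1 i) -rmorphD -rmorphM mulVf ?rmorph1 // pnatr_eq0.
  have -> : i 2^-1 * (h s + h (z * s)) * (1 - X ^+ 2 * a' ^+ 2) - 1 =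
     i 2^-1 * ((1 + X * a') * (h s * (1 - X * a') - 1)) +
     i 2^-1 * ((1 - X * a') * (h (z * s) * (1 + X * a') - 1)).
    by rewrite -[X in _ - X = _]i2; ring.
  by apply: q_add0; do 2 apply: q_mul0.
have th01 : 0 <= q (a ^+ (2 ^ j0)) / t ^+ (2 ^ j0) < 1.
  have tn : 0 < t ^+ (2 ^ j0) by rewrite exprn_gt0.
  by rewrite divr_ge0 ?q_ge0 ?(ltW tn) // ltr_pdivrMr // mul1r.
have p12 : 0 < (12%:R : R)^-1 by rewrite invr_gt0.
have [k Hk] := expr_small th01 p12.
pose n := (2 ^ (j0 + k))%N.
have [h [h1 h2]] := avg (j0 + k)%N; rewrite -/n in h1.
pose Y := i ((t^-1)%:C ^+ n) * a ^+ n.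
have n0 : (0 < n)%N by rewrite expn_gt0.
have qY : q Y <= 12^-1.
  have h12 := Hk (2 ^ k)%N (ltnW (ltn_expl k (ltnSn 1))).
  apply: le_trans (qZ _ _) _; apply: le_trans h12.
  rewrite cabsX cabs_real ger0_norm ?invr_ge0 ?(ltW t0) // expr_div_n -!exprM -expnD -/n mulrC.
  rewrite exprVn ler_wpM2r ?invr_ge0 ?exprn_ge0 ?(ltW t0) // /n expnD exprM.
  have p0 : (0 < 2 ^ k)%N by rewrite expn_gt0.
  by rewrite -(prednK p0) qX.
have q11 : q 1 <= 1 by rewrite -(rmorph1 i) -(cabs1 R).
have taurho : tau%:C * rho%:C = (t^-1)%:C.
  by rewrite -rmorphM; congr (_%:C); rewrite /tau /rho; field; rewrite !gt_eqF.
have := h2 rho%:C; rewrite cabs_real ger0_norm ?(ltW rho0) // taurho => /(_ erefl).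
set x := h rho%:C; set y := h _ => hxy.
have hy : q (y * (1 - Y) - 1) = 0 := h1 _.
have qy1 : q (y - 1) <= q y * 12^-1.
  have -> : y - 1 = y * Y + (y * (1 - Y) - 1) by ring.
  rewrite q_eqD //; apply: le_trans (qM _ _) _; exact: ler_wpM2l.
have qy : q y <= 1 + q (y - 1).
  by have := qD 1 (y - 1); rewrite subrKC; lra.
have qx1 : q (x - 1) <= 3^-1.
  have -> : x - 1 = (x - y) + (y - 1) by ring.
  by apply: le_trans (qD _ _) _; have := q_ge0 y; lra.
pose X := i (rho%:C ^+ n) * a ^+ n.
have hx : q (x * (1 - X) - 1) = 0 := h1 _.
(* From x (1 - X) = 1 modulo the kernel, X = (1 - X)(x - 1), so q X <= (1 + q X)/3. *)
have qX1 : q X <= 2^-1.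
  have e1 : q X <= q (1 - X) * 3^-1.
    have -> : X = (1 - X) * (x - 1) - (x * (1 - X) - 1) by ring.
    rewrite q_eqD ?qN //; apply: le_trans (qM _ _) _.
    have -> : 1 - ((1 - X) * (x - 1) - (x * (1 - X) - 1)) = 1 - X by ring.
    exact: ler_wpM2l.
  by have := qB 1 X; clear - e1 q11; lra.
have qan : q (a ^+ n) <= nu ^+ n / 2.
  have -> : a ^+ n = i (nu%:C ^+ n) * X.
    rewrite /X mulrA -rmorphM -exprMn -rmorphM /rho divff ?gt_eqF //.
    by rewrite !rmorph1 expr1n rmorph1 mul1r.
  apply: le_trans (qZ _ _) _; rewrite cabsX cabs_real ger0_norm ?(ltW nu0) //.
  by rewrite ler_wpM2l // exprn_ge0 // ltW.
have [d d0 dlt] := bernoulli_gap nu0 n0.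
have St : S (nu * (1 - d)).
  split; first by rewrite mulr_gt0 // subr_gt0; case/andP: d0.
  by exists (j0 + k)%N; rewrite -/n; apply: le_lt_trans qan dlt.
have : nu <= nu * (1 - d) by apply: ge_inf => //; case: hS.
by apply/negP; rewrite -ltNge gtr_pMr // gtrBl; case/andP: d0.
Qed.

End Spectrum.
End Gelfand.

(** * Maximal ideals *)

Section Ideals.
Variable A : comNzRingType.

Definition proper_ideal_set (I : set A) : Prop :=
  [/\ I 0, forall x y, I x -> I y -> I (x + y), forall x y, I y -> I (x * y) & ~ I 1].

(** The empty chain has an empty union; Zorn's lemma is therefore applied to the sets X whose union
    with I0 is a proper ideal. *)
Lemma maximal_ideal (I0 : set A) : proper_ideal_set I0 ->
  exists I, [/\ proper_ideal_set I, I0 `<=` I &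
    forall a, ~ I a -> exists b, I (b * a - 1)].
Proof.
move=> P0; pose P (X : set A) := proper_ideal_set (X `|` I0).
have [|X [PX Xmax]] := @Zorn_bigcup A P.
  move=> F FP tot; have [z0 zD zM z1] := P0; split.
  - by right.
  - move=> x y [[X FX Xx]|Ix] [[Y FY Yy]|Iy].
    + have [XY|YX] := tot X Y FX FY.
        have [_ hD _ _] := FP Y FY.
        have [h|h] := hD x y (or_introl (XY _ Xx)) (or_introl Yy); [by left; exists Y|by right].
      have [_ hD _ _] := FP X FX.
      have [h|h] := hD x y (or_introl Xx) (or_introl (YX _ Yy)); [by left; exists X|by right].
    + have [_ hD _ _] := FP X FX.
      have [h|h] := hD x y (or_introl Xx) (or_intror Iy); [by left; exists X|by right].
    + have [_ hD _ _] := FP Y FY.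
      have [h|h] := hD x y (or_intror Ix) (or_introl Yy); [by left; exists Y|by right].
    + by right; apply: zD.
  - move=> x y [[Y FY Yy]|Iy]; last by right; apply: zM.
    have [_ _ hM _] := FP Y FY.
    by case: (hM x y (or_introl Yy)) => h; [left; exists Y|right].
  - move=> [[Y FY Yy]|Iy //]; have [_ _ _ h] := FP Y FY; by apply: h; left.
exists (X `|` I0); split=> // a Xa.
have [h0 hD hM h1] := PX.
pose B := [set x | exists b y, (X `|` I0) y /\ x = y + b * a].
have BI : I0 `<=` B by move=> x Ix; exists 0, x; split; [right|rewrite mul0r addr0].
have XB : X `<=` B by move=> x Xx; exists 0, x; split; [left|rewrite mul0r addr0].
have Ba : B a by exists 1, 0; split=> //; rewrite mul1r add0r.
have nPB : ~ P B.
  apply: Xmax; split=> // BX; apply: Xa; left; exact: BX.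
have BE : B `|` I0 = B by rewrite setUidl.
have [B1|nB1] := pselect (B 1).
  have [b [y [yX E]]] := B1; exists b.
  have Ey : y = 1 - b * a by rewrite [in RHS]E addrK.
  have -> : b * a - 1 = (-1) * y by rewrite Ey; ring.
  exact: hM.
exfalso; apply: nPB; rewrite /P BE; split=> //.
- by exists 0, 0; split=> //; rewrite mul0r addr0.
- move=> _ _ [b [y [yX ->]]] [c [z [zX ->]]]; exists (b + c), (y + z).
  by split; [apply: hD|ring].
- move=> x _ [b [y [yX ->]]]; exists (x * b), (x * y).
  by split; [apply: hM|ring].
Qed.

End Ideals.

(** * Existence of characters *)

Section Character.
Variable R : realType.
Local Notation C := R[i].
Variables (A : comNzRingType) (i : {rmorphism C -> A}) (N : A -> R).
Hypothesis N_ge0 : forall x, 0 <= N x.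
Hypothesis ND : forall x y, N (x + y) <= N x + N y.
Hypothesis NM : forall x y, N (x * y) <= N x * N y.
Hypothesis Ni : forall c, N (i c) <= cabs c.
Hypothesis N_unit : forall x, N (1 - x) < 1 -> exists y, x * y = 1.

(** [N_unit] replaces completeness of the norm. For the infimum seminorm modulo a maximal ideal
    containing I0 every spectrum is nonempty, so each a is congruent to a scalar, as in the
    Gelfand-Mazur theorem; that scalar is [chi a]. *)
Theorem gelfand_character (I0 : set A) : proper_ideal_set I0 ->
  exists chi : A -> C,
    [/\ forall x y, chi (x + y) = chi x + chi y, forall x y, chi (x * y) = chi x * chi y,
        forall c, chi (i c) = c, forall x, cabs (chi x) <= N x &
        forall x, I0 x -> chi x = 0].
Proof.
move=> /maximal_ideal[I [[I00 ID IM I1] II maxI]].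
have IB x y : I x -> I y -> I (x - y).
  by move=> hx hy; apply: ID => //; rewrite -mulN1r; apply: IM.
have Iunit x y : I x -> x * y <> 1.
  by move=> Ix E; apply: I1; rewrite -E mulrC; apply: IM.
pose V x := [set N (x - m) | m in I].
have V0 x : has_inf (V x).
  split; first by exists (N (x - 0)); exists 0.
  by exists 0 => _ [m _ <-].
pose q x := inf (V x).
have qle x m : I m -> q x <= N (x - m).
  by move=> Im; apply: ge_inf; [case: (V0 x)|exists m].
have qex x e : 0 < e -> exists2 m, I m & N (x - m) < q x + e.
  by move=> e0; have [_ [m Im <-] h] := inf_adherent e0 (V0 x); exists m.
have q_ge0 x : 0 <= q x.
  by apply: lb_le_inf; [case: (V0 x)|move=> _ [m _ <-]].
have qD x y : q (x + y) <= q x + q y.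
  apply/ler_addgt0Pr => e e0; have e2 : 0 < e / 2 by lra.
  have [m Im hm] := qex x _ e2; have [p Ip hp] := qex y _ e2.
  apply: le_trans (qle _ _ (ID _ _ Im Ip)) _.
  have -> : x + y - (m + p) = (x - m) + (y - p) by ring.
  by apply: le_trans (ND _ _) _; lra.
have qM x y : q (x * y) <= q x * q y.
  apply/ler_addgt0Pr => e e0; have qx := q_ge0 x; have qy := q_ge0 y.
  pose d := Num.min 1 (e / (1 + q x + q y)).
  have s0 : 0 < 1 + q x + q y by lra.
  have d0 : 0 < d by rewrite lt_min ltr01 divr_gt0.
  have d1 : d <= 1 by rewrite ge_min lexx.
  have de : d * (1 + q x + q y) <= e by rewrite -ler_pdivlMr // ge_min lexx orbT.
  have [m Im hm] := qex x _ d0; have [p Ip hp] := qex y _ d0.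
  have h : I (x * p + m * (y - p)).
    by apply: ID; [apply: IM|rewrite mulrC; apply: IM].
  apply: le_trans (qle _ _ h) _.
  have -> : x * y - (x * p + m * (y - p)) = (x - m) * (y - p) by ring.
  apply: le_trans (NM _ _) _; have k1 := N_ge0 (x - m); have k2 := N_ge0 (y - p).
  apply: (@le_trans _ _ ((q x + d) * (q y + d))); first by apply: ler_pM => //; apply: ltW.
  nra.
have qi c : q (i c) <= cabs c.
  by apply: le_trans (qle _ _ I00) _; rewrite subr0.
have q1 : 1 <= q 1.
  rewrite leNgt; apply/negP => h; have h' : 0 < 1 - q 1 by lra.
  have [m Im] := qex 1 _ h'; rewrite subrKC => /N_unit[y]; exact: Iunit.
have qI x : I x -> q x = 0.
  move=> Ix; apply/eqP; rewrite eq_le q_ge0 andbT; apply: le_trans (qle _ _ Ix) _.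
  by rewrite subrr -(rmorph0 i) -(cabs0 R).
have /choice[chi Hchi] a : exists c, I (a - i c).
  have [c Hc] := spectrum_nonempty q_ge0 qD qM qi q1 a; exists c.
  apply: contrapT => /maxI[b /qI hb]; by have := Hc b; rewrite hb eqxx.
have iI c : I (i c) -> c = 0.
  move=> h; apply/eqP/negPn/negP => c0; apply: (Iunit _ (i c^-1) h).
  by rewrite -rmorphM divff // rmorph1.
have uniq a c : I (a - i c) -> chi a = c.
  move=> h; have := IB _ _ h (Hchi a).
  have -> : a - i c - (a - i (chi a)) = i (chi a - c) by rewrite rmorphB; ring.
  by move=> /iI/eqP; rewrite subr_eq0 => /eqP.
exists chi; split.
- move=> x y; apply: uniq; have := ID _ _ (Hchi x) (Hchi y).
  by rewrite rmorphD; congr I; ring.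
- move=> x y; apply: uniq; have := ID _ _ (IM y _ (Hchi x)) (IM (i (chi x)) _ (Hchi y)).
  by rewrite rmorphM; congr I; ring.
- by move=> c; apply: uniq; rewrite subrr.
(* If |chi x| > N x, then 1 - x / chi x would be invertible, although it is a multiple of x - chi x,
   which lies in I. *)
- move=> x; rewrite leNgt; apply/negP => h.
  have c0 : chi x != 0 by rewrite -cabs_gt0; apply: le_lt_trans h; apply: N_ge0.
  have : N (1 - (1 - i (chi x)^-1 * x)) < 1.
    rewrite subKr; apply: le_lt_trans (NM _ _) _.
    apply: (@le_lt_trans _ _ ((cabs (chi x))^-1 * N x)).
      by rewrite ler_wpM2r // -cabsV.
    by rewrite mulrC ltr_pdivrMr ?mul1r // cabs_gt0.
  move=> /N_unit[y]; apply: Iunit.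
  have -> : 1 - i (chi x)^-1 * x = (- i (chi x)^-1) * (x - i (chi x)).
    rewrite mulrBr mulNr mulNr opprK -rmorphM mulVf // rmorph1; ring.
  by apply: IM; apply: Hchi.
- by move=> x Ix; apply: uniq; rewrite rmorph0 subr0; apply: II.
Qed.

End Character.

(** * The corona theorem for APW+ *)

Section WienerPlus.
Variable R : realType.
Local Notation C := R[i].

Definition nonneg : set R := [set l | 0 <= l].

Lemma nonneg0 : nonneg 0. Proof. exact: lexx. Qed.

Lemma nonnegD (l m : R) : nonneg l -> nonneg m -> nonneg (l + m).
Proof. exact: addr_ge0. Qed.

Definition in_wiener : {pred R -> C} := fun f => `[< exists r, Wn nonneg f r >].

Fact in_wiener_subring : GRing.subring_closed in_wiener.
Proof.
split.
- by apply/asboolP; exists (cabs (1 : C)); apply: Wn_cst nonneg0.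
- move=> f g /asboolP[r Hf] /asboolP[r' Hg]; apply/asboolP.
  exists (r + cabs (-1 : C) * r').
  by apply: Wn_ext (WnD Hf (WnZ (-1) Hg)) => x; rewrite mulN1r.
- move=> f g /asboolP[r Hf] /asboolP[r' Hg]; apply/asboolP.
  by exists (r * r'); apply: WnM nonnegD Hf Hg.
Qed.

HB.instance Definition _ := GRing.isSubringClosed.Build (R -> C) in_wiener in_wiener_subring.

Definition wiener := {f : R -> C | f \in in_wiener}.
HB.instance Definition _ := [isSub of wiener for sval].
HB.instance Definition _ := [Choice of wiener by <:].
HB.instance Definition _ := [SubChoice_isSubComNzRing of wiener by <:].

Lemma wienerP (x : wiener) : exists r, Wn nonneg (val x) r.
Proof. by case: x => f /= /asboolP. Qed.

Lemma wiener_mk (f : R -> C) r : Wn nonneg f r -> exists x : wiener, val x = f.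
Proof.
move=> h; have hf : f \in in_wiener by apply/asboolP; exists r.
by exists (exist (fun f : R -> C => f \in in_wiener) f hf).
Qed.

Fact wiener_cst_proof (c : C) : (fun _ : R => c) \in in_wiener.
Proof. by apply/asboolP; exists (cabs c); apply: Wn_cst nonneg0. Qed.

Definition wiener_cst (c : C) : wiener := exist (fun f : R -> C => f \in in_wiener) _ (wiener_cst_proof c).

Fact wiener_cst_zmod : zmod_morphism wiener_cst.
Proof. by move=> c d; apply: val_inj. Qed.

Fact wiener_cst_monoid : monoid_morphism wiener_cst.
Proof. by split=> [|c d]; apply: val_inj. Qed.

HB.instance Definition _ := GRing.isZmodMorphism.Build C wiener wiener_cst wiener_cst_zmod.
HB.instance Definition _ := GRing.isMonoidMorphism.Build C wiener wiener_cst wiener_cst_monoid.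

Definition wnorm (x : wiener) : R := inf [set r | Wn nonneg (val x) r].

Lemma wnorm_has_inf (x : wiener) : has_inf [set r | Wn nonneg (val x) r].
Proof.
split; first by have [r h] := wienerP x; exists r.
by exists 0 => r /Wn_ge0.
Qed.

Lemma wnorm_le (x : wiener) r : Wn nonneg (val x) r -> wnorm x <= r.
Proof. by move=> h; apply: ge_inf => //; case: (wnorm_has_inf x). Qed.

Lemma wnorm_ge0 (x : wiener) : 0 <= wnorm x.
Proof. by apply: lb_le_inf; [case: (wnorm_has_inf x)|move=> r /Wn_ge0]. Qed.

Lemma wnorm_adh (x : wiener) e : 0 < e -> exists2 r, Wn nonneg (val x) r & r < wnorm x + e.
Proof. by move=> e0; have [r h1 h2] := inf_adherent e0 (wnorm_has_inf x); exists r. Qed.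

Lemma wnormD (x y : wiener) : wnorm (x + y) <= wnorm x + wnorm y.
Proof.
apply/ler_addgt0Pr => e e0; have e2 : 0 < e / 2 by lra.
have [r hr r1] := wnorm_adh x e2; have [s hs s1] := wnorm_adh y e2.
by apply: le_trans (@wnorm_le (x + y) _ (WnD hr hs)) _; lra.
Qed.

Lemma wnormM (x y : wiener) : wnorm (x * y) <= wnorm x * wnorm y.
Proof.
apply/ler_addgt0Pr => e e0; have x0 := wnorm_ge0 x; have y0 := wnorm_ge0 y.
pose d := Num.min 1 (e / (1 + wnorm x + wnorm y)).
have s0 : 0 < 1 + wnorm x + wnorm y by lra.
have d0 : 0 < d by rewrite lt_min ltr01 divr_gt0.
have d1 : d <= 1 by rewrite ge_min lexx.
have de : d * (1 + wnorm x + wnorm y) <= e by rewrite -ler_pdivlMr // ge_min lexx orbT.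
have [r hr r1] := wnorm_adh x d0; have [s hs s1] := wnorm_adh y d0.
apply: le_trans (@wnorm_le (x * y) _ (WnM nonnegD hr hs)) _.
apply: (@le_trans _ _ ((wnorm x + d) * (wnorm y + d))); last by nra.
by apply: ler_pM; rewrite ?(Wn_ge0 hr) ?(Wn_ge0 hs) // ltW.
Qed.

Lemma wnorm_cst c : wnorm (wiener_cst c) <= cabs c.
Proof. by apply: wnorm_le; apply: Wn_cst nonneg0. Qed.

Lemma wnorm_unit (x : wiener) : wnorm (1 - x) < 1 -> exists y, x * y = 1.
Proof.
move=> h; have h' : 0 < 1 - wnorm (1 - x) by lra.
have [r hr r1] := wnorm_adh (1 - x) h'; rewrite subrKC in r1.
have [nz Hn] := Wn_neumann nonneg0 nonnegD hr r1.
have [y yE] := wiener_mk Hn; exists y; apply: val_inj; apply/funext => t.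
have vE : 1 - val (1 - x) t = val x t by exact: subKr.
have := nz t; rewrite vE => xt.
change (val x t * val y t = 1); rewrite yE.
change (val x t * (1 - val (1 - x) t)^-1 = 1).
by rewrite vE divff.
Qed.

(* If no e_l(t) were close to u on L, large powers of the peak polynomial would be
   uniformly small, although their value at the character u is 1. *)
Lemma kronecker_unimodular (u : R -> C) (L : seq R) e : u 0 = 1 ->
  (forall l m, nonneg l -> nonneg m -> u (l + m) = u l * u m) ->
  (forall l, l \in L -> nonneg l /\ cabs (u l) = 1) ->
  (forall l, nonneg l -> cabs (u l) <= 1) -> 0 < e ->
  exists t, forall l, l \in L -> cabs (e_ l t - u l) <= e.
Proof.
move=> u0 uM uL u1 e0; apply: contrapT => /forallNP H.
have [P [PS P1 PB PL]] := peak_poly nonneg0 nonnegD u0 uM uL.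
pose q := 1 - e ^+ 2 / 4.
have Pq t : cabs (ev P t) ^+ 2 <= q.
  have /existsNP[l /not_implyP[lL /negP]] := H t; rewrite -ltNge => hl.
  have [Sl ul] := uL l lL; have hP := PL t l lL.
  have hp := parallelogram 1 ((u l)^* * e_ l t).
  have d : cabs (1 - (u l)^* * e_ l t) = cabs (e_ l t - u l).
    rewrite -[RHS]mul1r -ul -(cabs_conj (u l)) -cabsM mulrBr cabsBC.
    by rewrite [_^* * u l]mulrC mulr_conj ul expr1n.
  rewrite d cabsM cabs_e cabs_conj ul cabs1 in hp.
  rewrite cabsM cabsV cabs_nat in hP; have p0 := cabs_ge0 (ev P t); rewrite /q.
  have := cabs_ge0 (1 + (u l)^* * e_ l t).
  move: (cabs (1 + _)) (cabs (_ - u l)) (cabs (ev P t)) hp hP hl p0 => X B Z hp hP hl p0 X0.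
  have : Z ^+ 2 <= X ^+ 2 / 4 by nra.
  have : e ^+ 2 <= B ^+ 2 by nra.
  lra.
have q0 : 0 <= q by apply: le_trans (Pq 0); apply: sqr_ge0.
have q1 : q < 1 by rewrite /q; have : 0 < e ^+ 2 by [rewrite exprn_gt0]; lra.
have rho1 : 0 <= Num.sqrt q < 1.
  by rewrite sqrtr_ge0 /= -[X in _ < X]sqrtr1 ltr_sqrt.
have Prho t : cabs (ev P t) <= Num.sqrt q.
  by rewrite -[leLHS]ger0_norm ?cabs_ge0 // -sqrtr_sqr ler_sqrt.
have p2 : 0 < (2%:R : R)^-1 by rewrite invr_gt0.
have [m Hm] := poly_exp_small (size P) rho1 p2.
have B t : cabs (ev (pexp P m) t) <= Num.sqrt q ^+ m.
  by rewrite ev_exp cabsX; apply: lerXn2r; rewrite ?nnegrE ?cabs_ge0 ?sqrtr_ge0.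
have FS : freq_in nonneg (pexp P m) := mem_pexp nonneg0 nonnegD PS.
(* [cabs (u l) <= 1] is known for l >= 0 only, so the candidate frequencies are filtered. *)
pose L' := [seq l <- combos m [seq t.2 | t <- P] | 0 <= l].
have FL t : t \in pexp P m -> t.2 \in L'.
  by move=> tP; rewrite mem_filter pexp_combos // andbT; apply: FS.
have vL l : l \in L' -> cabs (u l) <= 1 by rewrite mem_filter => /andP[/u1].
have := pchar_bound FL vL B.
rewrite (pchar_exp m nonneg0 nonnegD u0 uM PS) P1 expr1n cabs1.
have : (size L')%:R * Num.sqrt q ^+ m <= m.+1%:R ^+ size P * Num.sqrt q ^+ m.
  rewrite ler_wpM2r ?exprn_ge0 ?sqrtr_ge0 // -natrX ler_nat size_filter.
  by apply: leq_trans (count_size _ _) _; rewrite size_combos size_map.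
lra.
Qed.

(** A nonnegative additive function is monotone; squeezing n l between consecutive integers bounds n
    |p(l) - l p(1)| independently of n. *)
Lemma additive_nonneg (p : R -> R) : (forall l m, 0 <= l -> 0 <= m -> p (l + m) = p l + p m) ->
  (forall l, 0 <= l -> 0 <= p l) -> forall l, 0 <= l -> p l = l * p 1.
Proof.
move=> pD p0 l l0.
have pN n x : 0 <= x -> p (n%:R * x) = n%:R * p x.
  move=> x0; elim: n => [|n IH].
    by have := pD 0 0 (lexx _) (lexx _); rewrite !mul0r addr0 => h; lra.
  by rewrite -natr1 !mulrDl !mul1r pD ?IH // mulr_ge0.
have pm x y : 0 <= x -> x <= y -> p x <= p y.
  by move=> x0 xy; rewrite -(subrKC x y) pD ?subr_ge0 // lerDl p0 // subr_ge0.
have p1 := p0 1 ler01.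
have key n : `|n%:R * (p l - l * p 1)| <= p 1.
  have nl : 0 <= n%:R * l by rewrite mulr_ge0.
  have /andP[k1 k2] := truncn_itv nl; set k := Num.truncn _ in k1 k2.
  have h1 : p (k%:R * 1) <= p (n%:R * l) by apply: pm; rewrite ?mulr1.
  have h2 : p (n%:R * l) <= p (k.+1%:R * 1) by apply: pm; rewrite ?mulr1 // ltW.
  rewrite !pN // in h1 h2; rewrite -natr1 in k2 h2; rewrite ler_norml; apply/andP; split; nra.
apply/eqP; rewrite -subr_eq0 -normr_le0; apply/ler_addgt0Pr => e e0; rewrite add0r.
have := key (Num.bound (p 1 / e)); rewrite normrM normr_nat => h.
have := archi_boundP (divr_ge0 p1 (ltW e0)); rewrite ltr_pdivrMr // => h2.
have n0 : 0 < (Num.bound (p 1 / e))%:R :> R by rewrite ltNge; apply/negP => h3; nra.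
by rewrite -(ler_pM2l n0); lra.
Qed.

Lemma cexp_half_plane (l t Y : R) :
  cexp ('i * l%:C * (t +i* Y)) = (expR (- (l * Y)))%:C * e_ l t :> C.
Proof.
rewrite /e_; have -> : 'i * l%:C * (t +i* Y) = (- (l * Y))%:C + 'i * (l * t)%:C :> C.
  by apply: complex_eq => /=; ring.
rewrite cexpD; congr (_ * _); rewrite /cexp /= cos0 sin0.
by apply: complex_eq => /=; ring.
Qed.

(** Either v vanishes at some l0, and then at every l > 0 since v(l)^n = v(n l) = 0 once n l >= l0,
    and a point i Y high up will do; or -ln |v| is additive and nonnegative, so |v(l)| = e^(-l y),
    and Kronecker's theorem for the unimodular v(l) e^(l y) gives the real part of z. *)
Lemma kronecker_half_plane (v : R -> C) (L : seq R) e : v 0 = 1 ->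
  (forall l m, nonneg l -> nonneg m -> v (l + m) = v l * v m) ->
  (forall l, nonneg l -> cabs (v l) <= 1) ->
  (forall l, l \in L -> nonneg l) -> 0 < e ->
  exists2 z : C, 0 < complex.Im z & forall l, l \in L -> cabs (cexp ('i * l%:C * z) - v l) <= e.
Proof.
move=> v0 vM v1 LS e0.
have vX n l : nonneg l -> v (l *+ n) = v l ^+ n.
  move=> Sl; elim: n => [|n IH]; first by rewrite mulr0n v0.
  by rewrite mulrS vM ?IH ?exprS //; apply: mulrn_wge0.
have [[l0 [Sl0 vl0]]|nz] := pselect (exists l, nonneg l /\ v l = 0).
  have vz l : 0 < l -> v l = 0.
    move=> l1; pose n := Num.bound (l0 / l).
    have hn : l0 <= l *+ n.
      by have := archi_boundP (divr_ge0 Sl0 (ltW l1)); rewrite ltr_pdivrMr // mulr_natl => /ltW.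
    have : v l ^+ n = 0.
      rewrite -vX; last exact: ltW.
      by rewrite -(subrKC l0 (l *+ n)) vM ?vl0 ?mul0r // /nonneg /= subr_ge0.
    by move=> /eqP; rewrite expf_eq0 => /andP[_ /eqP].
  have [Y Y0 HY] : exists2 Y : R, 0 < Y & forall l, l \in L -> l = 0 \/ expR (- (l * Y)) <= e.
    elim: L LS => [|l L IH] LS; first by exists 1.
    have [|Y Y0 HY] := IH; first by move=> m mL; apply: LS; rewrite inE mL orbT.
    have Sl : 0 <= l := LS l (mem_head _ _).
    have [lz|lnz] := eqVneq l 0.
      by exists Y => // m; rewrite inE => /orP[/eqP ->|/HY //]; left.
    have l1 : 0 < l by rewrite lt_def lnz.
    exists (Num.max Y (l * e)^-1) => [|m]; first by rewrite lt_max Y0.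
    rewrite inE => /orP[/eqP ->|mL].
      right; set X := l * _; have X1 : 1 <= e * X.
        rewrite /X mulrA -ler_pdivrMl ?mulr_gt0 // mulr1 [e * l]mulrC.
        by rewrite le_max lexx orbT.
      have X0 : 0 < X by rewrite /X mulr_gt0 // lt_max Y0.
      rewrite -(ler_pM2r X0); apply: le_trans X1.
      rewrite -[leRHS](expRxMexpNx_1 X) mulrC ler_wpM2r ?expR_ge0 //.
      by apply: le_trans (expR_ge1Dx X); lra.
    have [->|h] := HY m mL; [by left|right]; apply: le_trans h.
    have Sm : 0 <= m by apply: LS; rewrite inE mL orbT.
    by rewrite ler_expR lerN2 ler_wpM2l // le_max lexx.
  exists (0 +i* Y) => // l lL; rewrite cexp_half_plane e_x0 mulr1.
  have [l00|lnz] := eqVneq l 0; first by rewrite l00 v0 mul0r oppr0 expR0 subrr cabs0 ltW.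
  have l1 : 0 < l by rewrite lt_def lnz; apply: LS.
  have [l00|h] := HY l lL; first by rewrite l00 eqxx in lnz.
  by rewrite vz // subr0 cabs_real ger0_norm ?expR_ge0.
have vn l : nonneg l -> 0 < cabs (v l).
  by move=> Sl; rewrite cabs_gt0; apply/eqP => h; apply: nz; exists l.
pose p l := - ln (cabs (v l)).
have pD l m : 0 <= l -> 0 <= m -> p (l + m) = p l + p m.
  by move=> Sl Sm; rewrite /p vM // cabsM lnM ?posrE ?vn // opprD.
have p0 l : 0 <= l -> 0 <= p l by move=> Sl; rewrite oppr_ge0 ln_le0 // v1.
pose y := p 1; have y0 : 0 <= y by apply: p0; apply: ler01.
have vE l : nonneg l -> cabs (v l) = expR (- (l * y)).
  by move=> Sl; rewrite -(additive_nonneg pD p0 Sl) opprK lnK // posrE vn.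
pose u l := v l * (expR (l * y))%:C.
have uN l : nonneg l -> cabs (u l) = 1.
  move=> Sl; rewrite /u cabsM cabs_real ger0_norm ?expR_ge0 // vE // mulrC.
  exact: expRxMexpNx_1.
have u0 : u 0 = 1 by rewrite /u v0 mul0r expR0 mulr1.
have uM l m : nonneg l -> nonneg m -> u (l + m) = u l * u m.
  by move=> Sl Sm; rewrite /u vM // mulrDl expRD rmorphM; ring.
have e2 : 0 < e / 2 by lra.
have [||t Ht] := kronecker_unimodular (L := L) u0 uM _ _ e2.
- by move=> l lL; split; [apply: LS|apply/uN/LS].
- by move=> l /uN ->.
(* The ordinate y may be 0; raising it by a small k puts z inside the half-plane at a cost of at
   most e/2. *)
have [k k0 Hk] : exists2 k : R, 0 < k & forall l, l \in L -> l * k <= e / 2.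
  elim: {Ht} L LS => [|l L IH] LS; first by exists 1.
  have [|k k0 Hk] := IH; first by move=> m mL; apply: LS; rewrite inE mL orbT.
  have Sl : 0 <= l := LS l (mem_head _ _).
  have l1 : 0 < 1 + l by lra.
  exists (Num.min k (e / 2 / (1 + l))) => [|m]; first by rewrite lt_min k0 divr_gt0.
  rewrite inE => /orP[/eqP ->|mL].
    apply: (@le_trans _ _ (l * (e / 2 / (1 + l)))).
      by rewrite ler_wpM2l // ge_min lexx orbT.
    by rewrite mulrCA ler_piMr ?(ltW e2) // ler_pdivrMr //; lra.
  apply: le_trans (Hk m mL); rewrite ler_wpM2l ?ge_min ?lexx //.
  by apply: LS; rewrite inE mL orbT.
exists (t +i* (y + k)); first by rewrite /= ltr_wpDl.
move=> l lL; have Sl : 0 <= l := LS l lL; rewrite cexp_half_plane.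
have -> : v l = (expR (- (l * y)))%:C * u l.
  by rewrite /u mulrCA -rmorphM [expR (- _) * _]mulrC expRxMexpNx_1 mulr1.
rewrite mulrDr opprD expRD rmorphM -mulrA -mulrBr cabsM cabs_real ger0_norm ?expR_ge0 //.
have E1 : expR (- (l * y)) <= 1 by rewrite expR_le1 oppr_le0 mulr_ge0.
apply: (@le_trans _ _ (1 * cabs ((expR (- (l * k)))%:C * e_ l t - u l))).
  by rewrite ler_wpM2r ?cabs_ge0.
rewrite mul1r; have -> : (expR (- (l * k)))%:C * e_ l t - u l =
    (expR (- (l * k)) - 1)%:C * e_ l t + (e_ l t - u l) by rewrite rmorphB /=; ring.
apply: le_trans (cabsD _ _) _; rewrite cabsM cabs_e mulr1 cabs_real.
have lk0 : 0 <= l * k by rewrite mulr_ge0 // ltW.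
have h1 := expR_ge1Dx (- (l * k)); have h2 := Hk l lL; have h3 := Ht l lL.
have h4 : expR (- (l * k)) <= 1 by rewrite expR_le1 oppr_le0.
rewrite ler0_norm; lra.
Qed.

Definition extension (w : nat -> seq (C * R)) (z : C) : C :=
  plim w (fun l => cexp ('i * l%:C * z)).

Lemma cexp_half_plane_le (z : C) l : 0 <= complex.Im z -> nonneg l ->
  cabs (cexp ('i * l%:C * z)) <= 1.
Proof.
case: z => a b /= b0 l0; rewrite cexp_half_plane cabsM cabs_e mulr1 cabs_real.
by rewrite ger0_norm ?expR_ge0 // expR_le1 oppr_le0 mulr_ge0.
Qed.

(** [insubd 1] makes the e_l a family of elements of [wiener] indexed by all reals; at the
    nonnegative frequencies of s it is e_l itself. *)
Lemma wiener_poly (s : seq (C * R)) (F : wiener -> C) :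
  (forall x y, F (x + y) = F x + F y) -> (forall x y, F (x * y) = F x * F y) ->
  (forall c, F (wiener_cst c) = c) -> freq_in nonneg s ->
  exists x : wiener, val x = ev s /\
    F x = pchar (fun l => F (insubd 1 (fun t => e_ l t : C))) s.
Proof.
move=> FD FM Fc; elim: s => [|t s IH] hs.
  exists 0; split; first by apply/funext => x; rewrite ev_nil.
  by rewrite /pchar big_nil -(rmorph0 wiener_cst) Fc.
have [|x [xE Fx]] := IH; first by move=> u us; apply: hs; rewrite inE us orbT.
have St : nonneg t.2 by apply: hs; apply: mem_head.
pose E : wiener := insubd 1 (fun y => e_ t.2 y : C).
exists (wiener_cst t.1 * E + x); split.
  apply/funext => y; change (t.1 * val E y + val x y = ev (t :: s) y).
  rewrite xE /E val_insubd ifT; first by rewrite /ev big_cons.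
  by apply/asboolP; exists 1; apply: Wn_e.
by rewrite FD FM Fc Fx /pchar big_cons.
Qed.

Theorem corona f1 f2 w1 w2 B1 B2 (d : R) : rep nonneg f1 w1 B1 -> rep nonneg f2 w2 B2 -> 0 < d ->
  (forall z, 0 < complex.Im z -> d <= cabs (extension w1 z) + cabs (extension w2 z)) ->
  exists h1 h2 r1 r2, [/\ Wn nonneg h1 r1, Wn nonneg h2 r2 &
    forall x, f1 x * h1 x + f2 x * h2 x = 1].
Proof.
move=> H1 H2 d0 Hd; apply: contrapT => nB.
have [F1 F1E] := wiener_mk (rep_Wn H1); have [F2 F2E] := wiener_mk (rep_Wn H2).
pose I0 : set wiener := [set x | exists a b, x = F1 * a + F2 * b].
have PI : proper_ideal_set I0.
  split.
  - by exists 0, 0; rewrite !mulr0 addr0.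
  - move=> _ _ [a [b ->]] [a' [b' ->]]; exists (a + a'), (b + b'); ring.
  - move=> x _ [a [b ->]]; exists (x * a), (x * b); ring.
  - move=> [a [b E]]; apply: nB.
    have [ra ha] := wienerP a; have [rb hb] := wienerP b.
    exists (val a), (val b), ra, rb; split=> // x; rewrite -F1E -F2E.
    by have := congr1 (fun y : wiener => val y x) E => /esym.
have [chi [chiD chiM chic chiN chi0]] :=
  gelfand_character wnorm_ge0 wnormD wnormM wnorm_cst wnorm_unit PI.
pose v l := chi (insubd 1 (fun t => e_ l t : C)).
have we l : nonneg l -> val (insubd (1 : wiener) (fun t => e_ l t : C)) = (fun t => e_ l t).
  by move=> Sl; rewrite val_insubd ifT //; apply/asboolP; exists 1; apply: Wn_e.
have v0 : v 0 = 1.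
  rewrite /v -[RHS]chic; congr chi; apply: val_inj; rewrite we; last exact: nonneg0.
  by apply/funext => x; rewrite e_0.
have vM l m : nonneg l -> nonneg m -> v (l + m) = v l * v m.
  move=> Sl Sm; rewrite /v -chiM; congr chi; apply: val_inj; rewrite we; last exact: nonnegD.
  apply/funext => x; rewrite e_D.
  by change (e_ l x * e_ m x = val (insubd (1 : wiener) (fun t => e_ l t : C)) x *
    val (insubd (1 : wiener) (fun t => e_ m t : C)) x); rewrite !we.
have v1 l : nonneg l -> cabs (v l) <= 1.
  move=> Sl; apply: le_trans (chiN _) _; apply: wnorm_le; rewrite we //; exact: Wn_e.
(* At the point z found below each extension has modulus at most 3 d/8 (truncation, passage from v
   to z, value of v on the truncation), which for two functions stays below d. *)
have e0 : 0 < d / 8 by lra.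
have step f w B (F : wiener) : rep nonneg f w B -> val F = f -> chi F = 0 ->
  exists s, [/\ freq_in nonneg s, cabs (pchar v s) <= d / 8 &
    forall z, 0 < complex.Im z ->
      cabs (extension w z - pchar (fun l => cexp ('i * l%:C * z)) s) <= d / 8].
  move=> Hw FE chiF; have [hw wB _] := Hw.
  have [n Hn] := pbounded_tail wB e0; exists (psum w n); split.
  - exact: freq_in_psum.
  - have fs : freq_in nonneg (psum w n) by apply: freq_in_psum.
    have [S [SE chiS]] := wiener_poly chiD chiM chic fs.
    rewrite -/v in chiS.
    have E : chi (F - S) = - pchar v (psum w n).
      have -> : F - S = F + wiener_cst (-1) * S by rewrite rmorphN1 mulN1r.
      by rewrite chiD chiM chic mulN1r chiF add0r chiS.
    rewrite -cabsN -E; apply: le_trans (chiN _) _; apply: wnorm_le.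
    have := rep_tail Hw (Hn n (leqnn _)); apply: Wn_ext => x.
    by rewrite -SE -FE.
  - move=> z z0; apply: plim_tail hw wB _ (Hn n (leqnn _)) => l; apply: cexp_half_plane_le.
    exact: ltW.
have chi1 : chi F1 = 0 by apply: chi0; exists 1, 0; rewrite mulr1 mulr0 addr0.
have chi2 : chi F2 = 0 by apply: chi0; exists 0, 1; rewrite mulr1 mulr0 add0r.
have [s1 [S1 P1 E1]] := step _ _ _ _ H1 F1E chi1.
have [s2 [S2 P2 E2]] := step _ _ _ _ H2 F2E chi2.
pose L := [seq t.2 | t <- s1 ++ s2].
have LS l : l \in L -> nonneg l by move=> /mapP[t ts ->]; apply: (freq_in_cat S1 S2).
have n0 : 0 < 1 + nrm s1 + nrm s2 by have := nrm_ge0 s1; have := nrm_ge0 s2; lra.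
have [z z0 Hz] := kronecker_half_plane v0 vM v1 LS (divr_gt0 e0 n0).
have close s : {subset s <= s1 ++ s2} -> nrm s <= 1 + nrm s1 + nrm s2 ->
    cabs (pchar (fun l => cexp ('i * l%:C * z)) s - pchar v s) <= d / 8.
  move=> sL sn; rewrite /pchar -sumrB; apply: le_trans (cabs_sum _ _ _) _.
  apply: (@le_trans _ _ (\sum_(t <- s) cabs t.1 * (d / 8 / (1 + nrm s1 + nrm s2)))).
    rewrite big_seq [leRHS]big_seq; apply: ler_sum => t ts.
    by rewrite -mulrBr cabsM ler_wpM2l ?cabs_ge0 //; apply: Hz; apply: map_f; apply: sL.
  rewrite -mulr_suml -/(nrm s) mulrCA ler_piMr ?(ltW e0) // ler_pdivrMr // mul1r.
  exact: sn.
have c1 : cabs (pchar (fun l => cexp ('i * l%:C * z)) s1 - pchar v s1) <= d / 8.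
  by apply: close => [t ts|]; [rewrite mem_cat ts|have := nrm_ge0 s2; lra].
have c2 : cabs (pchar (fun l => cexp ('i * l%:C * z)) s2 - pchar v s2) <= d / 8.
  by apply: close => [t ts|]; [rewrite mem_cat ts orbT|have := nrm_ge0 s1; lra].
have small (X Y Z : C) : cabs (X - Y) <= d / 8 -> cabs (Y - Z) <= d / 8 -> cabs Z <= d / 8 ->
    cabs X <= 3 * (d / 8).
  move=> xy yz hz; have -> : X = (X - Y) + (Y - Z) + Z by ring.
  by apply: le_trans (cabsD _ _) _; apply: le_trans (lerD (cabsD _ _) (lexx _)) _; lra.
have := Hd z z0; have := small _ _ _ (E1 z z0) c1 P1; have := small _ _ _ (E2 z z0) c2 P2; lra.
Qed.

End WienerPlus.

Arguments nonneg {R}.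

(** * Hardy classes *)

Section Hardy.
Variable R : realType.
Local Notation C := R[i].
Local Notation mu := (@lebesgue_measure R).
Implicit Types (s : seq (C * R)) (l x y a b T : R) (f g : R -> C)
  (w : nat -> seq (C * R)) (z h : C).

Definition hexp z l : C := cexp ('i * l%:C * z).

Lemma hexp_real x l : hexp x%:C l = e_ l x.
Proof. by rewrite /hexp /e_ rmorphM mulrA. Qed.

Lemma extensionE w z : extension w z = plim w (hexp z). Proof. by []. Qed.

Lemma pchar_nrmM (S : set R) v (M : R) s : freq_in S s -> (forall l, S l -> cabs (v l) <= M) ->
  cabs (pchar v s) <= M * nrm s.
Proof.
move=> hs hv; apply: le_trans (cabs_sum _ _ _) _; rewrite /nrm mulr_sumr.
rewrite big_seq [leRHS]big_seq; apply: ler_sum => t /hs/hv h.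
by rewrite cabsM mulrC ler_wpM2r // cabs_ge0.
Qed.

Lemma expR_sqr_bound (x : R) : 0 <= x -> x ^+ 2 * expR (- x) <= 2.
Proof.
move=> x0; have := expR_ge1Dxn 1 x0; rewrite /= => h.
rewrite -ler_pdivlMr ?expR_gt0 // expRN invrK; have : 0 <= x ^+ 2 by apply: sqr_ge0.
by move: h; rewrite (_ : (2`!)%:R = 2 :> R) //; lra.
Qed.

Lemma cabs_hexp z l : cabs (hexp z l) = expR (- (l * complex.Im z)).
Proof.
case: z => a b; rewrite /hexp cexp_half_plane cabsM cabs_e mulr1 cabs_real.
by rewrite ger0_norm ?expR_ge0.
Qed.

(** The remainder is of order (l |h|)^2 e^(-l y/2), and l^2 e^(-l y/2) is bounded uniformly in l.
    This is what allows termwise differentiation of an extension. *)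
Lemma hexp_taylor z h l : 0 < complex.Im z -> cabs h <= complex.Im z / 2 -> nonneg l ->
  cabs (hexp (z + h) l - hexp z l - h * ('i * l%:C * hexp z l)) <=
  128 / complex.Im z ^+ 2 * cabs h ^+ 2.
Proof.
set y := complex.Im z => y0 hy l0.
have i1 : cabs ('i : C) = 1 by rewrite cabsE /= expr0n add0r expr1n sqrtr1.
have -> : hexp (z + h) l - hexp z l - h * ('i * l%:C * hexp z l) =
    hexp z l * (cexp ('i * l%:C * h) - 1 - 'i * l%:C * h).
  by rewrite /hexp mulrDr cexpD; ring.
have hE : cabs ('i * l%:C * h) = l * cabs h.
  by rewrite !cabsM i1 mul1r cabs_real ger0_norm.
rewrite cabsM cabs_hexp -/y; apply: le_trans (ler_wpM2l (expR_ge0 _) (cexp_taylor1 _)) _.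
rewrite hE; have h0 := cabs_ge0 h.
have e1 : expR (l * cabs h) <= expR (l * y / 2).
  by rewrite ler_expR -mulrA ler_wpM2l.
have e2 : expR (- (l * y)) * expR (l * y / 2) = expR (- (l * y / 2)).
  by rewrite -expRD; congr expR; field.
apply: (@le_trans _ _ (16 * (l * cabs h) ^+ 2 * expR (- (l * y / 2)))).
  rewrite -e2; have p0 : 0 <= 16 * (l * cabs h) ^+ 2 by rewrite mulr_ge0 // sqr_ge0.
  rewrite mulrCA; apply: ler_wpM2l => //. by rewrite ler_wpM2l ?expR_ge0.
have ly : 0 <= l * y / 2 by rewrite divr_ge0 // mulr_ge0 // ltW.
have := expR_sqr_bound ly; set E := expR _ => hb.
have -> : 16 * (l * cabs h) ^+ 2 * E = 64 / y ^+ 2 * cabs h ^+ 2 * ((l * y / 2) ^+ 2 * E).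
  by field; rewrite gt_eqF.
apply: (@le_trans _ _ (64 / y ^+ 2 * cabs h ^+ 2 * 2)).
  by rewrite ler_wpM2l // mulr_ge0 ?sqr_ge0 // divr_ge0 // sqr_ge0.
by rewrite le_eqVlt; apply/orP; left; apply/eqP; ring.
Qed.

Lemma hexp_le z l : 0 <= complex.Im z -> nonneg l -> cabs (hexp z l) <= 1.
Proof. exact: cexp_half_plane_le. Qed.

Lemma extension_cderiv w B z : (forall k, freq_in (@nonneg R) (w k)) -> pbounded w B ->
  0 < complex.Im z -> exists d, cderiv (extension w) z d.
Proof.
move=> hw wB y0; set y := complex.Im z in y0 *.
(* The factor y normalizes the derivative i l e^(ilz): since l y <= e^(l y), the modulus is at most
   1 and [plim] applies. *)
pose v l := y%:C * ('i * l%:C * hexp z l).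
have v1 l : nonneg l -> cabs (v l) <= 1.
  move=> l0; rewrite /v cabsM cabs_real (gtr0_norm y0) [cabs ('i * _ * _)]cabsM [cabs ('i * _)]cabsM cabs_hexp -/y.
  rewrite [cabs 'i]cabsE /= expr0n add0r expr1n sqrtr1 mul1r cabs_real ger0_norm // mulrA.
  rewrite [y * l]mulrC -[leRHS](expRxMexpNx_1 (l * y)) ler_wpM2r ?expR_ge0 //.
  by have := expR_ge1Dx (l * y); lra.
have B0 : 0 <= B by have := wB 0%N; rewrite /nrm big_nil.
exists (y%:C^-1 * plim w v) => e e0.
pose K := 128 / y ^+ 2 * B.
have K0 : 0 <= K by rewrite mulr_ge0 // divr_ge0 // sqr_ge0.
exists (Num.min (y / 2) (e / (1 + K))) => [|h].
  by rewrite lt_min !divr_gt0 // ltr_wpDr.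
rewrite lt_min => /andP[h1]; rewrite ltr_pdivlMr ?ltr_wpDr // => h2.
have h0 := cabs_ge0 h.
apply: (@le_trans _ _ (K * cabs h ^+ 2)); last first.
  by rewrite expr2 mulrA ler_wpM2r //; lra.
have Imh : 0 <= complex.Im (z + h).
  have := cabs_Im h; rewrite ler_norml cImD -/y; lra.
apply/ler_addgt0Pr => e' e'0.
have q0 : 0 < e' / (2 + cabs h / y) by rewrite divr_gt0 // ltr_wpDr // divr_ge0 // ltW.
have [N1 H1] := plimP hw wB (fun l => hexp_le Imh (l := l)) q0.
have [N2 H2] := plimP hw wB (fun l => hexp_le (ltW y0) (l := l)) q0.
have [N3 H3] := plimP hw wB v1 q0.
pose n := maxn N1 (maxn N2 N3).
have {}H1 := H1 n (leq_maxl _ _).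
have {}H2 := H2 n (leq_trans (leq_maxl _ _) (leq_maxr _ _)).
have {}H3 := H3 n (leq_trans (leq_maxr _ _) (leq_maxr _ _)).
rewrite -!extensionE in H1 H2.
set q := e' / _ in H1 H2 H3.
set s := psum w n in H1 H2 H3.
have fs : freq_in (@nonneg R) s by apply: freq_in_psum.
pose v3 l := hexp (z + h) l - hexp z l - h * ('i * l%:C * hexp z l).
have H4 : cabs (pchar v3 s) <= K * cabs h ^+ 2.
  have := pchar_nrmM fs (fun l => hexp_taylor y0 (ltW h1) (l := l)).
  rewrite -/y => /le_trans; apply; rewrite /K [leRHS]mulrAC ler_wpM2l //; last exact: wB.
  by rewrite mulr_ge0 ?sqr_ge0 // divr_ge0 // sqr_ge0.
have E : pchar v3 s = pchar (hexp (z + h)) s - pchar (hexp z) s - h * (y%:C^-1 * pchar v s).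
  rewrite /pchar !mulr_sumr -!sumrB; apply: eq_bigr => t _; rewrite /v3 /v.
  have yn : y%:C != 0 :> C by rewrite -cabs_gt0 cabs_real normr_gt0 gt_eqF.
  by field.
have -> : extension w (z + h) - extension w z - y%:C^-1 * plim w v * h =
   pchar v3 s - ((pchar (hexp (z + h)) s - extension w (z + h)) - (pchar (hexp z) s - extension w z)
   - h * y%:C^-1 * (pchar v s - plim w v)) by rewrite E; ring.
apply: le_trans (cabsB _ _) _; apply: lerD => //.
apply: le_trans (cabsB _ _) _; apply: le_trans (lerD (cabsB _ _) (lexx _)) _.
rewrite !cabsM cabsV cabs_real (gtr0_norm y0).
apply: (@le_trans _ _ (q + q + cabs h / y * q)).
  by apply: lerD; [apply: lerD|apply: ler_wpM2l => //; rewrite divr_ge0 // ltW].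
rewrite /q le_eqVlt; apply/orP; left; apply/eqP; field.
by rewrite !gt_eqF // ltr_wpDr // ?mulr_gt0 //; lra.
Qed.

Lemma pchar_hexp_cderiv s z : exists d, cderiv (fun z => pchar (hexp z) s) z d.
Proof.
elim: s => [|t s [d Hd]].
  exists 0; rewrite (_ : (fun z => _) = fun=> 0); last by apply/funext => x; rewrite /pchar big_nil.
  exact: cderiv_const.
have h := cderivZ t.1 (cderiv_exp_lin (cderivZ ('i * t.2%:C) (cderiv_id z))).
eexists; have := cderivD h Hd.
rewrite (_ : (fun z => _ + _) = (fun z => pchar (hexp z) (t :: s))) => [H|]; first exact: H.
by apply/funext => u; rewrite /pchar big_cons.
Qed.

Lemma extension_boundary f w B : rep (@nonneg R) f w B -> forall x e, 0 < e ->
  exists2 r, 0 < r & forall z, 0 < complex.Im z -> cabs (z - x%:C) < r ->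
    cabs (extension w z - f x) <= e.
Proof.
move=> [hw wB fE] x e e0; have e3 : 0 < e / 3 by lra.
have [n Hn] := pbounded_tail wB e3; have {}Hn := Hn n (leqnn n).
have [d Hd] := pchar_hexp_cderiv (psum w n) x%:C.
have [r r0 Hr] := cderiv_cont Hd e3; exists r => // z z0 /Hr.
rewrite subrKC (_ : pchar (hexp x%:C) _ = ev (psum w n) x); last first.
  by apply: eq_bigr => t _; rewrite hexp_real.
move=> h2; have h1 := plim_tail hw wB (fun l => hexp_le (ltW z0) (l := l)) Hn.
have h3 := plim_tail hw wB (cabs_e_le x (S := @nonneg R)) Hn.
rewrite -extensionE in h1; rewrite -fE -evE in h3.
have -> : extension w z - f x = (extension w z - pchar (hexp z) (psum w n)) +
   (pchar (hexp z) (psum w n) - ev (psum w n) x) - (f x - ev (psum w n) x) by ring.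
by apply: le_trans (cabsB _ _) _; apply: le_trans (lerD (cabsD _ _) (lexx _)) _; lra.
Qed.

Lemma extension_bound w B z : (forall k, freq_in (@nonneg R) (w k)) -> pbounded w B ->
  0 < complex.Im z -> cabs (extension w z) <= B.
Proof. by move=> hw wB z0; apply: plim_bound hw wB (fun l => hexp_le (ltW z0) (l := l)). Qed.

Lemma extension_hardy f w B : rep (@nonneg R) f w B ->
  bounded_analytic (@Cplus R) (extension w) /\ boundary_value (@Cplus R) (extension w) f.
Proof.
move=> H; have [hw wB fE] := H; split.
  split; last by exists B => z; apply: extension_bound.
  by move=> z z0; apply/cderiv_derivable; apply: extension_cderiv wB z0.
apply: aeW => x a a0; apply/cvgCP => e e0.
have [r r0 Hr] := extension_boundary H x e0.
by rewrite near_withinE; apply/nbhsCP; exists r => // z zr [z0 _]; apply: Hr.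
Qed.

Lemma boundary_value_vertical (F : C -> C) f : boundary_value (@Cplus R) F f ->
  {ae mu, forall x, forall e, 0 < e ->
    exists2 r, 0 < r & forall y, 0 < y < r -> cabs (F (x +i* y) - f x) <= e}.
Proof.
apply: (@filterS _ _ (ae_filter_ringOfSetsType mu)) => x /(_ 1 ltr01)/cvgCP H e /H.
rewrite near_withinE => /nbhsCP[r r0 Hr]; exists r => // y /andP[y0 yr].
have i1 : cabs ('i : C) = 1 by rewrite cabsE /= expr0n add0r expr1n sqrtr1.
apply: Hr.
  have -> : (x +i* y) - x%:C = 'i * y%:C by apply: complex_eq => /=; ring.
  by rewrite cabsM i1 mul1r cabs_real gtr0_norm.
by split=> //=; rewrite subrr normr0 mul1r gtr0_norm.
Qed.

Lemma hardy_uniqueness (F : C -> C) f w B : bounded_analytic (@Cplus R) F ->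
  boundary_value (@Cplus R) F f -> rep (@nonneg R) f w B ->
  forall z, 0 < complex.Im z -> F z = extension w z.
Proof.
move=> [Fd [M FM]] /boundary_value_vertical Fb Hw z z0.
have [hw wB fE] := Hw.
apply/eqP; rewrite -subr_eq0 -mulN1r; apply/eqP.
apply: (@boundary_uniqueness _ (fun z => F z + (-1) * extension w z) (M + B)) => //.
- move=> u u0; have [d1 h1] := (cderiv_derivable _ _).1 (Fd u u0).
  by have [d2 h2] := extension_cderiv hw wB u0; eexists; apply: cderivD h1 (cderivZ _ h2).
- move=> u u0; apply: le_trans (cabsD _ _) _; rewrite mulN1r cabsN.
  by apply: lerD; [apply: FM|apply: extension_bound].
- move: Fb; apply: (@filterS _ _ (ae_filter_ringOfSetsType mu)) => x Hx e e0.
  have e2 : 0 < e / 2 by lra.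
  have [r r0 Hr] := Hx _ e2; have [t t0 Ht] := extension_boundary Hw x e2.
  exists (Num.min r t) => [|y /andP[y0]]; first by rewrite lt_min r0.
  rewrite lt_min => /andP[yr yt].
  have h1 : cabs (F (x +i* y) - f x) <= e / 2 by apply: Hr; rewrite y0.
  have h2 : cabs (extension w (x +i* y) - f x) <= e / 2.
    apply: Ht => //; have -> : (x +i* y) - x%:C = 'i * y%:C by apply: complex_eq => /=; ring.
    rewrite cabsM [cabs 'i]cabsE /= expr0n add0r expr1n sqrtr1 mul1r.
    by rewrite cabs_real gtr0_norm.
  have -> : F (x +i* y) + -1 * extension w (x +i* y) =
    (F (x +i* y) - f x) - (extension w (x +i* y) - f x) by ring.
  by apply: le_trans (cabsB _ _) _; lra.
Qed.

End Hardy.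

(** * Corona vectors and Bezout equations *)

Section CoronaPairs.
Variable R : realType.
Local Notation C := R[i].
Local Notation mu := (@lebesgue_measure R).
Implicit Types (s : seq (C * R)) (l x y a b T : R) (f g : R -> C)
  (w : nat -> seq (C * R)) (z h : C) (F : C -> C).
Local Notation Cplus := (@Cplus R).
Local Notation Cminus := (@Cminus R).

Lemma hexp_cderiv l z : exists d, cderiv (fun z => hexp z l) z d.
Proof.
eexists; exact: (cderiv_exp_lin (cderivZ ('i * l%:C) (cderiv_id z))).
Qed.

Lemma hexp_mul_hardy F g l : 0 <= l -> bounded_analytic Cplus F -> boundary_value Cplus F g ->
  bounded_analytic Cplus (fun z => hexp z l * F z) /\
  boundary_value Cplus (fun z => hexp z l * F z) (fun x => e_ l x * g x).
Proof.
move=> l0 [Fd [M FM]] Fb; split.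
  split; last first.
    exists M => z z0; rewrite cabsM; apply: le_trans (FM z z0).
    by rewrite ler_piMl ?cabs_ge0 // hexp_le // ltW.
  move=> z z0; apply/cderiv_derivable.
  have [d1 h1] := (cderiv_derivable _ _).1 (Fd z z0); have [d2 h2] := hexp_cderiv l z.
  by eexists; apply: cderivM h2 h1.
move: Fb; apply: (@filterS _ _ (ae_filter_ringOfSetsType mu)) => x Fx a a0.
apply/cvgCP => e e0; have e2 : 0 < e / 2 by lra.
have g0 : 0 < 1 + cabs (g x) by rewrite ltr_wpDr // cabs_ge0.
have [d hd] := hexp_cderiv l x%:C.
have [r r0 Hr] := cderiv_cont hd (divr_gt0 e2 g0).
have /cvgCP/(_ _ e2) := Fx a a0; rewrite !near_withinE => /nbhsCP[t t0 Ht].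
apply/nbhsCP; exists (Num.min r t) => [|z]; first by rewrite lt_min r0.
rewrite lt_min => /andP[/Hr h1 /Ht h2] zs; have {}h2 := h2 zs; move: h1.
rewrite subrKC hexp_real => h1; have [z0 _] := zs.
have -> : hexp z l * F z - e_ l x * g x = hexp z l * (F z - g x) + (hexp z l - e_ l x) * g x by ring.
apply: le_trans (cabsD _ _) _.
rewrite [cabs (_ * (F z - _))]cabsM [cabs ((_ - _) * _)]cabsM.
have k1 : cabs (hexp z l) <= 1 by rewrite hexp_le // ltW.
have k2 : cabs (hexp z l) * cabs (F z - g x) <= e / 2.
  by apply: le_trans h2; rewrite ler_piMl ?cabs_ge0.
have k3 : cabs (hexp z l - e_ l x) * cabs (g x) <= e / 2.
  move: h1; rewrite ler_pdivlMr //; have := cabs_ge0 (hexp z l - e_ l x).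
  have := cabs_ge0 (g x); nra.
lra.
Qed.

(** Clear termwise for truncations; it passes to the limit because coefficients are continuous for
    the sup norm. *)
Lemma bohr_coef_extension f w B l y : rep nonneg f w B -> 0 <= l -> 0 < y ->
  AP (fun x => extension w (x +i* y)) /\
  bohr_coef (fun x => extension w (x +i* y)) l = (expR (- (l * y)))%:C * bohr_coef f l.
Proof.
move=> Hw l0 y0; have [hw wB fE] := Hw; have Wf := rep_Wn Hw.
pose low s := [seq ((expR (- (t.2 * y)))%:C * t.1, t.2) | t <- s] : seq (C * R).
have lowE s x : ev (low s) x = pchar (hexp (x +i* y)) s.
  rewrite /ev big_map /pchar; apply: eq_bigr => t _ /=.
  by rewrite /hexp cexp_half_plane; ring.
have lowc s m : coef (low s) m = (expR (- (m * y)))%:C * coef s m.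
  rewrite /coef big_map /= mulr_sumr; apply: eq_bigr => t /eqP ->; by [].
have tail e : 0 < e -> exists n, (forall x, cabs (f x - ev (psum w n) x) <= e) /\
    (forall x, cabs (extension w (x +i* y) - ev (low (psum w n)) x) <= e).
  move=> e0; have [n Hn] := pbounded_tail wB e0; exists n; split=> x.
    by rewrite fE; apply: plim_tail hw wB (cabs_e_le x (S := nonneg)) (Hn n (leqnn n)).
  rewrite lowE; apply: plim_tail hw wB _ (Hn n (leqnn n)) => m; apply: hexp_le.
  exact: ltW.
have Ae : AP (fun x => extension w (x +i* y)).
  by apply/APP => e /tail[n [_ h]]; exists (low (psum w n)).
split=> //.
apply/eqP; rewrite -subr_eq0 -cabs_eq0 eq_le cabs_ge0 andbT.
apply/ler_addgt0Pr => e e0; rewrite add0r; have e2 : 0 < e / 2 by lra.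
have [n [h1 h2]] := tail _ e2.
have k1 := bohr_coef_dist l (Wn_AP Wf) (AP_ev _) h1.
have k2 := bohr_coef_dist l Ae (AP_ev _) h2.
rewrite bohr_coef_ev in k1; rewrite bohr_coef_ev lowc in k2.
set E := expR _ in k2 *; have E1 : E <= 1 by rewrite expR_le1 oppr_le0 mulr_ge0 // ltW.
have E0 : 0 <= E by apply: expR_ge0.
set A := bohr_coef (fun _ => _) l in k2 *; set P := coef _ l in k1 k2.
have -> : A - E%:C * bohr_coef f l = (A - E%:C * P) - E%:C * (bohr_coef f l - P) by ring.
apply: le_trans (cabsB _ _) _; rewrite [cabs (E%:C * _)]cabsM cabs_real ger0_norm //.
have := cabs_ge0 (bohr_coef f l - P); nra.
Qed.

(** By uniqueness the extension of f is e^(i dt z) F, of modulus at most M e^(-dt y) at height y,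
    while its l-th coefficient there is e^(-l y) times that of f. So the coefficient of f is at most
    M e^(-(dt - l) y) for every y > 0. *)
Lemma hardy_spectrum F f w B dt l : rep nonneg f w B -> 0 <= dt -> bounded_analytic Cplus F ->
  boundary_value Cplus F (fun x => e_ (- dt) x * f x) -> l < dt -> bohr_coef f l = 0.
Proof.
move=> Hw dt0 FA FB ldt; have [l0|l0] := leP 0 l; last first.
  by apply: (Wn_coef (rep_Wn Hw)); rewrite /nonneg /= leNgt l0.
have [_ [M FM]] := FA.
have [HA HB] := hexp_mul_hardy dt0 FA FB.
have fE : (fun u => e_ dt u * (e_ (- dt) u * f u)) = f.
  by apply/funext => u; rewrite mulrA e_KN mul1r.
rewrite fE in HB.
have E (y : R) x : 0 < y -> extension w (x +i* y) = hexp (x +i* y) dt * F (x +i* y).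
  move=> y0; apply/esym; exact: (hardy_uniqueness HA HB Hw).
have bound y : 0 < y -> cabs (bohr_coef f l) <= M * expR (- ((dt - l) * y)).
  move=> y0; have [Ae Ec] := bohr_coef_extension Hw l0 y0.
  have sup x : cabs (extension w (x +i* y)) <= expR (- (dt * y)) * M.
    rewrite E // [cabs (_ * F _)]cabsM cabs_hexp /= ler_wpM2l ?expR_ge0 //.
    exact: FM.
  have := bohr_coef_bound l Ae sup; rewrite Ec cabsM cabs_real ger0_norm ?expR_ge0 // => h.
  rewrite -(ler_pM2l (expR_gt0 (- (l * y)))); apply: le_trans h _.
  by rewrite mulrCA -expRD mulrC le_eqVlt; apply/orP; left; apply/eqP; congr (_ * expR _); ring.
apply/eqP; rewrite -cabs_eq0 eq_le cabs_ge0 andbT; apply/ler_addgt0Pr => e e0; rewrite add0r.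
have M0 : 0 <= M by apply: le_trans (FM 'i _); [apply: cabs_ge0|exact: ltr01].
have d0 : 0 < dt - l by rewrite subr_gt0.
have X0 : 0 < M / e + 1 by rewrite ltr_wpDl // divr_ge0 // ltW.
apply: le_trans (bound ((M / e + 1) / (dt - l)) _) _; first by rewrite divr_gt0.
have -> : (dt - l) * ((M / e + 1) / (dt - l)) = M / e + 1 by rewrite mulrC divfK // gt_eqF.
rewrite expRN ler_pdivrMr ?expR_gt0 // mulrC -ler_pdivrMr //.
by apply: le_trans (expR_ge1Dx _); lra.
Qed.

(** The Bezout identity extends to the half-plane by boundary uniqueness, and there it bounds |v1| +
    |v2| below by 1 / (1 + B3 + B4). *)
Lemma CP_bezout (v : R -> 'cV[C]_2) (h1 h2 : R -> C) r1 r2 r3 r4 :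
  Wn nonneg (fun x => v x 0 0) r1 -> Wn nonneg (fun x => v x 1 0) r2 ->
  Wn nonneg h1 r3 -> Wn nonneg h2 r4 ->
  (forall x, v x 0 0 * h1 x + v x 1 0 * h2 x = 1) -> CP Cplus v.
Proof.
move=> W1 W2 W3 W4 E.
have mk f r : Wn nonneg f r -> exists w B, rep nonneg f w B.
  by move=> /Wn_APW[h k]; apply: APW_rep.
have [w1 [B1 H1]] := mk _ _ W1; have [w2 [B2 H2]] := mk _ _ W2.
have [w3 [B3 H3]] := mk _ _ W3; have [w4 [B4 H4]] := mk _ _ W4.
have [hw1 b1 _] := H1; have [hw2 b2 _] := H2; have [hw3 b3 _] := H3; have [hw4 b4 _] := H4.
pose Fs (j : 'I_2) := if j == 0 then extension w1 else extension w2.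
exists Fs; split.
  move=> j; rewrite /Fs; have [->|j0] := eqVneq j 0; first exact: extension_hardy H1.
  have -> : j = 1 by case: j j0 => [[|[|//]] jl] //= _; apply: val_inj.
  exact: extension_hardy H2.
have B30 : 0 <= B3 by have := b3 0%N; rewrite /nrm big_nil.
have B40 : 0 <= B4 by have := b4 0%N; rewrite /nrm big_nil.
have key z : 0 < complex.Im z ->
    extension w1 z * extension w3 z + extension w2 z * extension w4 z = 1.
  move=> z0; apply/eqP; rewrite -subr_eq0; apply/eqP.
  have ec w B u : (forall k, freq_in nonneg (w k)) -> pbounded w B -> 0 < complex.Im u ->
      exists d, cderiv (extension w) u d by move=> hw; apply: extension_cderiv.
  apply: (@boundary_uniqueness _ (fun z => extension w1 z * extension w3 z +
    extension w2 z * extension w4 z + (-1)) (B1 * B3 + B2 * B4 + 1)) => //.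
  - move=> u u0; have [d1 e1] := ec _ _ _ hw1 b1 u0; have [d2 e2] := ec _ _ _ hw2 b2 u0.
    have [d3 e3] := ec _ _ _ hw3 b3 u0; have [d4 e4] := ec _ _ _ hw4 b4 u0.
    eexists; apply: cderivD (cderivD (cderivM e1 e3) (cderivM e2 e4)) (cderiv_const (-1) u).
  - move=> u u0; apply: le_trans (cabsD _ _) _; rewrite cabsN cabs1 lerD2r.
    apply: le_trans (cabsD _ _) _; rewrite !cabsM.
    by apply: lerD; apply: ler_pM; rewrite ?cabs_ge0 //;
      [apply: extension_bound hw1 b1 u0|apply: extension_bound hw3 b3 u0|
       apply: extension_bound hw2 b2 u0|apply: extension_bound hw4 b4 u0].
  - apply: aeW => x e e0.
    pose D := 1 + B1 + B2 + cabs (h1 x) + cabs (h2 x).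
    have B10 : 0 <= B1 by have := b1 0%N; rewrite /nrm big_nil.
    have B20 : 0 <= B2 by have := b2 0%N; rewrite /nrm big_nil.
    have c1 := cabs_ge0 (h1 x); have c2 := cabs_ge0 (h2 x).
    have D0 : 0 < D by rewrite /D; lra.
    have eD := divr_gt0 e0 D0.
    have [r1' p1 q1] := extension_boundary H1 x eD; have [r2' p2 q2] := extension_boundary H2 x eD.
    have [r3' p3 q3] := extension_boundary H3 x eD; have [r4' p4 q4] := extension_boundary H4 x eD.
    exists (Num.min (Num.min r1' r2') (Num.min r3' r4')) => [|y /andP[y0]].
      by rewrite !lt_min p1 p2 p3 p4.
    rewrite !lt_min => /andP[/andP[y1 y2] /andP[y3 y4]].
    have cy : cabs ((x +i* y) - x%:C) = y.
      have -> : (x +i* y) - x%:C = 'i * y%:C by apply: complex_eq => /=; ring.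
      rewrite cabsM [cabs 'i]cabsE /= expr0n add0r expr1n sqrtr1 mul1r.
      by rewrite cabs_real gtr0_norm.
    have {}q1 := q1 (x +i* y) y0; rewrite cy in q1; have {}q1 := q1 y1.
    have {}q2 := q2 (x +i* y) y0; rewrite cy in q2; have {}q2 := q2 y2.
    have {}q3 := q3 (x +i* y) y0; rewrite cy in q3; have {}q3 := q3 y3.
    have {}q4 := q4 (x +i* y) y0; rewrite cy in q4; have {}q4 := q4 y4.
    have y0' : 0 < complex.Im (x +i* y) by [].
    have k1 := extension_bound hw1 b1 y0'; have k2 := extension_bound hw2 b2 y0'.
    set X1 := extension w1 _ in q1 k1 *; set X2 := extension w2 _ in q2 k2 *.
    set X3 := extension w3 _ in q3 *; set X4 := extension w4 _ in q4 *.
    have -> : X1 * X3 + X2 * X4 + -1 = (X1 * (X3 - h1 x) + (X1 - v x 0 0) * h1 x) +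
        (X2 * (X4 - h2 x) + (X2 - v x 1 0) * h2 x) by rewrite -[X in _ - X](E x); ring.
    have bd (P Q H : C) K : cabs P <= K -> 0 <= K -> cabs Q <= e / D -> cabs H <= e / D ->
        forall k : C, cabs (P * Q + H * k) <= (K + cabs k) * (e / D).
      move=> PK K0 Qe He k; apply: le_trans (cabsD _ _) _; rewrite !cabsM mulrDl.
      by apply: lerD; [apply: ler_pM; rewrite ?cabs_ge0|rewrite mulrC ler_wpM2l ?cabs_ge0].
    apply: le_trans (cabsD _ _) _.
    apply: le_trans (lerD (bd _ _ _ _ k1 B10 q3 q1 _) (bd _ _ _ _ k2 B20 q4 q2 _)) _.
    rewrite -mulrDl mulrCA ler_piMr ?(ltW e0) // ler_pdivrMr // /D; lra.
have K0 : 0 < 1 + B3 + B4 by lra.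
apply: (@lt_le_trans _ _ (1 + B3 + B4)^-1); first by rewrite invr_gt0.
apply: lb_le_inf; first by exists (cabs (Fs 0 'i) + cabs (Fs 1 'i)); exists 'i => //=; exact: ltr01.
move=> _ [z z0 <-]; rewrite /Fs /= -[leLHS]div1r ler_pdivrMr //.
rewrite -[leLHS](cabs1 R) -[X in cabs X <= _](key z z0); apply: le_trans (cabsD _ _) _; rewrite !cabsM.
have := extension_bound hw3 b3 z0; have := extension_bound hw4 b4 z0.
have := cabs_ge0 (extension w1 z); have := cabs_ge0 (extension w2 z).
move: (cabs (extension w1 z)) (cabs (extension w2 z)) (cabs (extension w3 z)) (cabs (extension w4 z)).
move=> X1 X2 X3 X4 x20 x10 h4 h3.
have : X1 * X3 <= X1 * B3 by rewrite ler_wpM2l.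
have : X2 * X4 <= X2 * B4 by rewrite ler_wpM2l.
have : 0 <= X1 * B4 by rewrite mulr_ge0.
have : 0 <= X2 * B3 by rewrite mulr_ge0.
lra.
Qed.

(** A priori the shifted vector is only in APW; its bounded analytic extensions force its spectrum
    into [0, +oo[. These extensions are then the exponential series, to which the corona theorem
    applies. *)
Lemma bezout_CP (psi : R -> 'cV[C]_2) (dt : R) r1 r2 : Wn nonneg (fun x => psi x 0 0) r1 ->
  Wn nonneg (fun x => psi x 1 0) r2 -> 0 <= dt -> CP Cplus (tilde dt psi) ->
  exists (h1 h2 : R -> C) r3 r4 r5 r6, [/\ Wn nonneg (fun x => tilde dt psi x 0 0) r3,
    Wn nonneg (fun x => tilde dt psi x 1 0) r4, Wn nonneg h1 r5, Wn nonneg h2 r6 &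
    forall x, tilde dt psi x 0 0 * h1 x + tilde dt psi x 1 0 * h2 x = 1].
Proof.
move=> W1 W2 dt0 [F [HF infF]].
have reg j r : Wn nonneg (fun x => psi x j 0) r -> exists r' w B,
    [/\ Wn nonneg (fun x => tilde dt psi x j 0) r', rep nonneg (fun x => tilde dt psi x j 0) w B &
     forall z, 0 < complex.Im z -> F j z = extension w z].
  move=> Wj; have [FA FB] := HF j.
  have tE : (fun x => tilde dt psi x j 0) = (fun x => e_ (- dt) x * psi x j 0).
    by apply/funext => x; rewrite /tilde mxE.
  rewrite tE in FB *; have [w [B Hw]] := APW_rep (Wn_APW Wj).1 (Wn_APW Wj).2.
  have Wt : Wn setT (fun x => e_ (- dt) x * psi x j 0) (1 * r).
    by apply: (@WnM _ setT) => //; [apply: Wn_e|apply: Wn_weaken Wj].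
  have St : bohr_spectrum (fun x => e_ (- dt) x * psi x j 0) `<=` nonneg.
    move=> l; rewrite /bohr_spectrum /nonneg /= bohr_coef_e; last exact: Wn_AP Wj.
    rewrite opprK; have [//|l0] := leP 0 l; move=> /eqP; case.
    by apply: hardy_spectrum Hw dt0 FA FB _; rewrite gtrDr.
  have [r' Hr'] := (APW_WnP nonneg _).1 (conj (Wn_APW Wt).1 St).
  have [w' [B' Hw']] := APW_rep (Wn_APW Wt).1 St.
  exists r', w', B'; split=> // z z0; exact: hardy_uniqueness FA FB Hw' z z0.
have [r3 [w1 [B1 [T1 R1 E1]]]] := reg 0 _ W1.
have [r4 [w2 [B2 [T2 R2 E2]]]] := reg 1 _ W2.
have [|h1 [h2 [r5 [r6 [k1 k2 k3]]]]] := corona R1 R2 infF.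
  move=> z z0; rewrite -E1 // -E2 //; apply: ge_inf; last by exists z.
  by exists 0 => _ [u _ <-]; rewrite addr_ge0 ?cabs_ge0.
by exists h1, h2, r3, r4, r5, r6.
Qed.

(** Through the reflection F -> conj(F(conj z)), results for the upper half-plane serve for the
    lower one. *)
Lemma CP_conj (U V : set C) (v : R -> 'cV[C]_2) : (forall z, V z <-> U (z^*)) ->
  CP U v -> CP V (fun x => map_mx (@conjc R) (v x)).
Proof.
move=> UV [F [HF infF]]; exists (fun j z => (F j (z^*))^*); split.
  move=> j; have [[Fd [M FM]] Fb] := HF j; split.
    split; last by exists M => z /UV; rewrite cabs_conj; apply: FM.
    move=> z /UV/Fd/cderiv_derivable[d Hd]; apply/cderiv_derivable.
    by exists (d^*); apply: cderiv_conj.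
  move: Fb; apply: (@filterS _ _ (ae_filter_ringOfSetsType mu)) => x Fx a a0.
  apply/cvgCP => e e0; have /cvgCP/(_ _ e0) := Fx a a0.
  rewrite !near_withinE => /nbhsCP[r r0 Hr]; apply/nbhsCP; exists r => // z zr [/UV Vz zs].
  rewrite mxE (_ : _ - _ = (F j z^* - v x j 0)^*); last by rewrite rmorphB.
  rewrite cabs_conj; apply: Hr.
    by rewrite -cabs_conj (_ : (z^* - x%:C)^* = z - x%:C) // rmorphB /= conjcK oppr0.
  by split=> //; case: (z) zs => p q /=; rewrite normrN.
rewrite (_ : [set _ | _ in V] = [set cabs (F 0 z) + cabs (F 1 z) | z in U]) //.
apply/seteqP; split=> _ [z zV <-].
  by exists (z^*); [apply/UV|rewrite !cabs_conj].
by exists (z^*); [apply/UV; rewrite conjcK|rewrite !cabs_conj conjcK].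
Qed.

End CoronaPairs.

(** * Factorization *)

Section WienerClass.
Variable R : realType.
Local Notation C := R[i].
Implicit Types (s : seq (C * R)) (l x d : R) (f g : R -> C) (S : set R).

Definition inW S f : Prop := exists r, Wn S f r.
Definition nonpos : set R := [set l | l <= 0].

Lemma APWpE : @APWp R = inW nonneg.
Proof. by apply/funext => f; apply/propext; apply: APWpP. Qed.

Lemma APWmE : @APWm R = inW nonpos.
Proof. by apply/funext => f; apply/propext; apply: APWmP. Qed.

Lemma APWE : @APW R = inW setT.
Proof. by apply/funext => f; apply/propext; apply: APWP. Qed.

Lemma inW_AP S f : inW S f -> AP f.
Proof. by case=> r /Wn_AP. Qed.

Lemma inW_ext S f g : (forall x, f x = g x) -> inW S f -> inW S g.
Proof. by move=> /funext ->. Qed.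

Lemma inWP S f : inW S f <-> inW setT f /\ forall l, ~ S l -> bohr_coef f l = 0.
Proof.
split=> [[r H]|[[r H] h]].
  by split=> [|l]; [exists r; apply: Wn_weaken H|apply: Wn_coef H].
apply/APW_WnP; split; first exact: (Wn_APW H).1.
by move=> l /eqP hl; apply: contrapT => /h.
Qed.

Lemma inW_weaken S S' f : (forall l, S l -> S' l) -> inW S f -> inW S' f.
Proof. by move=> SS [r H]; exists r; apply: Wn_weaken H. Qed.

Lemma inW_eq0 S S' f : inW S f -> inW S' f -> (forall l, S l -> ~ S' l) -> forall x, f x = 0.
Proof.
move=> /inWP[[r H] h] /inWP[_ h'] SS'; apply: bohr_uniqueness; first exact: Wn_AP H.
by move=> l; have [/SS'/h'|/h] := pselect (S l).
Qed.

Lemma inW_shift S f d : inW S f -> inW (fun l => S (l - d)) (fun x => e_ d x * f x).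
Proof.
move=> H; have Af := inW_AP H; have /inWP[[r Hf] h] := H; apply/inWP; split.
  by exists (1 * r); apply: (WnM (fun _ _ _ _ => I) (@Wn_e _ setT d I) Hf).
by move=> l /h; rewrite bohr_coef_e.
Qed.

Lemma inW_conj S f : inW S f -> inW (fun l => S (- l)) (fun x => (f x)^*).
Proof.
move=> [r H]; exists r => e /H[s [h1 h2 h3]]; exists (pconj s); split.
- by move=> t /mapP[u us ->] /=; rewrite opprK; apply: h1.
- by apply: le_trans h2; rewrite /nrm big_map; apply: ler_sum => t _ /=; rewrite cabs_conj.
by move=> x; rewrite ev_conj -rmorphB cabs_conj.
Qed.

(** Filtering the blocks of an absolutely convergent series by frequency keeps its bound. *)
Lemma inW_split S f : inW setT f ->
  exists f1 f2, [/\ inW S f1, inW (~` S) f2 & forall x, f x = f1 x + f2 x].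
Proof.
move=> [r H]; have [w [B [hw wB fE]]] := APW_rep (Wn_APW H).1 (Wn_APW H).2.
pose fw (P : set R) k := [seq t <- w k | `[< P t.2 >]].
have fwE (P : set R) n : psum (fw P) n = [seq t <- psum w n | `[< P t.2 >]].
  by elim: n => //= n ->; rewrite filter_cat.
have fwB P : pbounded (fw P) B.
  move=> n; rewrite fwE; apply: le_trans (wB n); rewrite /nrm big_filter.
  by rewrite [leRHS](bigID (fun t => `[< P t.2 >])) /= lerDl sumr_ge0 // => t _; apply: cabs_ge0.
have fwS (P : set R) k : freq_in P (fw P k).
  by move=> t; rewrite mem_filter => /andP[/asboolP].
have fwW (P : set R) : inW P (fun x => plim (fw P) (fun l => e_ l x)).
  by exists B; apply: (@rep_Wn _ _ _ (fw P)); split.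
exists (fun x => plim (fw S) (fun l => e_ l x)), (fun x => plim (fw (~` S)) (fun l => e_ l x)).
split=> // x; rewrite fE; apply: (plim_eq hw wB) => [l|e e0]; first exact: cabs_e_le.
have e2 : 0 < e / 2 by rewrite divr_gt0.
have [N1 h1] := plimP (fwS S) (fwB S) (cabs_e_le x (S := S)) e2.
have [N2 h2] := plimP (fwS (~` S)) (fwB (~` S)) (cabs_e_le x (S := ~` S)) e2.
exists (maxn N1 N2) => n; rewrite geq_max => /andP[/h1 k1 /h2 k2].
have -> : pchar (fun l => e_ l x) (psum w n) =
    pchar (fun l => e_ l x) (psum (fw S) n) + pchar (fun l => e_ l x) (psum (fw (~` S)) n).
  rewrite !fwE /pchar !big_filter (bigID (fun t => `[< S t.2 >])) /=; congr (_ + _).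
  by apply: eq_bigl => t; rewrite asbool_neg.
rewrite opprD addrACA; apply: le_trans (cabsD _ _) _; lra.
Qed.

Section Closure.
Variable S : set R.
Hypothesis S0 : S 0.
Hypothesis SD : forall l m : R, S l -> S m -> S (l + m).

Lemma inW_cst (c : C) : inW S (fun=> c).
Proof. by exists (cabs c); apply: Wn_cst. Qed.

Lemma inWD f g : inW S f -> inW S g -> inW S (fun x => f x + g x).
Proof. by move=> [r H] [r' H']; exists (r + r'); apply: WnD. Qed.

Lemma inWM f g : inW S f -> inW S g -> inW S (fun x => f x * g x).
Proof. by move=> [r H] [r' H']; exists (r * r'); apply: WnM. Qed.

Lemma inWN f : inW S f -> inW S (fun x => - f x).
Proof. by move=> H; apply: inW_ext (inWM (inW_cst (-1)) H) => x; rewrite mulN1r. Qed.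

Lemma inWB f g : inW S f -> inW S g -> inW S (fun x => f x - g x).
Proof. by move=> H /inWN; apply: inWD. Qed.

Lemma inW_cexp f : inW S f -> inW S (fun x => cexp (f x)).
Proof. by move=> [r H]; exists (expR r); apply: Wn_cexp. Qed.

Lemma inW_sum I (t : seq I) (P : pred I) (F : I -> R -> C) : (forall i, P i -> inW S (F i)) ->
  inW S (fun x => \sum_(i <- t | P i) F i x).
Proof.
move=> H; elim: t => [|i t IH].
  by apply: inW_ext (inW_cst 0) => x; rewrite big_nil.
case Pi: (P i); last by apply: inW_ext IH => x; rewrite big_cons Pi.
by apply: inW_ext (inWD (H i Pi) IH) => x; rewrite big_cons Pi.
Qed.

Lemma inW_prod I (t : seq I) (P : pred I) (F : I -> R -> C) : (forall i, P i -> inW S (F i)) ->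
  inW S (fun x => \prod_(i <- t | P i) F i x).
Proof.
move=> H; elim: t => [|i t IH].
  by apply: inW_ext (inW_cst 1) => x; rewrite big_nil.
case Pi: (P i); last by apply: inW_ext IH => x; rewrite big_cons Pi.
by apply: inW_ext (inWM (H i Pi) IH) => x; rewrite big_cons Pi.
Qed.

Lemma mx_in_mul m n p (A : R -> 'M[C]_(m, n)) (B : R -> 'M[C]_(n, p)) :
  mx_in (inW S) A -> mx_in (inW S) B -> mx_in (inW S) (fun x => A x *m B x).
Proof.
move=> HA HB i j.
apply: (@inW_ext _ (fun x => \sum_k A x i k * B x k j)) => [x|]; first by rewrite mxE.
by apply: inW_sum => k _; apply: inWM.
Qed.

Lemma mx_in_det n (A : R -> 'M[C]_n) : mx_in (inW S) A -> inW S (fun x => \det (A x)).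
Proof.
move=> HA; apply: inW_sum => s _; apply: inWM; first exact: inW_cst.
by apply: inW_prod.
Qed.

Lemma mx_in_adj n (A : R -> 'M[C]_n) : mx_in (inW S) A -> mx_in (inW S) (fun x => \adj (A x)).
Proof.
move=> HA i j.
apply: (@inW_ext _ (fun x => (-1) ^+ (j + i) * \det (row' j (col' i (A x))))) => [x|].
  by rewrite mxE.
apply: inWM; first exact: inW_cst.
apply: mx_in_det => k l.
by apply: inW_ext (HA (lift j k) (lift i l)) => x; rewrite !mxE.
Qed.

(** By the adjugate formula, the entries of the inverse are in the algebra as soon as the inverse b
    of the determinant is. *)
Lemma invertible_inP n (A : R -> 'M[C]_n) : invertible_in (inW S) A <->
  mx_in (inW S) A /\ exists2 b, inW S b & forall x, \det (A x) * b x = 1.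
Proof.
split=> [[HA UA IA]|[HA [b Hb bE]]].
  split=> //; exists (fun x => \det (invmx (A x))); first exact: mx_in_det.
  by move=> x; rewrite -det_mulmx mulmxV // det1.
have UA x : A x \in unitmx.
  by rewrite unitmxE; apply/unitrP; exists (b x); rewrite bE mulrC bE.
split=> // i j; apply: inW_ext (inWM Hb (mx_in_adj HA i j)) => x.
have db : (\det (A x))^-1 = b x.
  have d0 : \det (A x) != 0 by rewrite -unitfE -unitmxE.
  by apply: (mulfI d0); rewrite divff // bE.
by rewrite /invmx UA [RHS]mxE db.
Qed.

Lemma invertible_in_mul n (A B : R -> 'M[C]_n) : invertible_in (inW S) A ->
  invertible_in (inW S) B -> invertible_in (inW S) (fun x => A x *m B x).
Proof.
move=> /invertible_inP[HA [a Ha aE]] /invertible_inP[HB [b Hb bE]]; apply/invertible_inP.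
split; first exact: mx_in_mul.
exists (fun x => a x * b x) => [|x]; first exact: inWM.
by rewrite det_mulmx mulrACA aE bE mulr1.
Qed.

Lemma invertible_in_inv n (A : R -> 'M[C]_n) : invertible_in (inW S) A ->
  invertible_in (inW S) (fun x => invmx (A x)).
Proof.
move=> [HA UA IA]; split=> // [x|i j]; first by rewrite unitmx_inv.
by apply: inW_ext (HA i j) => x; rewrite invmxK.
Qed.

End Closure.

Lemma nonpos0 : nonpos 0. Proof. exact: lexx. Qed.

Lemma nonposD (l m : R) : nonpos l -> nonpos m -> nonpos (l + m).
Proof. by rewrite /nonpos /= => *; rewrite -oppr_ge0 opprD addr_ge0 ?oppr_ge0. Qed.

Lemma inW_shift_eq0 d a b : inW nonneg a -> inW nonpos b -> 0 < d ->
  (forall x, e_ d x * a x = b x) -> forall x, b x = 0.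
Proof.
move=> Ha Hb d0 ab; have Hb' := inW_ext ab (inW_shift d Ha).
apply: (inW_eq0 Hb Hb') => l; rewrite /nonpos /nonneg /= subr_ge0 => l0 h.
by have := le_trans h l0; rewrite leNgt d0.
Qed.

(** For d > 0 the spectra of e_d a and b are disjoint, so b = 0; for d < 0 the same applies to the
    inverses, as e_(-d) a' = b'. *)
Lemma inW_unit_shift d a a' b b' : inW nonneg a -> inW nonneg a' -> inW nonpos b ->
  inW nonpos b' -> (forall x, a x * a' x = 1) -> (forall x, b x * b' x = 1) ->
  (forall x, e_ d x * a x = b x) -> d = 0.
Proof.
move=> Ha Ha' Hb Hb' aa bb ab; apply/eqP; rewrite eq_le; apply/andP; split; rewrite leNgt; apply/negP.
  move=> d0; have b0 := inW_shift_eq0 Ha Hb d0 ab 0.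
  by have /eqP := bb 0; rewrite b0 mul0r eq_sym oner_eq0.
have inverse (E E' p p' q q' : C) : E' * E = 1 -> p * p' = 1 -> q * q' = 1 -> E * p = q ->
    E' * p' = q'.
  move=> h1 h2 h3 h4; rewrite -[LHS]mulr1 -h3 -h4.
  have -> : E' * p' * (E * p * q') = (E' * E) * (p * p') * q' by ring.
  by rewrite h1 h2 !mul1r.
rewrite -oppr_gt0 => d0; have ab' x := inverse _ _ _ _ _ _ (e_NK d x) (aa x) (bb x) (ab x).
have b0 := inW_shift_eq0 Ha' Hb' d0 ab' 0.
by have /eqP := bb 0; rewrite b0 mulr0 eq_sym oner_eq0.
Qed.

Lemma CP_bezoutm (v : R -> 'cV[C]_2) (h1 h2 : R -> C) :
  mx_in (inW nonpos) v -> inW nonpos h1 -> inW nonpos h2 ->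
  (forall x, v x 0 0 * h1 x + v x 1 0 * h2 x = 1) -> CP (@Cminus R) v.
Proof.
move=> Hv /inW_conj H1 /inW_conj H2 E.
have flip f : inW (fun l => nonpos (- l)) f -> inW nonneg f.
  by apply: inW_weaken => l; rewrite /nonpos /nonneg /= oppr_le0.
have [r3 {}H1] := flip _ H1; have [r4 {}H2] := flip _ H2.
have [r1 V1] := flip _ (inW_conj (Hv 0 0)); have [r2 V2] := flip _ (inW_conj (Hv 1 0)).
have H : CP (@Cplus R) (fun x => map_mx (@conjc R) (v x)).
  apply: (@CP_bezout _ _ _ _ r1 r2 r3 r4 _ _ H1 H2).
  - by apply: Wn_ext V1 => x; rewrite mxE.
  - by apply: Wn_ext V2 => x; rewrite mxE.
  by move=> x; rewrite !mxE -!rmorphM -rmorphD /= E rmorph1.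
have := @CP_conj _ (@Cplus R) (@Cminus R) _ _ H.
have -> : (fun x => map_mx (@conjc R) (map_mx (@conjc R) (v x))) = v.
  by apply/funext => x; apply/matrixP => i j; rewrite !mxE conjcK.
by apply=> z; rewrite /Defs.Cplus /Defs.Cminus /=; case: z => p q /=; rewrite oppr_gt0.
Qed.

Lemma bezoutm_CP (v : R -> 'cV[C]_2) : mx_in (inW nonpos) v -> CP (@Cminus R) v ->
  exists (h1 h2 : R -> C), [/\ inW nonpos h1, inW nonpos h2 &
    forall x, v x 0 0 * h1 x + v x 1 0 * h2 x = 1].
Proof.
move=> Hv Cv.
have flip f : inW nonpos f -> inW nonneg (fun x => (f x)^*).
  by move=> /inW_conj; apply: inW_weaken => l; rewrite /nonpos /nonneg /= oppr_le0.
have flip' f : inW nonneg f -> inW nonpos (fun x => (f x)^*).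
  by move=> /inW_conj; apply: inW_weaken => l; rewrite /nonpos /nonneg /= oppr_ge0.
pose u x := map_mx (@conjc R) (v x).
have tu : tilde 0 u = u.
  by apply/funext => x; rewrite /tilde oppr0 e_0 scale1r.
have Cu : CP (@Cplus R) (tilde 0 u).
  rewrite tu; apply: (CP_conj _ Cv) => z.
  by rewrite /Defs.Cplus /Defs.Cminus /=; case: z => p q /=; rewrite oppr_lt0.
have [r1 V1] := flip _ (Hv 0 0); have [r2 V2] := flip _ (Hv 1 0).
have U1 : Wn nonneg (fun x => u x 0 0) r1 by apply: Wn_ext V1 => x; rewrite mxE.
have U2 : Wn nonneg (fun x => u x 1 0) r2 by apply: Wn_ext V2 => x; rewrite mxE.
have [h1 [h2 [_ [_ [r5 [r6 [_ _ W1 W2 E]]]]]]] := bezout_CP U1 U2 (lexx 0) Cu.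
exists (fun x => (h1 x)^*), (fun x => (h2 x)^*); split.
- by apply: flip'; exists r5.
- by apply: flip'; exists r6.
move=> x; have := congr1 (@conjc R) (E x); rewrite tu !mxE rmorphD !rmorphM rmorph1 /=.
by rewrite !conjcK.
Qed.

End WienerClass.

Arguments nonpos {R}.

(** * Determinants and uniqueness of the partial indices *)

Section Factorization.
Variable R : realType.
Local Notation C := R[i].
Implicit Types (x d : R) (f g : R -> C).

Definition choose2 d1 d2 (j : 'I_2) : R := if j == 0 then d1 else d2.

Lemma ord2P (P : 'I_2 -> Prop) : P 0 -> P 1 -> forall j, P j.
Proof.
move=> P0 P1 [[|[|//]] j2]; first by rewrite (_ : Ordinal _ = 0) //; apply: val_inj.
by rewrite (_ : Ordinal _ = 1) //; apply: val_inj.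
Qed.

Lemma big_ord2 (F : 'I_2 -> C) : \sum_j F j = F 0 + F 1.
Proof. by rewrite !big_ord_recl big_ord0 addr0; congr (_ + F _); apply: val_inj. Qed.

Lemma det22 (A : 'M[C]_2) : \det A = A 0 0 * A 1 1 - A 0 1 * A 1 0.
Proof.
have l0 : lift 0 0 = 1 :> 'I_2 by apply: val_inj.
have l1 : lift 1 0 = 0 :> 'I_2 by apply: val_inj.
rewrite (expand_det_row _ 0) big_ord2 /cofactor !det_mx11 !mxE l0 l1 /=.
by rewrite /= expr0 expr1 mul1r mulN1r mulrN.
Qed.

Lemma mul_mx_diag_e m (A : 'M[C]_(m, 2)) d1 d2 x i j :
  (A *m diag_e d1 d2 x) i j = A i j * e_ (choose2 d1 d2 j) x.
Proof. by rewrite mul_mx_diag !mxE /choose2; case: ifP. Qed.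

Lemma mul_diag_e_mx n (A : 'M[C]_(2, n)) d1 d2 x i j :
  (diag_e d1 d2 x *m A) i j = e_ (choose2 d1 d2 i) x * A i j.
Proof. by rewrite mul_diag_mx !mxE /choose2; case: ifP. Qed.

Lemma det_diag_e d1 d2 x : \det (diag_e d1 d2 x) = e_ (d1 + d2) x :> C.
Proof. by rewrite det22 /diag_e !mxE /= mul0r subr0 e_D. Qed.

Variable G : R -> 'M[C]_2.

Lemma factorization_mul Gm Gp d1 d2 : APW_factorization G Gm Gp d1 d2 ->
  forall x, G x *m Gp x = Gm x *m diag_e d1 d2 x.
Proof. by move=> [[_ U _] _ E] x; rewrite E mulmxKV. Qed.

(** Otherwise every exponent of the second factorization exceeds the j-th of the first. With A =
    Gm'^-1 Gm and B = Gp'^-1 Gp one has A D = D' B, so each entry of column j of A is some e_t with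
    t > 0 times an element of APW+, hence 0, although A is invertible. *)
Lemma index_le Gm Gp d1 d2 Gm' Gp' d1' d2' : APW_factorization G Gm Gp d1 d2 ->
  APW_factorization G Gm' Gp' d1' d2' -> forall j, exists i, choose2 d1' d2' i <= choose2 d1 d2 j.
Proof.
move=> H H' j; apply: contrapT => nle.
have lt i : choose2 d1 d2 j < choose2 d1' d2' i.
  by rewrite ltNge; apply/negP => le; apply: nle; exists i.
have GE := factorization_mul H; have [Ip Im _] := H; have [Ip' Im' GE'] := H'.
rewrite APWpE in Ip Ip'; rewrite APWmE in Im Im'.
have [_ Um' _] := Im'.
have IA := invertible_in_mul (@nonpos0 R) (@nonposD R) (invertible_in_inv Im') Im.
have IB := invertible_in_mul (@nonneg0 R) (@nonnegD R) (invertible_in_inv Ip') Ip.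
pose A x := invmx (Gm' x) *m Gm x; pose B x := invmx (Gp' x) *m Gp x.
have AB x : A x *m diag_e d1 d2 x = diag_e d1' d2' x *m B x.
  by rewrite /A /B -mulmxA -GE GE' -!mulmxA mulKmx.
have [HA UA _] := IA; have [HB _ _] := IB.
have A0 i x : A x i j = 0.
  have dd : 0 < choose2 d1' d2' i - (choose2 d1 d2 j) by rewrite subr_gt0.
  apply: (inW_shift_eq0 (HB i j) (HA i j) dd) => u.
  have := congr1 (fun M : 'M[C]_2 => M i j) (AB u); rewrite mul_mx_diag_e mul_diag_e_mx => E.
  by rewrite addrC e_D -mulrA -/(B u) -E mulrCA e_NK mulr1.
have := congr1 (fun M : 'M[C]_2 => M j j) (mulVmx (UA 0)).
rewrite !mxE eqxx big1 => [/eqP|i _]; first by rewrite eq_sym oner_eq0.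
by rewrite -/(A 0) A0 mulr0.
Qed.

Variable delta : R.
Hypothesis hG : invertible_in (@APW R) G.
Hypothesis hdelta : mean_motion (fun x => \det (G x)) delta.

(* The logarithm of the determinant is split according to the sign of the frequencies. *)
Lemma det_factorization : exists p p' q q' : R -> C,
  [/\ inW nonneg p /\ inW nonneg p', inW nonpos q /\ inW nonpos q',
      forall x, p x * p' x = 1, forall x, q x * q' x = 1 &
      forall x, \det (G x) = e_ delta x * (q x * p x)].
Proof.
have [g Ag gE] := hdelta; have [HG _ _] := hG; rewrite APWE in HG.
have dG := mx_in_det (S := setT) I (fun _ _ _ _ => I) HG.
have [rg Wg] : inW setT (fun x => cexp (g x)).
  apply: (@inW_ext _ _ (fun x => e_ (- delta) x * \det (G x))) => [x|]; first by rewrite gE.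
  by apply: inW_weaken (inW_shift (- delta) dG).
have [gp [gm [Hp Hm gpm]]] := inW_split nonneg (APW_log Ag Wg).
have {}Hm : inW nonpos gm.
  by apply: inW_weaken Hm => l; rewrite /nonneg /nonpos /= => /negP; rewrite -ltNge => /ltW.
have expK (z : C) : cexp z * cexp (- z) = 1 by rewrite -cexpD subrr cexp0.
exists (fun x => cexp (gp x)), (fun x => cexp (- gp x)), (fun x => cexp (gm x)), (fun x => cexp (- gm x)).
split.
- by split; apply: (inW_cexp (@nonneg0 R) (@nonnegD R)) => //; apply: (inWN (@nonneg0 R) (@nonnegD R)).
- by split; apply: (inW_cexp (@nonpos0 R) (@nonposD R)) => //; apply: (inWN (@nonpos0 R) (@nonposD R)).
- by move=> x; apply: expK.
- by move=> x; apply: expK.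
by move=> x; rewrite -cexpD addrC -gpm gE mulrA e_KN mul1r.
Qed.

(** By the two formulas for det G, e_(delta - d1 - d2) times a unit of APW+ is a unit of APW-, which
    forces the exponent to be 0. *)
Lemma index_sum Gm Gp d1 d2 : APW_factorization G Gm Gp d1 d2 -> d1 + d2 = delta.
Proof.
move=> H; have GE := factorization_mul H; have [Ip Im _] := H.
rewrite APWpE in Ip; rewrite APWmE in Im.
have /(invertible_inP (@nonneg0 R) (@nonnegD R))[Hp [a' Ha' aE]] := Ip.
have /(invertible_inP (@nonpos0 R) (@nonposD R))[Hm [b' Hb' bE]] := Im.
have da := mx_in_det (@nonneg0 R) (@nonnegD R) Hp; have db := mx_in_det (@nonpos0 R) (@nonposD R) Hm.
have [p [p' [q [q' [[Wp Wp'] [Wq Wq'] pE qE dE]]]]] := det_factorization.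
suff : delta - (d1 + d2) = 0 by move=> /eqP; rewrite subr_eq0 => /eqP.
have inv (a b c d : C) : a * b = 1 -> c * d = 1 -> (a * c) * (b * d) = 1.
  by move=> h h'; rewrite mulrACA h h' mulr1.
apply: (inW_unit_shift (inWM (@nonnegD R) Wp da) (inWM (@nonnegD R) Wp' Ha') (inWM (@nonposD R) Wq' db)
  (inWM (@nonposD R) Wq Hb')) => x.
- by apply: inv.
- by apply: inv => //; rewrite mulrC.
have := congr1 determinant (GE x); rewrite !det_mulmx det_diag_e dE (e_D delta).
have key (u v v' c c' m m' k : C) : v * v' = 1 -> m * m' = 1 ->
    u * (m * c) * k = c' * v -> u * v' * (c * k) = m' * c'.
  move=> h1 h2 h3; have -> : m' * c' = m' * (c' * v) * v' by rewrite -!mulrA h1 mulr1.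
  rewrite -h3; have -> : m' * (u * (m * c) * k) * v' = (m * m') * (u * v' * (c * k)) by ring.
  by rewrite h2 mul1r.
exact: key (e_KN _ _) (qE x).
Qed.

End Factorization.

(** * Factorizations from solutions and conversely *)

Section Construction.
Variable R : realType.
Local Notation C := R[i].
Implicit Types (x d : R) (f g : R -> C).

Definition mx22 (a b c d : C) : 'M[C]_2 :=
  \matrix_(i, j) (if i == 0 then if j == 0 then a else b else if j == 0 then c else d).

Lemma det_mx22 (a b c d : C) : \det (mx22 a b c d) = a * d - b * c.
Proof. by rewrite det22 !mxE. Qed.

Lemma mx_in_mx22 S (a b c d : R -> C) : inW S a -> inW S b -> inW S c -> inW S d ->
  mx_in (inW S) (fun x => mx22 (a x) (b x) (c x) (d x)).
Proof.
move=> Ha Hb Hc Hd; apply: ord2P; apply: ord2P.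
- by apply: inW_ext Ha => x; rewrite mxE.
- by apply: inW_ext Hb => x; rewrite mxE.
- by apply: inW_ext Hc => x; rewrite mxE.
by apply: inW_ext Hd => x; rewrite mxE.
Qed.

(* In the bases (o, (-h2, h1)) and (s, (-k2, k1)) the matrix E g is triangular
   with diagonal entries T and T' q p; [al] and [be] remove the corner entry. *)
Lemma triangular_reduction (g00 g01 g10 g11 E E' T T' o0 o1 s0 s1 h1 h2 k1 k2 p p' q u1 u2 : C) :
  let y0 := E * (g01 * h1 - g00 * h2) in let y1 := E * (g11 * h1 - g10 * h2) in
  let al := - (T' * u1) in let be := T * u2 in
  E * E' = 1 -> T * T' = 1 -> p * p' = 1 ->
  E * (g00 * o0 + g01 * o1) = T * s0 -> E * (g10 * o0 + g11 * o1) = T * s1 ->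
  o0 * h1 + o1 * h2 = 1 -> s0 * k1 + s1 * k2 = 1 ->
  g00 * g11 - g01 * g10 = E' * E' * (q * p) ->
  p' * (k1 * y0 + k2 * y1) = u1 + u2 ->
  g00 * (al * o0 - p' * h2) + g01 * (al * o1 + p' * h1) = (be * s0 - q * k2) * (T' * E') /\
  g10 * (al * o0 - p' * h2) + g11 * (al * o1 + p' * h1) = (be * s1 + q * k1) * (T' * E').
Proof.
move=> y0 y1 al be EE TT pp H0 H1 oh sk dg uE.
pose c := s0 * y1 - s1 * y0.
have cE : c = T' * (q * p).
  have : T * c = q * p.
    have -> : T * c = (T * s0) * y1 - (T * s1) * y0 by rewrite /c; ring.
    rewrite -H0 -H1 /y0 /y1.
    have -> : E * (g00 * o0 + g01 * o1) * (E * (g11 * h1 - g10 * h2)) -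
      E * (g10 * o0 + g11 * o1) * (E * (g01 * h1 - g00 * h2)) =
      E * E * (g00 * g11 - g01 * g10) * (o0 * h1 + o1 * h2) by ring.
    rewrite oh dg mulr1; have -> : E * E * (E' * E' * (q * p)) = (E * E') * (E * E') * (q * p) by ring.
    by rewrite EE !mul1r.
  by move=> <-; rewrite mulrA [T' * T]mulrC TT mul1r.
have e0 : y0 = (k1 * y0 + k2 * y1) * s0 - k2 * c.
  by rewrite -[LHS]mulr1 -sk /c; ring.
have e1 : y1 = (k1 * y0 + k2 * y1) * s1 + k1 * c.
  by rewrite -[LHS]mulr1 -sk /c; ring.
have key ga gb s (X : C) : E * (ga * o0 + gb * o1) = T * s ->
    E * (gb * h1 - ga * h2) = (k1 * y0 + k2 * y1) * s + X * c ->
    ga * (al * o0 - p' * h2) + gb * (al * o1 + p' * h1) = (be * s + q * X) * (T' * E').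
  move=> K0 K1; rewrite -[LHS]mul1r -EE.
  have -> : E * E' * (ga * (al * o0 - p' * h2) + gb * (al * o1 + p' * h1)) =
    E' * (al * (E * (ga * o0 + gb * o1)) + p' * (E * (gb * h1 - ga * h2))) by ring.
  rewrite K0 K1 [p' * (_ + _)]mulrDr [p' * (_ * s)]mulrA uE /al /be cE.
  have -> : E' * (- (T' * u1) * (T * s) + ((u1 + u2) * s + p' * (X * (T' * (q * p))))) =
    E' * ((u1 + u2 - (T * T') * u1) * s + (p * p') * (X * T' * q)) by ring.
  have -> : (T * u2 * s + q * X) * (T' * E') = E' * ((T * T') * u2 * s + X * T' * q) by ring.
  by rewrite TT pp; ring.
split; first by rewrite -[- (q * k2)]mulrN; apply: key H0 _; rewrite mulNr.
exact: key H1 e1.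
Qed.

Variables (G : R -> 'M[C]_2) (delta : R).
Hypothesis hG : invertible_in (@APW R) G.
Hypothesis hdelta : mean_motion (fun x => \det (G x)) delta.

Lemma factorization_of_solution psip psim dt : RH_CP_solution G delta psip psim dt ->
  exists Gm Gp : R -> 'M[C]_2, [/\ APW_factorization G Gm Gp (- dt + delta / 2) (dt + delta / 2),
    forall x, col 0 (Gp x) = tilde dt psip x & forall x, col 0 (Gm x) = psim x].
Proof.
move=> [[Hp Hm Heq] dt0 CPp CPm]; rewrite APWpE in Hp; rewrite APWmE in Hm.
have [rp0 Hp0] := Hp 0 0; have [rp1 Hp1] := Hp 1 0.
have [h1 [h2 [r3 [r4 [r5 [r6 [To0 To1 Th1 Th2 oh]]]]]]] := bezout_CP Hp0 Hp1 dt0 CPp.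
have [k1 [k2 [Hk1 Hk2 sk]]] := bezoutm_CP Hm CPm.
have [p [p' [q [q' [[Wp Wp'] [Wq Wq'] pE qE dE]]]]] := det_factorization hG hdelta.
have [HG _ _] := hG; rewrite APWE in HG.
pose om i x := tilde dt psip x i 0; pose s i x := psim x i 0.
have Ho0 : inW nonneg (om 0) by exists r3.
have Ho1 : inW nonneg (om 1) by exists r4.
have Hh1 : inW nonneg h1 by exists r5.
have Hh2 : inW nonneg h2 by exists r6.
have Hs i : inW nonpos (s i) by apply: Hm.
have full S f : inW S f -> inW setT f by apply: inW_weaken.
have TM := @inWM _ setT (fun _ _ _ _ => I); have TD := @inWD _ (@setT R).
have TB := @inWB _ (@setT R) I (fun _ _ _ _ => I).
pose E x : C := e_ (- (delta / 2)) x.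
pose y i x := E x * (G x i 1 * h1 x - G x i 0 * h2 x).
have HE : inW setT E by exists 1; apply: Wn_e.
have Hy i : inW setT (y i).
  apply: (TM) => //; apply: (TB); apply: (TM); [exact: HG|exact: full Hh1|exact: HG|exact: full Hh2].
have Hu : inW setT (fun x => p' x * (k1 x * y 0 x + k2 x * y 1 x)).
  by apply: (TM); [apply: full Wp'|apply: (TD); apply: (TM) => //; [apply: full Hk1|apply: full Hk2]].
(* Frequencies >= -dt become nonnegative after multiplication by e_dt; those below -dt are moved by
   e_(-dt) below -2 dt, which is at most 0 because dt >= 0. *)
have [u1 [u2 [Hu1 Hu2 uE]]] := inW_split [set l | - dt <= l] Hu.
pose al x := - (e_ dt x * u1 x); pose be x : C := e_ (- dt) x * u2 x.
have Hal : inW nonneg al.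
  apply: inWN; [exact: nonneg0|exact: nonnegD|].
  by apply: inW_weaken (inW_shift dt Hu1) => l; rewrite /nonneg /= => h; lra.
have Hbe : inW nonpos be.
  apply: inW_weaken (inW_shift (- dt) Hu2) => l; rewrite /nonpos /= => /negP.
  by rewrite -ltNge => h; lra.
have PM := @inWM _ nonneg (@nonnegD R); have NM := @inWM _ nonpos (@nonposD R).
pose Gp x := mx22 (om 0 x) (al x * om 0 x - p' x * h2 x) (om 1 x) (al x * om 1 x + p' x * h1 x).
pose Gm x := mx22 (s 0 x) (be x * s 0 x - q x * k2 x) (s 1 x) (be x * s 1 x + q x * k1 x).
have ohE x : om 0 x * h1 x + om 1 x * h2 x = 1 by apply: oh.
have skE x : s 0 x * k1 x + s 1 x * k2 x = 1 by apply: sk.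
(* The second column of [Gp] is p' (-h2, h1) plus [al] times the first, so the Bezout equation gives
   the determinant p', whose inverse is p. Likewise [Gm] has determinant q. *)
have Ip : invertible_in (inW nonneg) Gp.
  apply/(invertible_inP (@nonneg0 R) (@nonnegD R)); split.
    apply: mx_in_mx22 => //; first by apply: (inWB (@nonneg0 R) (@nonnegD R)); apply: (PM).
    by apply: inWD; apply: (PM).
  exists p => // x; rewrite det_mx22 -[RHS](pE x).
  rewrite -[RHS]mulr1 -(ohE x); ring.
have Im : invertible_in (inW nonpos) Gm.
  apply/(invertible_inP (@nonpos0 R) (@nonposD R)); split.
    apply: mx_in_mx22 => //; first by apply: (inWB (@nonpos0 R) (@nonposD R)); apply: (NM).
    by apply: inWD; apply: (NM).
  exists q' => // x; rewrite det_mx22 -[RHS](qE x).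
  rewrite -[RHS]mulr1 -(skE x); ring.
have colE (M : R -> 'M[C]_2) (v : R -> 'cV[C]_2) : (forall x, M x 0 0 = v x 0 0) ->
    (forall x, M x 1 0 = v x 1 0) -> forall x, col 0 (M x) = v x.
  by move=> M0 M1 x; apply/matrixP => i j; rewrite ord1 mxE; move: i; apply: ord2P.
exists Gm, Gp; split; last 2 first.
- by apply: colE => x; rewrite mxE.
- by apply: colE => x; rewrite mxE.
split; [by rewrite APWpE|by rewrite APWmE|move=> x].
suff <- : G x *m Gp x = Gm x *m diag_e (- dt + delta / 2) (dt + delta / 2) x.
  by rewrite mulmxK //; have [_ U _] := Ip; apply: U.
have EE : E x * e_ (delta / 2) x = 1 by apply: e_NK.
have H i : E x * (G x i 0 * om 0 x + G x i 1 * om 1 x) = e_ (- dt) x * s i x.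
  have := congr1 (fun v : 'cV[C]_2 => v i 0) (Heq x); rewrite !mxE big_ord2 /s => <-.
  by rewrite /om /tilde !mxE -/(E x); ring.
have dg : G x 0 0 * G x 1 1 - G x 0 1 * G x 1 0 = e_ (delta / 2) x * e_ (delta / 2) x * (q x * p x).
  by rewrite -det22 dE -e_D; congr (e_ _ x * _); field.
have [K0 K1] := triangular_reduction EE (e_NK dt x) (pE x) (H 0) (H 1) (ohE x) (skE x) dg (uE x).
have diagE i j : (Gm x *m diag_e (- dt + delta / 2) (dt + delta / 2) x) i j =
    Gm x i j * ((if j == 0 then e_ (- dt) x else e_ dt x) * e_ (delta / 2) x).
  by rewrite mul_mx_diag_e /choose2; case: (j == 0); rewrite e_D.
have col0 i : G x i 0 * om 0 x + G x i 1 * om 1 x = s i x * (e_ (- dt) x * e_ (delta / 2) x).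
  by rewrite mulrA [s i x * _]mulrC -H mulrAC EE mul1r.
apply/matrixP; move=> i j; rewrite mxE big_ord2 diagE; move: i j.
by apply: ord2P; apply: ord2P; rewrite !mxE /=.
Qed.

Lemma solution_of_factorization : has_APW_factorization G ->
  exists psip psim dt, RH_CP_solution G delta psip psim dt.
Proof.
move=> [Gm [Gp [d1 [d2 H]]]]; have sumd := index_sum hG hdelta H.
have GE := factorization_mul H; have [Ip Im _] := H.
rewrite APWpE in Ip; rewrite APWmE in Im.
have [Hp Up Hip] := Ip; have [Hm Um Him] := Im.
(* The exponents sum to delta, so one of them is at most delta / 2; choosing it gives dt >= 0. *)
have [j jle] : exists j, choose2 d1 d2 j <= delta / 2.
  have [h|h] := leP d1 d2; [exists 0|exists 1]; rewrite /choose2 /=; lra.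
set dj := choose2 d1 d2 j in jle; pose dt := delta / 2 - dj.
have dt0 : 0 <= dt by rewrite subr_ge0.
exists (fun x => e_ dt x *: col j (Gp x)), (fun x => col j (Gm x)), dt.
have tE : tilde dt (fun x => e_ dt x *: col j (Gp x)) = fun x => col j (Gp x).
  by apply/funext => x; rewrite /tilde scalerA e_NK scale1r.
(* Row j of the inverse supplies the Bezout coefficients of column j. *)
have bez (M : 'M[C]_2) : M \in unitmx -> (col j M) 0 0 * invmx M j 0 + (col j M) 1 0 * invmx M j 1 = 1.
  move=> UM; have := congr1 (fun N : 'M[C]_2 => N j j) (mulVmx UM); rewrite !mxE eqxx big_ord2 mulr1n => <-.
  by rewrite ![_ * M _ _]mulrC.
split=> //; last first.
- apply: (@CP_bezoutm _ _ (fun x => invmx (Gm x) j 0) (fun x => invmx (Gm x) j 1)) => //.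
    by move=> i k; apply: inW_ext (Hm i j) => x; rewrite mxE.
  by move=> x; apply: bez.
- rewrite tE; have [r1 W1] := Hp 0 j; have [r2 W2] := Hp 1 j.
  have [r3 W3] := Hip j 0; have [r4 W4] := Hip j 1.
  apply: (CP_bezout _ _ W3 W4); last by move=> x; apply: bez.
    by apply: Wn_ext W1 => x; rewrite mxE.
  by apply: Wn_ext W2 => x; rewrite mxE.
split.
- rewrite APWpE => i k; apply: (@inW_ext _ _ (fun x => e_ dt x * Gp x i j)) => [x|].
    by rewrite !mxE.
  apply: inWM (Hp i j); first exact: nonnegD.
  by exists 1; apply: Wn_e.
- by rewrite APWmE => i k; apply: inW_ext (Hm i j) => x; rewrite mxE.
move=> x; apply/matrixP => i k; rewrite -scalemxAr scalerA !mxE.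
have := congr1 (fun N : 'M[C]_2 => N i j) (GE x); rewrite mul_mx_diag_e -/dj mxE => E.
under eq_bigr => l _ do rewrite mxE.
rewrite E mulrC -mulrA -!e_D (_ : dj + _ = 0) ?e_0 ?mulr1 //.
by rewrite /dt; lra.
Qed.

End Construction.

Theorem theorem3p8 (R : realType) (G : R -> 'M[R[i]]_2) (delta : R)
    (hG : invertible_in (@APW R) G)
    (hdelta : mean_motion (fun x => \det (G x)) delta) :
  (has_APW_factorization G <->
     exists psip psim dt, RH_CP_solution G delta psip psim dt) /\
  (forall (psip psim : R -> 'cV[R[i]]_2) (dt : R),
     RH_CP_solution G delta psip psim dt ->
     (forall d1 d2 : R, partial_AP_indices G d1 d2 <->
        d1 = - dt + delta / 2 /\ d2 = dt + delta / 2) /\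
     (exists Gm Gp : R -> 'M[R[i]]_2,
        [/\ APW_factorization G Gm Gp (- dt + delta / 2) (dt + delta / 2),
            forall x, col 0 (Gp x) = tilde dt psip x &
            forall x, col 0 (Gm x) = psim x])).
Proof.
split.
  split; first exact: solution_of_factorization hG hdelta.
  move=> [psip [psim [dt /(factorization_of_solution hG hdelta)[Gm [Gp [H _ _]]]]]].
  by exists Gm, Gp, (- dt + delta / 2), (dt + delta / 2).
move=> psip psim dt Hsol.
have [Gm [Gp [H c0 c1]]] := factorization_of_solution hG hdelta Hsol.
have [_ dt0 _ _] := Hsol; split; last by exists Gm, Gp.
move=> d1 d2; split; last first.
  by move=> [-> ->]; split; [lra|exists Gm, Gp; left].
(* Minimum and sum determine the unordered pair of exponents. The sum comes from the determinant,
   the minimum from [index_le] in both directions. *)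
have key Gm' Gp' (a b : R) : APW_factorization G Gm' Gp' a b ->
    Num.min a b = - dt + delta / 2 /\ a + b = delta.
  move=> H'; have sumE := index_sum hG hdelta H'; split=> //.
  apply/eqP; rewrite eq_le; apply/andP; split.
    have [ j ] := index_le H H' 0; rewrite /choose2 /=; apply: le_trans.
    by case: ifP => _; rewrite ge_min lexx ?orbT.
  have low i : - dt + delta / 2 <= choose2 a b i.
    have [k] := index_le H' H i; apply: le_trans; rewrite /choose2; case: ifP => _; lra.
  by have := low 0; have := low 1; rewrite /choose2 /= => h1 h2; rewrite le_min h1 h2.
move=> [d12 [Gm' [Gp' [/key|/key]]]]; rewrite ?[Num.min d2 d1]minC min_l // => -[-> e];
  by split=> //; lra.
Qed.
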